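(* Let $N\ge1$ and $0\le r\le N$. There exist constants $C_1,C_2>0$ such that for all $u\in L^1(T_N,\Lambda^r)$ with $du=0$ and all $L>0$ there exists $v\in L^\infty(T_N,\Lambda^r)$ with $dv=0$ and (i) $\|v\|_{L^\infty(T_N,\Lambda^r)}\le C_1L$; (ii) $|\{y\in T_N: v(y)\neq u(y)\}|\le \frac{C_2}{L}\int_{\{y\in T_N:|u(y)|>L\}}|u(y)|\,dy$; (iii) $\|v-u\|_{L^1(T_N,\Lambda^r)}\le C_2\int_{\{y\in T_N:|u(y)|>L\}}|u(y)|\,dy$.
   Context: $T_N=\mathbb R^N/\mathbb Z^N$ is the $N$-torus (functions on it identified with $\mathbb Z^N$-periodic functions), with Lebesgue measure $|\cdot|$. $\Lambda^r$ is the $r$-fold exterior power of $(\mathbb R^N)^*$ with the Euclidean norm $|\cdot|$ in the basis $\theta_{k_1}\wedge\dots\wedge\theta_{k_r}$ ($k_1<\dots<k_r$). $d$ is the exterior derivative, understood in the sense of distributions: $dw=0$ means $\int_{T_N}d\phi\wedge w=0$ for all $\phi\in C^\infty(T_N,\Lambda^{N-r-1})$. *)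

(* Defs.v *)
From HB Require Import structures.
From mathcomp Require Import all_boot all_order all_algebra.
From mathcomp Require Import all_classical all_reals all_analysis.
Import Order.TTheory GRing.Theory Num.Theory.
Import numFieldNormedType.Exports.

Set Implicit Arguments.
Unset Strict Implicit.
Unset Printing Implicit Defensive.

Local Open Scope classical_set_scope.
Local Open Scope ring_scope.

(* N-dimensional Lebesgue measure, built as an iterated product of the *)
(* one-dimensional Lebesgue measure (the library has no Lebesgue       *)
(* measure on 'rV[R]_N).                                               *)

Lemma prodm_sigma_finite (R : realType) d1 d2 (T1 : measurableType d1)
  (T2 : measurableType d2)
  (m1 : {sigma_finite_measure set T1 -> \bar R})
  (m2 : {sigma_finite_measure set T2 -> \bar R}) :
  sigma_finite setT (m1 \x m2)%E.
Proof.
have /sigma_finiteP[F [TF ndF Foo]] := sigma_finiteT m1.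
have /sigma_finiteP[G [TG ndG Goo]] := sigma_finiteT m2.
exists (fun n => F n `*` G n).
 rewrite -setXTT TF TG predeqE => -[x y]; split.
    move=> [/= [n _ Fnx] [k _ Gky]]; exists (maxn n k) => //; split.
    - by move: x Fnx; exact/subsetPset/ndF/leq_maxl.
    - by move: y Gky; exact/subsetPset/ndG/leq_maxr.
  by move=> [n _ []/= ? ?]; split; exists n.
move=> k; have [? ?] := Foo k; have [? ?] := Goo k.
split; first exact: measurableX.
by rewrite product_measure1E// lte_mul_pinfty// ge0_fin_numE.
Qed.

Section prodm.
Context d1 d2 (T1 : measurableType d1) (T2 : measurableType d2) (R : realType)
  (m1 : {sigma_finite_measure set T1 -> \bar R})
  (m2 : {sigma_finite_measure set T2 -> \bar R}).
Definition prodm : set (T1 * T2)%type -> \bar R := (m1 \x m2)%E.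
HB.instance Definition _ := Measure.copy prodm (m1 \x m2)%E.
HB.instance Definition _ := Measure_isSigmaFinite.Build _ _ _ prodm
  (@prodm_sigma_finite R _ _ _ _ m1 m2).
End prodm.

Record rspace (R : realType) (n : nat) := RSpace {
  rs_disp : measure_display;
  rs_type : measurableType rs_disp;
  rs_meas : {sigma_finite_measure set rs_type -> \bar R};
  rs_coord : rs_type -> 'rV[R]_n }.

(* lebR R n : R^n realised as R * (R * (... * unit)), with the product
   Lebesgue measure, and the (bijective) coordinate map to 'rV[R]_n *)
Fixpoint lebR (R : realType) (n : nat) : rspace R n :=
  match n return rspace R n with
  | 0 => @RSpace R 0 _ unit (@dirac _ unit tt R) (fun _ => 0)
  | n'.+1 => let P := lebR R n' in
     @RSpace R n'.+1 _ _ (@prodm _ _ _ _ R (@lebesgue_measure R) (rs_meas P))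
       (fun xy => \row_(i < n'.+1)
          match unlift ord0 i with
          | None => (xy.1 : R)
          | Some j => @rs_coord _ _ P xy.2 0 j end)
  end.

Definition RN (R : realType) (N : nat) := rs_type (lebR R N).
Definition lebN (R : realType) (N : nat) := rs_meas (lebR R N).
Definition coordN (R : realType) (N : nat) : RN R N -> 'rV[R]_N :=
  @rs_coord _ _ (lebR R N).

(* the fundamental domain [0,1)^N of T_N = R^N / Z^N *)
Definition cubeN (R : realType) (N : nat) : set (RN R N) :=
  [set x | forall i : 'I_N, 0 <= coordN x 0 i < 1].
Arguments cubeN : clear implicits.

(* r-element subsets of {0,..,N-1} index the basis theta_{k_1}/\../\theta_{k_r} *)
Definition kset (N r : nat) := {I : {set 'I_N} | #|I| == r}.

(* an element of Lambda^r : its coordinates in the standard basis *)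
Definition lamform (R : realType) (N r : nat) := kset N r -> R.

Definition lamnorm (R : realType) (N r : nat) (w : lamform R N r) : R :=
  Num.sqrt (\sum_(I : kset N r) w I ^+ 2).

(* coefficient of an r-form on an arbitrary set of indices (0 if wrong size) *)
Definition fext (R : realType) (N r : nat) (w : lamform R N r) (I : {set 'I_N}) : R :=
  if (insub I : option (kset N r)) is Some J then w J else 0.

(* theta_A /\ theta_B = wsign A B * theta_(A :|: B) for disjoint A, B *)
Definition wsign (R : realType) (N : nat) (A B : {set 'I_N}) : R :=
  (-1) ^+ #|[set p : 'I_N * 'I_N | (p.1 \in A) && (p.2 \in B) && (p.2 < p.1)%N]|.

(* coefficient of a /\ w on theta_1 /\ ... /\ theta_N  (for p + r = N) *)
Definition wedge_top (R : realType) (N p r : nat) (a : lamform R N p) (w : lamform R N r) : R :=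
  \sum_(I : kset N r) wsign R (~: val I) (val I) * fext a (~: val I) * w I.

Definition evec (R : realType) (N : nat) (k : 'I_N) : 'rV[R]_N := delta_mx 0 k.

Definition pderiv (R : realType) (N : nat) (k : 'I_N) (f : 'rV[R]_N -> R) :
  'rV[R]_N -> R := fun x => 'D_(evec R k) f x.

Fixpoint pderivs (R : realType) (N : nat) (s : seq 'I_N) (f : 'rV[R]_N -> R) :
  'rV[R]_N -> R :=
  match s with [::] => f | k :: s' => pderiv k (pderivs s' f) end.

Definition smooth_fun (R : realType) (N : nat) (f : 'rV[R]_N -> R) : Prop :=
  forall s : seq 'I_N, continuous (pderivs s f) /\
    forall (k : 'I_N) (x : 'rV[R]_N), derivable (pderivs s f) x (evec R k).

(* Z^N-Zperiodic functions = functions on T_N *)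
Definition Zperiodic (R : realType) (N : nat) (T : Type) (f : 'rV[R]_N -> T) : Prop :=
  forall (k : 'I_N) (x : 'rV[R]_N), f (x + evec R k) = f x.

Definition test_form (R : realType) (N s : nat) (phi : 'rV[R]_N -> lamform R N s) : Prop :=
  Zperiodic phi /\ forall I : kset N s, smooth_fun (fun x => phi x I).

Definition dform (R : realType) (N s : nat) (phi : 'rV[R]_N -> lamform R N s)
  (x : 'rV[R]_N) : lamform R N s.+1 :=
  fun J => \sum_(k in val J)
    wsign R [set k] (val J :\ k) * pderiv k (fun y => fext (phi y) (val J :\ k)) x.

(* dw = 0 in the sense of distributions on T_N:
   int_{T_N} d phi /\ w = 0 for all phi in C^infty(T_N, Lambda^{N-r-1})
   (vacuous when r = N) *)
Definition dclosed (R : realType) (N r : nat) (w : 'rV[R]_N -> lamform R N r) : Prop :=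
  forall (s : nat) (phi : 'rV[R]_N -> lamform R N s),
    (s.+1 + r)%N = N -> test_form phi ->
    (\int[lebN R N]_(x in cubeN R N)
        (wedge_top (dform phi (coordN x)) (w (coordN x)))%:E = 0)%E.

Definition meas_form (R : realType) (N r : nat) (w : 'rV[R]_N -> lamform R N r) : Prop :=
  Zperiodic w /\
  forall I : kset N r, measurable_fun (cubeN R N) (fun x => w (coordN x) I).

Definition L1form (R : realType) (N r : nat) (w : 'rV[R]_N -> lamform R N r) : Prop :=
  meas_form w /\
  (\int[lebN R N]_(x in cubeN R N) (lamnorm (w (coordN x)))%:E < +oo)%E.

Definition lamsub (R : realType) (N r : nat) (v w : lamform R N r) : lamform R N r :=
  fun I => v I - w I.

(* Main.v *)
(* Let u_j be the mollification of u at scale 2^-j. As u is closed, a homotopy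
   operator with kernels of size 2^-j gives forms w_j with d w_j = u_j - u_(j+1),
   built from u at distance O(2^-j), hence u = u_0 - sum_j d w_j. Call a dyadic
   cube bad if the mean over it of f = |u| 1_(|u| > L) exceeds L, and stop the sum near
   the bad cubes: put V_n = u_0 - sum_(j < n) d (chi_j w_j), where the cutoff chi_j
   (gradient O(2^j)) vanishes on the stopping set of scale j and equals 1 off the
   slightly larger one of scale j + 2. Every V_n is closed. Where chi_j <> 0 the
   mass of u at scale 2^-j is O(L), so |V_n| = O(L): away from the stopping sets
   V_n = u_n, and at a stopped point only boundedly many terms differ from
   u_j - u_(j+1). The V_n converge in L^1 to a form v equal to u off the stopping
   sets, whose union lies in fixed dilates of the maximal bad cubes and so has measure
   O(L^-1 int f). If the unit cube itself is bad, v = 0 works. *)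

Require Import Defs.
From HB Require Import structures.
From mathcomp Require Import all_boot all_order all_algebra.
From mathcomp Require Import all_classical all_reals all_analysis.
From mathcomp Require Import ring lra zify measurable_realfun.
Import Order.TTheory GRing.Theory Num.Theory.
Import numFieldNormedType.Exports.
Set Implicit Arguments.
Unset Strict Implicit.
Unset Printing Implicit Defensive.
Local Open Scope classical_set_scope.
Local Open Scope ring_scope.

(** Truncating [u] pointwise destroys [du = 0], so the cutoffs multiply potentials, at the price of
    a term d chi_j /\ w_j. It is affordable because in each summand of w_j one of the N kernel
    factors is a primitive, of size 1 instead of 2^j: thus |w_j| = O(2^-j L), which cancels the
    O(2^j) gradient. All kernels come from one function, the staircase [pstep M], a smoothed integer
    part that rises by 1 in a window of width O(1/M) around each integer. Its derivative is a
    periodic mollifier of mass 1, the difference of two scales is a periodic primitive of the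
    difference of two mollifiers, and differences of translates form a partition of unity, from
    which the cutoffs are made. Tensor products of such functions reduce partial derivatives in R^N
    to derivatives on the line. The bound for v off the stopping sets comes from L^1 convergence: v
    is the limit of forms bounded by one and the same constant. Forms are handled as families
    indexed by all subsets of the coordinates, and closedness is tested one index set at a time. *)

(** * Smooth functions on the line and a smooth step *)

Section smooth_line.
Variable R : realType.
Implicit Types (f g : R -> R) (x d : R).

Lemma is_derive1E f (x d : R) : is_derive x 1 f d -> derivable f x 1 /\ (derive1 f) x = d.
Proof. by move=> fd; split; [exact: ex_derive|rewrite derive1E; exact: derive_val]. Qed.

Lemma derivable1_is_derive f (x : R) : derivable f x 1 -> is_derive x 1 f ((derive1 f) x).
Proof. by move=> fx; apply: DeriveDef => //; rewrite derive1E. Qed.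

Lemma derive1_ext f (df : R -> R) : (forall x : R, is_derive x 1 f (df x)) -> (derive1 f) = df.
Proof. by move=> fd; apply/funext => x; have [] := is_derive1E (fd x). Qed.

Fixpoint Cn n f : Prop :=
  if n is m.+1 then (forall x, derivable f x 1) /\ Cn m (derive1 f) else True.

Definition smooth1 f := forall n, Cn n f.

Lemma CnW n f : Cn n.+1 f -> Cn n f.
Proof. by elim: n f => // n IH f [df /IH]. Qed.

Lemma smooth1_derivable f (x : R) : smooth1 f -> derivable f x 1.
Proof. by move=> /(_ 1%N)[]. Qed.

Lemma smooth1_is_derive f (x : R) : smooth1 f -> is_derive x 1 f ((derive1 f) x).
Proof. by move=> /smooth1_derivable /derivable1_is_derive. Qed.

Lemma smooth1_derive f : smooth1 f -> smooth1 (derive1 f).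
Proof. by move=> sf n; have [] := sf n.+1. Qed.

Lemma smooth1_continuous f : smooth1 f -> continuous f.
Proof.
by move=> sf x; apply: differentiable_continuous; apply/derivable1_diffP; exact: smooth1_derivable.
Qed.

(** Coinduction for smoothness: to prove a function smooth it suffices to exhibit a class that
    contains it and is stable under differentiation. *)
Lemma smooth1_coind (S : set (R -> R)) :
  (forall f, S f -> exists2 df, (forall x : R, is_derive x 1 f (df x)) & S df) ->
  forall f, S f -> smooth1 f.
Proof.
move=> SP f Sf n; elim: n f Sf => // n IH f Sf.
have [df fd Sdf] := SP f Sf.
by split => [x|]; [have [] := is_derive1E (fd x)|rewrite (derive1_ext fd); exact: IH].
Qed.

Lemma smooth1_cst (c : R) : smooth1 (cst c).
Proof.
apply: (@smooth1_coind [set f | exists c, f = cst c]); last by exists c.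
move=> _ [{}c ->]; exists (cst 0); last by exists 0.
by move=> x; exact: is_derive_cst.
Qed.

Lemma smooth1N f : smooth1 f -> smooth1 (fun x => - f x).
Proof.
move=> sf; apply: (@smooth1_coind [set h | exists2 f, smooth1 f & h = - f]); last by exists f.
move=> _ [{sf}f sf ->]; exists (- (derive1 f)).
  by move=> x; apply: is_deriveN; exact: smooth1_is_derive.
by exists (derive1 f) => //; exact: smooth1_derive.
Qed.

Lemma CnD n f g : Cn n f -> Cn n g -> Cn n (f + g).
Proof.
elim: n f g => // n IH f g [df cf] [dg cg]; split => [x|]; first exact: derivableD.
rewrite (_ : derive1 (f + g) = (derive1 f) + (derive1 g)); first exact: IH.
by apply: derive1_ext => x; apply: is_deriveD; exact: derivable1_is_derive.
Qed.

Lemma smooth1D f g : smooth1 f -> smooth1 g -> smooth1 (fun x => f x + g x).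
Proof. by move=> sf sg n; exact: CnD. Qed.

Lemma CnM n f g : Cn n f -> Cn n g -> Cn n (f * g).
Proof.
elim: n f g => // n IH f g cf cg; have [df cf'] := cf; have [dg cg'] := cg.
split => [x|]; first exact: derivableM.
rewrite (_ : derive1 (f * g) = f * (derive1 g) + g * (derive1 f)).
  by apply: CnD; apply: IH => //; exact: CnW.
by apply: derive1_ext => x; apply: is_deriveM; exact: derivable1_is_derive.
Qed.

Lemma smooth1M f g : smooth1 f -> smooth1 g -> smooth1 (fun x => f x * g x).
Proof. by move=> sf sg n; exact: CnM. Qed.

Lemma smooth1V f : (forall x, f x != 0) -> smooth1 f -> smooth1 (fun x => (f x)^-1).
Proof.
move=> f0 sf n; have := sf n; elim: n => // n IH [df cf].
have Vd (x : R) : is_derive x 1 (fun x => (f x)^-1) (- ((f x)^-1 * (f x)^-1 * derive1 f x)).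
  have := @is_deriveV _ f x (derive1 f x) 1 (f0 x) (derivable1_is_derive (df x)).
  by rewrite [_ *: _]mulNr expr2 invfM.
split => [x|]; first by have [] := is_derive1E (Vd x).
rewrite (derive1_ext Vd) (_ : (fun x => _) =
  cst (-1) * (((fun x => (f x)^-1) * (fun x => (f x)^-1)) * derive1 f)); last first.
  by apply/funext => x; rewrite !fctE mulN1r.
have IHn : Cn n (fun x => (f x)^-1) by apply: IH; have := sf n.
by apply: CnM; [exact: smooth1_cst|apply: CnM => //; exact: CnM].
Qed.

Lemma is_derive_affine f (a b x d : R) : is_derive (a * x + b) 1 f d ->
  is_derive x 1 (fun x => f (a * x + b)) (a * d).
Proof.
move=> fd; have gd : is_derive x 1 (fun x : R => a * x + b) a.
  have := is_deriveD (is_deriveZ a (is_derive_id x (1 : R))) (is_derive_cst b x (1 : R)).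
  by rewrite addr0 [_ *: _]mulr1.
by rewrite [a * d]mulrC; exact: (@is_derive1_comp _ f (fun x => a * x + b)).
Qed.

Lemma smooth1_affine f (a b : R) : smooth1 f -> smooth1 (fun x => f (a * x + b)).
Proof.
suff H n : forall f, Cn n f -> Cn n (fun x => f (a * x + b)) by move=> sf n; exact: H.
elim: n => // n IH {}f [df cf].
have fd x : is_derive x 1 (fun x => f (a * x + b)) (a * (derive1 f) (a * x + b)).
  by apply: is_derive_affine; exact: derivable1_is_derive.
split => [x|]; first by have [] := is_derive1E (fd x).
rewrite (derive1_ext fd).
suff Z (c : R) h : Cn n h -> Cn n (fun x => c * h x) by exact/Z/IH.
clear; elim: n h => // n IH h [dh ch].
have hd x : is_derive x 1 (fun x => c * h x) (c * (derive1 h) x).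
  by apply: is_deriveZ; exact: derivable1_is_derive.
split => [x|]; first by have [] := is_derive1E (hd x).
by rewrite (derive1_ext hd); exact: IH.
Qed.

Lemma is_derive_local f g (x d : R) : (exists2 e : R, 0 < e & forall y, `|y - x| < e -> f y = g y) ->
  is_derive x 1 f d -> is_derive x 1 g d.
Proof.
move=> [e e0 fg]; apply: near_eq_is_derive.
by apply/nbhs_ballP; exists e => //= y; rewrite /ball/= distrC; exact: fg.
Qed.

Lemma smooth1_local f : (forall x, exists2 g, smooth1 g &
  exists2 e : R, 0 < e & forall y, `|y - x| < e -> f y = g y) -> smooth1 f.
Proof.
pose S := [set f : R -> R | forall x, exists2 g, smooth1 g &
  exists2 e : R, 0 < e & forall y, `|y - x| < e -> f y = g y].
move=> Sf; apply: (@smooth1_coind S) => // {Sf}f Sf.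
have fd x : is_derive x 1 f ((derive1 f) x).
  apply: derivable1_is_derive; have [g sg [e e0 fg]] := Sf x.
  suff : is_derive x 1 f ((derive1 g) x) by case/is_derive1E.
  apply: (@is_derive_local g); last exact: smooth1_is_derive.
  by exists e => // y /fg ->.
exists (derive1 f) => // x; have [g sg [e e0 fg]] := Sf x.
exists (derive1 g); first exact: smooth1_derive.
exists e => // y yx; suff : is_derive y 1 f ((derive1 g) y) by case/is_derive1E.
apply: (@is_derive_local g); last exact: smooth1_is_derive.
exists (e - `|y - x|); first by rewrite subr_gt0.
move=> z zy; rewrite fg// (le_lt_trans (ler_distD y _ _))//.
by rewrite -ltrBrDr.
Qed.

(** The difference quotient at x is at most |C| |h|. This gives the derivative of [flat] at 0, where
    its two branches meet. *)
Lemma is_derive_quadratic_contact (f : R -> R) (x C : R) :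
  (forall y, `|f y| <= C * (y - x) ^+ 2) -> is_derive x 1 f 0.
Proof.
move=> fC.
have fx0 : f x = 0.
  by apply/eqP; rewrite -normr_le0; have := fC x; rewrite subrr expr0n mulr0.
have cf : h^-1 *: ((f \o shift x) (h *: 1) - f x) @[h --> 0^'] --> (0 : R).
  apply/cvgrPdist_le => e e0; rewrite /= fx0.
  near=> h; rewrite sub0r normrN subr0 normrM normfV scaler1.
  have h0 : h != 0 by near: h; exact: nbhs_dnbhs_neq.
  rewrite mulrC ler_pdivrMr ?normr_gt0// (le_trans (fC _))// addrK.
  rewrite -real_normK ?num_real// expr2 mulrA ler_wpM2r//.
  rewrite (le_trans (ler_wpM2r _ (ler_norm C)))//.
  have C1 : 0 < `|C| + 1 by rewrite ltr_wpDl.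
  rewrite (@le_trans _ _ ((`|C| + 1) * `|h|))//.
    by rewrite ler_wpM2r// lerDl.
  rewrite mulrC -ler_pdivlMr//; near: h; apply: dnbhs0_le.
  by rewrite divr_gt0.
by apply: DeriveDef; [apply/cvg_ex; exists 0|exact: cvg_lim].
Unshelve. all: by end_near. Qed.

Lemma horner_le_expR (p : {poly R}) :
  exists C : R, forall s, 0 <= s -> `|p.[s]| <= C * expR s.
Proof.
exists (\sum_(i < size p) `|p`_i| * i`!%:R) => s s0.
rewrite horner_coef (le_trans (ler_norm_sum _ _ _))// mulr_suml ler_sum// => i _.
rewrite normrM -mulrA ler_wpM2l// normrX ger0_norm//.
case: (i : nat) => [|n]; first by rewrite expr0 mul1r (le_trans _ (expR_ge1Dx _))// lerDl.
rewrite mulrC -ler_pdivrMr ?ltr0n ?fact_gt0//.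
by rewrite (le_trans _ (expR_ge1Dxn n s0))// lerDr.
Qed.

(** The polynomial factor makes the class stable under differentiation: the derivative of [flat p]
    is [flat] of X^2 (p - p'). *)
Definition flat (p : {poly R}) (t : R) : R :=
  if 0 < t then p.[t^-1] * expR (- t^-1) else 0.

Lemma flat_le_sqr p : exists C : R, forall t, `|flat p t| <= C * t ^+ 2.
Proof.
(* With s = 1/t, the extra factor s^2 turns the bound C exp(s) into |p(s)| exp(-s) <= C / s^2 = C
   t^2. *)
have [C Cp] := horner_le_expR (p * 'X^2); exists C => t; rewrite /flat.
have C0 : 0 <= C by have := Cp 0 (lexx 0); rewrite expR0 mulr1; exact: le_trans.
case: ltP => [t0|_]; last by rewrite normr0 mulr_ge0// sqr_ge0.
have /Cp : 0 <= t^-1 by rewrite invr_ge0 ltW.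
rewrite hornerM hornerXn normrM [in `|_ ^+ 2|]ger0_norm; last first.
  by rewrite exprn_ge0// invr_ge0 ltW.
rewrite exprVn ler_pdivrMr ?exprn_gt0// => Ct.
rewrite normrM (ger0_norm (expR_ge0 _)) expRN ler_pdivrMr ?expR_gt0//.
by rewrite mulrAC.
Qed.

Lemma is_derive_flat p (t : R) :
  is_derive t 1 (flat p) (flat ('X^2 * (p - p^`())) t).
Proof.
have [t0|t0|->] := ltgtP t 0.
- rewrite {2}/flat ltNge (ltW t0)/=.
  apply: (@is_derive_local (cst 0)).
  exists (- t); first by rewrite oppr_gt0.
  move=> y; rewrite ltr_norml => /andP[_ yt]; rewrite /flat ltNge.
  by rewrite (_ : y <= 0)//; lra.
- have dV : is_derive t 1 (fun y : R => y^-1) (- t ^- 2).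
    have := @is_deriveV _ id t 1 1; rewrite /= [_ *: _]mulr1; apply => //.
    by rewrite gt_eqF.
  have dp : is_derive t 1 (fun y : R => p.[y^-1]) (p^`().[t^-1] * (- t ^- 2)).
    apply: (@is_derive1_comp _ (horner p) (fun y => y^-1)) dV.
  have de : is_derive t 1 (fun y : R => expR (- y^-1)) (expR (- t^-1) * t ^- 2).
    apply: (@is_derive1_comp _ expR (fun y => - y^-1)).
    by have := is_deriveN dV; rewrite opprK.
  have := is_deriveM dp de; rewrite {2}/flat t0.
  set d := (X in is_derive _ _ _ X -> _) => dd.
  rewrite (_ : _ * _ = d); last first.
    rewrite /d hornerM hornerXn hornerD hornerN exprVn.
    by rewrite /GRing.scale/=; ring.
  apply: is_derive_local dd; exists t => // y.
  rewrite ltr_norml /flat => /andP[yt _]; rewrite ifT//.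
  by move: yt; rewrite ltrBrDr addNr.
- rewrite {2}/flat ltxx; have [C fC] := flat_le_sqr p.
  by apply: (@is_derive_quadratic_contact _ _ C) => y; rewrite subr0.
Qed.

Lemma smooth1_flat p : smooth1 (flat p).
Proof.
apply: (@smooth1_coind [set f | exists p, f = flat p]); last by exists p.
move=> _ [q ->]; exists (flat ('X^2 * (q - q^`()))); last by eexists.
by move=> x; exact: is_derive_flat.
Qed.

(** The classical smooth step built from exp(-1/t). Its variation is confined to [-1/4, 1/4], so
    that the steps placed at consecutive integers do not overlap. *)
Definition sstep (t : R) : R :=
  flat 1 (t + 4^-1) / (flat 1 (t + 4^-1) + flat 1 (4^-1 - t)).

Lemma flat1_ge0 t : 0 <= flat 1 t.
Proof. by rewrite /flat; case: ifP => // _; rewrite hornerC mul1r expR_ge0. Qed.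

Lemma flat1_gt0 t : 0 < t -> 0 < flat 1 t.
Proof. by rewrite /flat => ->; rewrite hornerC mul1r expR_gt0. Qed.

Lemma flat_le0 p t : t <= 0 -> flat p t = 0.
Proof. by rewrite /flat ltNge => ->. Qed.

Lemma sstep_den t : 0 < flat 1 (t + 4^-1) + flat 1 (4^-1 - t).
Proof.
have [t0|t0] := leP t 0.
  by rewrite ltr_wpDl ?flat1_ge0// flat1_gt0//; lra.
by rewrite ltr_pwDl ?flat1_ge0// flat1_gt0//; lra.
Qed.

Lemma smooth1_sstep : smooth1 sstep.
Proof.
have sl : smooth1 (fun t => flat 1 (t + 4^-1)).
  have := @smooth1_affine _ 1 (4^-1) (smooth1_flat 1).
  by under eq_fun do rewrite mul1r.
have sr : smooth1 (fun t => flat 1 (4^-1 - t)).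
  have := @smooth1_affine _ (-1) (4^-1) (smooth1_flat 1).
  by under eq_fun do rewrite mulN1r addrC.
apply: smooth1M => //; apply: smooth1V => [t|]; last exact: smooth1D.
by rewrite gt_eqF// sstep_den.
Qed.

Lemma sstep0 t : t <= - 4^-1 -> sstep t = 0.
Proof. by move=> t4; rewrite /sstep flat_le0 ?mul0r//; lra. Qed.

Lemma sstep1 t : 4^-1 <= t -> sstep t = 1.
Proof.
move=> t4; rewrite /sstep (_ : flat 1 (4^-1 - t) = 0); last by rewrite flat_le0//; lra.
by rewrite addr0 divff// gt_eqF// flat1_gt0//; lra.
Qed.

Lemma sstep_ge0_le1 t : 0 <= sstep t <= 1.
Proof.
rewrite divr_ge0 ?flat1_ge0 ?(ltW (sstep_den _))//=.
by rewrite ler_pdivrMr ?sstep_den// mul1r lerDl flat1_ge0.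
Qed.

Lemma derive_sstep0 t : 4^-1 < `|t| -> derive1 sstep t = 0.
Proof.
move=> t4; have tt : 0 < `|t| - 4^-1 by rewrite subr_gt0.
suff : is_derive t 1 sstep 0 by case/is_derive1E.
have [t0|t0] := leP 0 t.
  apply: (@is_derive_local (cst 1)); exists (`|t| - 4^-1) => // y.
  rewrite ltr_norml ger0_norm// => /andP[ty _]; rewrite sstep1//; lra.
apply: (@is_derive_local (cst 0)); exists (`|t| - 4^-1) => // y.
rewrite ltr_norml ltr0_norm// => /andP[_ ty]; rewrite sstep0//; lra.
Qed.

Lemma continuous_bounded_itv (f : R -> R) (a b : R) : a <= b -> continuous f ->
  exists B : R, forall t, a <= t <= b -> `|f t| <= B.
Proof.
move=> ab cf; have cnf : {within `[a, b], continuous (fun x => `|f x|)}.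
  apply: continuous_subspaceT => x.
  by apply: continuous_comp; [exact: cf|exact: norm_continuous].
have [c _ cB] := EVT_max ab cnf.
by exists `|f c| => t tab; apply: cB; rewrite in_itv/=.
Qed.

Lemma derive_sstep_bounded : exists B : R, forall t, `|derive1 sstep t| <= B.
Proof.
have [|B HB] := @continuous_bounded_itv (derive1 sstep) (-1) 1 _
  (smooth1_continuous (smooth1_derive smooth1_sstep)); first lra.
exists B => t; have [t1|t1] := leP `|t| 1.
  by apply: HB; rewrite -ler_norml.
rewrite derive_sstep0; last lra.
by rewrite normr0 (le_trans _ (HB 0 _))//; lra.
Qed.

End smooth_line.

(** * The circle R / Z: distance to the integers and the smoothed staircase *)

Section circle.
Variable R : realType.
Implicit Types s t : R.

Definition nint (t : R) : int := Num.floor (t + 2^-1).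

(** The distance from t to Z, that is, the distance on R / Z between the class of t and 0. *)
Definition cdist (t : R) : R := `|t - (nint t)%:~R|.

Lemma cdist_ge0 t : 0 <= cdist t.
Proof. exact: normr_ge0. Qed.

Lemma cdist_le_half t : cdist t <= 2^-1.
Proof.
have /andP[] := floor_itv (t + 2^-1); rewrite -/(nint t) intrD ler_norml => a b.
by apply/andP; split; lra.
Qed.

Lemma int_dist_lt1 (m n : int) : `|m%:~R - n%:~R : R| < 1 -> m = n.
Proof.
rewrite -intrB -intr_norm -[1]/(1%:~R) ltr_int => mn.
by lia.
Qed.

Lemma cdist_le t (n : int) : cdist t <= `|t - n%:~R|.
Proof.
rewrite leNgt; apply/negP => nt.
suff nE : n = nint t by move: nt; rewrite nE ltxx.
apply: int_dist_lt1; have := cdist_le_half t; move: nt; rewrite /cdist.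
rewrite (_ : n%:~R - _ = (t - (nint t)%:~R) - (t - n%:~R)); last ring.
move=> nt t2; rewrite (le_lt_trans (ler_normB _ _))//; lra.
Qed.

Lemma cdist_le_norm t : cdist t <= `|t|.
Proof. by have := cdist_le t 0; rewrite subr0. Qed.

Lemma cdistD s t : cdist (s + t) <= cdist s + cdist t.
Proof.
rewrite (le_trans (cdist_le _ (nint s + nint t)))// intrD.
rewrite (_ : s + t - _ = (s - (nint s)%:~R) + (t - (nint t)%:~R)); last ring.
exact: ler_normD.
Qed.

Lemma cdistN t : cdist (- t) = cdist t.
Proof.
suff H s : cdist (- s) <= cdist s.
  by apply/eqP; rewrite eq_le H/= -{1}(opprK t) H.
by rewrite (le_trans (cdist_le _ (- nint s)))// intrN -opprD normrN.
Qed.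

Lemma cdistDz t (n : int) : cdist (t + n%:~R) = cdist t.
Proof.
suff H s (m : int) : cdist (s + m%:~R) <= cdist s.
  by apply/eqP; rewrite eq_le H/= -{1}(addrK n%:~R t) -intrN H.
rewrite (le_trans (cdist_le _ (nint s + m)))// intrD.
by rewrite (_ : s + _ - _ = s - (nint s)%:~R)//; ring.
Qed.

Lemma cdistB s t : cdist (s - t) = cdist (t - s).
Proof. by rewrite -cdistN opprB. Qed.

Lemma cdist_tri a s t : cdist (s - t) <= cdist (s - a) + cdist (a - t).
Proof. by rewrite (_ : s - t = (s - a) + (a - t)) ?cdistD//; ring. Qed.

Variable M : R.
Hypothesis M1 : 1 <= M.

(** A smoothed integer part: it commutes with integer translations and is locally constant at
    distance more than 1/(4M) from the integers. *)
Definition pstep (t : R) : R := (nint t)%:~R + sstep (M * (t - (nint t)%:~R)).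

Let M0 : 0 < M. Proof. exact: lt_le_trans M1. Qed.

Lemma sstepM0 t : t <= - 4^-1 / M -> sstep (M * t) = 0.
Proof. by move=> t4; rewrite sstep0// mulrC -ler_pdivlMr. Qed.

Lemma sstepM1 t : 4^-1 / M <= t -> sstep (M * t) = 1.
Proof. by move=> t4; rewrite sstep1// mulrC -ler_pdivrMr. Qed.

Let M4 : 4^-1 / M <= 4^-1.
Proof. by rewrite ler_pdivrMr// ler_peMr. Qed.

(** The definition uses the nearest integer, which jumps at the half-integers. As the step is
    constant at distance at least 1/4 from an integer, the formula centred at n stays valid up to
    distance 3/4; this overlap gives smoothness at the half-integers. *)
Lemma pstepE t (n : int) : `|t - n%:~R| <= 3 / 4 ->
  pstep t = n%:~R + sstep (M * (t - n%:~R)).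
Proof.
move=> tn; rewrite /pstep; have := cdist_le_half t; rewrite /cdist.
set m := nint t => tm.
have mn : `|m - n| <= 1.
  rewrite -ltzD1 -(ltr_int R) intr_norm intrB intrD.
  rewrite (_ : m%:~R - _ = (t - n%:~R) - (t - m%:~R)); last ring.
  by rewrite (le_lt_trans (ler_normB _ _))//; lra.
move: tn tm; rewrite !ler_norml => /andP[n1 n2] /andP[m1 m2].
have [/eqP|/eqP mnN|/eqP mnP] : [\/ m - n == 0, m - n == -1 | m - n == 1].
  have : (m - n == 0) || (m - n == -1) || (m - n == 1) by lia.
  by move=> /orP[/orP[]|]; [constructor 1|constructor 2|constructor 3].
- by move/eqP; rewrite subr_eq0 => /eqP ->.
- have nE : n = m + 1 by lia.
  rewrite nE intrD in n1 n2 *.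
  rewrite sstepM1; last by rewrite (le_trans M4)//; lra.
  by rewrite sstepM0 ?addr0// mulNr; have := M4; lra.
- have nE : n = m - 1 by lia.
  rewrite nE intrB in n1 n2 *.
  rewrite sstepM0; last by rewrite mulNr; have := M4; lra.
  by rewrite sstepM1; [ring|rewrite (le_trans M4)//; lra].
Qed.

Lemma pstepDz t (n : int) : pstep (t + n%:~R) = pstep t + n%:~R.
Proof.
rewrite (@pstepE _ (nint t + n)).
  rewrite intrD /pstep (_ : t + n%:~R - _ = t - (nint t)%:~R); last by ring.
  by rewrite addrAC.
rewrite intrD (_ : t + n%:~R - _ = t - (nint t)%:~R); last by ring.
by rewrite (le_trans (cdist_le_half t))//; lra.
Qed.

Lemma pstep_local t (n := nint t) (y : R) : `|y - t| < 4^-1 ->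
  pstep y = n%:~R + sstep (M * y + (- M * n%:~R)).
Proof.
move=> yt; rewrite (@pstepE _ n); first by congr (_ + sstep _); ring.
rewrite (_ : y - _ = (y - t) + (t - n%:~R)); last ring.
by rewrite (le_trans (ler_normD _ _))//; have := cdist_le_half t; rewrite /cdist -/n; lra.
Qed.

Lemma is_derive_pstep (t : R) :
  is_derive t 1 pstep (M * derive1 (@sstep R) (M * (t - (nint t)%:~R))).
Proof.
set n := nint t.
apply: (@is_derive_local _ (fun y => n%:~R + sstep (M * y + (- M * n%:~R)))).
  by exists 4^-1 => // y yt; rewrite (@pstep_local t).
rewrite (_ : M * derive1 _ _ = 0 + M * derive1 (@sstep R) (M * t + - M * n%:~R)); last first.
  by rewrite add0r mulNr -mulrBr.
apply: is_deriveD; apply: is_derive_affine.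
exact/smooth1_is_derive/smooth1_sstep.
Qed.

Lemma derive_pstepE (t : R) : derive1 pstep t = M * derive1 (@sstep R) (M * (t - (nint t)%:~R)).
Proof. by have [] := is_derive1E (is_derive_pstep t). Qed.

Lemma smooth1_pstep : smooth1 pstep.
Proof.
apply: smooth1_local => t; exists (fun y => (nint t)%:~R + sstep (M * y + (- M * (nint t)%:~R))).
  apply: (smooth1D (smooth1_cst _)); apply: smooth1_affine; exact: smooth1_sstep.
by exists 4^-1 => // y yt; rewrite (@pstep_local t).
Qed.

Lemma derive_pstep_supp t : derive1 pstep t != 0 -> cdist t <= 4^-1 / M.
Proof.
rewrite leNgt derive_pstepE => h; apply/negP => tM; move/eqP: h; apply.
rewrite derive_sstep0 ?mulr0// normrM gtr0_norm//.
by rewrite mulrC -ltr_pdivrMr.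
Qed.

(** If t is further than 2/M from Z, then t and t - 1/M lie on the same flat piece of the
    staircase. *)
Lemma pstepB_supp t : pstep t - pstep (t - M^-1) != 0 -> cdist t <= 2 / M.
Proof.
rewrite leNgt => h; apply/negP => tM; move/eqP: h; apply.
have := cdist_le_half t; move: tM; rewrite /cdist; set n := nint t => tM t2.
have Mi : 0 < M^-1 by rewrite invr_gt0.
(* A distance to Z is at most 1/2, so 2/M < 1/2. *)
have M4' : M^-1 < 4^-1 by lra.
have tn : `|t - M^-1 - n%:~R| <= 3 / 4.
  rewrite (_ : t - _ - _ = (t - n%:~R) - M^-1); last ring.
  by rewrite (le_trans (ler_normB _ _))// (gtr0_norm Mi); lra.
rewrite (@pstepE t n); last by lra.
rewrite (pstepE tn); have [n0|n0] := leP 0 (t - n%:~R).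
  rewrite ger0_norm// in tM.
  by rewrite !sstepM1; lra.
rewrite ltr0_norm// in tM.
by rewrite !sstepM0; rewrite ?mulNr; lra.
Qed.

End circle.

(** * Coordinates, boxes and measurability in R^N *)

Section lebN_basics.
Variable R : realType.

Lemma coordN0 N (x : RN R N.+1) : coordN x 0 ord0 = x.1.
Proof. by rewrite /coordN/= mxE unlift_none. Qed.

Lemma coordNS N (x : RN R N.+1) (j : 'I_N) : coordN x 0 (lift ord0 j) = @coordN R N x.2 0 j.
Proof. by rewrite /coordN/= mxE liftK. Qed.

Lemma measurable_coordN N (i : 'I_N) : measurable_fun setT (fun x : RN R N => coordN x 0 i).
Proof.
elim: N i => [[]//|N IH] i.
have [j ->|->] := unliftP ord0 i.
  under eq_fun do rewrite coordNS.
  exact: (measurableT_comp (IH j) (@measurable_snd _ _ _ _)).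
by under eq_fun do rewrite coordN0; exact: measurable_fst.
Qed.

Definition boxN N (A : 'I_N -> set R) : set (RN R N) :=
  [set x | forall i, A i (coordN x 0 i)].

Lemma boxNS N (A : 'I_N.+1 -> set R) :
  boxN A = (A ord0 : set R) `*` boxN (fun j => A (lift ord0 j)).
Proof.
apply/seteqP; split => [x Ax|x [A0 AS] i]; first split => [|j].
- by rewrite -coordN0; exact: Ax.
- by have := Ax (lift ord0 j); rewrite coordNS.
- have [j ->|->] := unliftP ord0 i; first by rewrite coordNS; exact: AS.
  by rewrite coordN0.
Qed.

Lemma measurable_boxN N (A : 'I_N -> set R) : (forall i, measurable (A i)) -> measurable (boxN A).
Proof.
move=> mA; rewrite (_ : boxN A = \big[setI/setT]_i ((fun x => coordN x 0 i) @^-1` A i)).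
  apply: bigsetI_measurable => i _; rewrite -[X in measurable X]setTI.
  exact: measurable_coordN.
apply/seteqP; split => [x Ax|x].
  by apply: (big_ind (fun S : set _ => S x)) => // i _; exact: Ax.
by move=> + i; rewrite (bigD1 i)//= => -[].
Qed.

Lemma cubeN_box N : cubeN R N = boxN (fun=> `[0, 1[%classic).
Proof.
by apply/seteqP; split => x /= + i => /(_ i); rewrite ?in_itv//=.
Qed.

Lemma lebN_box_le N (A : 'I_N -> set R) (m : R) : 0 <= m -> (forall i, measurable (A i)) ->
  (forall i, (lebesgue_measure (A i) <= m%:E)%E) -> (lebN R N (boxN A) <= (m ^+ N)%:E)%E.
Proof.
move=> m0; elim: N A => [|N IH] A mA Am.
  by rewrite expr0 /lebN/= diracE lee_fin; case: (_ \in _).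
rewrite boxNS exprS EFinM.
rewrite [X in (X <= _)%E](@product_measure1E _ _ _ _ _ lebesgue_measure (lebN R N))//=; last 2 first.
- exact: mA.
- exact: measurable_boxN.
by apply: lee_pmul => //; exact: IH.
Qed.

Lemma lebN_box N (A : 'I_N -> set R) (m : R) : (forall i, measurable (A i)) ->
  (forall i, (lebesgue_measure (A i) = m%:E)%E) -> (lebN R N (boxN A) = (m ^+ N)%:E)%E.
Proof.
elim: N A => [|N IH] A mA Am.
  rewrite expr0 /lebN/= diracE mem_set//= => -[]//.
rewrite boxNS exprS EFinM.
rewrite [LHS](@product_measure1E _ _ _ _ _ lebesgue_measure (lebN R N))//=; last 2 first.
- exact: mA.
- exact: measurable_boxN.
by rewrite Am; congr (_ * _)%E; exact: IH.
Qed.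

Lemma measurable_cubeN N : measurable (cubeN R N).
Proof. by rewrite cubeN_box; exact: measurable_boxN. Qed.

Lemma lebN_cubeN N : lebN R N (cubeN R N) = 1%E.
Proof.
rewrite cubeN_box (@lebN_box _ _ 1) ?expr1n// => _.
by rewrite lebesgue_measure_itv/= lte_fin ltr01 oppr0 adde0.
Qed.

Lemma cubeNS N : cubeN R N.+1 = (`[0, 1[%classic : set R) `*` cubeN R N.
Proof. by rewrite !cubeN_box boxNS. Qed.


Lemma rVnorm_le N (x : 'rV[R]_N) (e : R) : 0 <= e -> (forall i, `|x 0 i| <= e) -> `|x| <= e.
Proof.
move=> e0 xe; rewrite [`|x|]mx_normrE; apply: bigmax_le => // -[i j] _ /=.
by rewrite ord1.
Qed.

Lemma coord_le_rVnorm N (x : 'rV[R]_N) i : `|x 0 i| <= `|x|.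
Proof. by rewrite [`|x|]mx_normrE; apply: (le_bigmax _ (fun ij => `|x ij.1 ij.2|) (0, i)). Qed.

Lemma dist_round (p t : R) : 0 < p -> `|t - (Num.floor (p * t))%:~R / p| <= p^-1.
Proof.
move=> p0; rewrite -(ler_pM2l p0) mulfV ?gt_eqF// -{1}(gtr0_norm p0) -normrM mulrBr.
rewrite mulrCA mulfV ?gt_eqF// mulr1; have /andP[f1 f2] := floor_itv (p * t).
by rewrite ger0_norm ?subr_ge0//; move: f2; rewrite intrD; lra.
Qed.

Lemma near_half_pow_le (e : R) : 0 < e -> \forall j \near \oo, 2^-1 ^+ j <= e.
Proof.
move=> e0; have h : `|2^-1 : R| < 1 by rewrite ger0_norm; lra.
have /cvgrPdist_le/(_ _ e0) := cvg_expr h.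
by apply: filterS => j /=; rewrite sub0r normrN; apply: le_trans; exact: ler_norm.
Qed.

(* A continuous function is the pointwise limit of its compositions with
   coordinatewise dyadic rounding, each of which takes countably many values. *)
Lemma continuous_measurable_coordN N (g : 'rV[R]_N -> R) : continuous g ->
  measurable_fun setT (fun x : RN R N => g (coordN x)).
Proof.
move=> cg.
pose rnd (j : nat) (y : 'rV[R]_N) : 'rV[R]_N := \row_i ((Num.floor (2 ^+ j * y 0 i))%:~R / 2 ^+ j).
apply: (@measurable_fun_cvg _ _ _ _ (fun j x => g (rnd j (coordN x)))); last first.
  move=> x _; apply: continuous_cvg; first exact: cg.
  apply/cvgrPdist_le => e e0; near=> j.
  apply: rVnorm_le => [|i]; first exact: ltW.
  rewrite !mxE (le_trans (dist_round _ _)) ?exprn_gt0//.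
  rewrite -exprVn; near: j.
  exact: near_half_pow_le.
move=> j _ Y mY; rewrite setTI.
pose val (k : {ffun 'I_N -> int}) : 'rV[R]_N := \row_i ((k i)%:~R / 2 ^+ j).
pose C (k : {ffun 'I_N -> int}) := boxN (fun i => [set t : R | Num.floor (2 ^+ j * t) = k i]).
pose F (k : {ffun 'I_N -> int}) := if g (val k) \in Y then C k else set0.
rewrite [X in measurable X](_ : _ = \bigcup_k F k); last first.
  apply/seteqP; split => [x Yx|x [k _]].
    exists [ffun i => Num.floor (2 ^+ j * coordN x 0 i)] => //.
    rewrite /F ifT; first by move=> i /=; rewrite ffunE.
    rewrite inE; move: Yx => /=; congr (Y (g _)).
    by apply/rowP => i; rewrite !mxE ffunE.
  rewrite /F; case: ifPn => // /set_mem Yk Ckx /=; move: Yk; congr (Y (g _)).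
  by apply/rowP => i; rewrite !mxE Ckx.
apply: countable_bigcupT_measurable => [|k]; first exact: countableP.
rewrite /F; case: ifP => // _; apply: measurable_boxN => i.
rewrite (_ : [set t | _] = (fun t : R => 2 ^+ j * t) @^-1` `[(k i)%:~R, (k i + 1)%:~R[%classic).
  rewrite -[X in measurable X]setTI.
  by apply: measurable_funM.
apply/seteqP; split => t /=; rewrite in_itv/=.
  by move=> <-; exact: floor_itv.
by move=> /floor_def.
Unshelve. all: by end_near. Qed.

End lebN_basics.

(** * Fubini and Tonelli on a product of two sets *)

Section fubini_setX.
Context d1 d2 (T1 : measurableType d1) (T2 : measurableType d2) (R : realType).
Variables (m1 : {sigma_finite_measure set T1 -> \bar R}) (m2 : {sigma_finite_measure set T2 -> \bar R}).
Variables (A : set T1) (B : set T2).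
Hypotheses (mA : measurable A) (mB : measurable B).
Variable f : T1 * T2 -> \bar R.
Local Open Scope ereal_scope.

Let FE x : fubini_F m2 (f \_ (A `*` B)) x = ((fun x => \int[m2]_(y in B) f (x, y)) \_ A) x.
Proof.
rewrite /fubini_F patchE; case: ifPn => xA.
  rewrite [RHS]integral_mkcond; apply: eq_integral => y _.
  by rewrite !patchE in_setX/= xA.
by apply: integral0_eq => y _; rewrite patchE in_setX/= (negbTE xA).
Qed.

Let GE y : fubini_G m1 (f \_ (A `*` B)) y = ((fun y => \int[m1]_(x in A) f (x, y)) \_ B) y.
Proof.
rewrite /fubini_G patchE; case: ifPn => yB.
  rewrite [RHS]integral_mkcond; apply: eq_integral => x _.
  by rewrite !patchE in_setX/= yB andbT.
by apply: integral0_eq => x _; rewrite patchE in_setX/= (negbTE yB) andbF.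
Qed.

Lemma fubini_setX1 : (m1 \x m2).-integrable (A `*` B) f ->
  \int[m1 \x m2]_(z in A `*` B) f z = \int[m1]_(x in A) \int[m2]_(y in B) f (x, y).
Proof.
move=> fi; rewrite integral_mkcond -integral12_prod_meas1; last first.
  by rewrite -(integrable_mkcond _ (measurableX mA mB)).
by rewrite [RHS]integral_mkcond; apply: eq_integral => x _; rewrite FE.
Qed.

Lemma fubini_setX2 : (m1 \x m2).-integrable (A `*` B) f ->
  \int[m1 \x m2]_(z in A `*` B) f z = \int[m2]_(y in B) \int[m1]_(x in A) f (x, y).
Proof.
move=> fi; rewrite integral_mkcond -integral21_prod_meas1; last first.
  by rewrite -(integrable_mkcond _ (measurableX mA mB)).
by rewrite [RHS]integral_mkcond; apply: eq_integral => x _; rewrite GE.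
Qed.

Lemma tonelli_setX1 : measurable_fun (A `*` B) f -> (forall z, 0 <= f z) ->
  \int[m1 \x m2]_(z in A `*` B) f z = \int[m1]_(x in A) \int[m2]_(y in B) f (x, y).
Proof.
move=> mf f0; have m' : measurable_fun setT (f \_ (A `*` B)).
  by apply: (measurable_restrictT _ (measurableX mA mB)).1.
have p' z : 0 <= (f \_ (A `*` B)) z by rewrite patchE; case: ifP.
rewrite integral_mkcond fubini_tonelli1//.
by rewrite [RHS]integral_mkcond; apply: eq_integral => x _; rewrite FE.
Qed.

Lemma tonelli_setX2 : measurable_fun (A `*` B) f -> (forall z, 0 <= f z) ->
  \int[m1 \x m2]_(z in A `*` B) f z = \int[m2]_(y in B) \int[m1]_(x in A) f (x, y).
Proof.
move=> mf f0; have m' : measurable_fun setT (f \_ (A `*` B)).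
  by apply: (measurable_restrictT _ (measurableX mA mB)).1.
have p' z : 0 <= (f \_ (A `*` B)) z by rewrite patchE; case: ifP.
rewrite integral_mkcond fubini_tonelli2//.
by rewrite [RHS]integral_mkcond; apply: eq_integral => y _; rewrite GE.
Qed.

Lemma measurable_fubini_setX1 : measurable_fun (A `*` B) f -> (forall z, 0 <= f z) ->
  measurable_fun A (fun x => \int[m2]_(y in B) f (x, y)).
Proof.
move=> mf f0; have m' : measurable_fun setT (f \_ (A `*` B)).
  by apply: (measurable_restrictT _ (measurableX mA mB)).1.
have p' z : 0 <= (f \_ (A `*` B)) z by rewrite patchE; case: ifP.
apply/(measurable_restrictT _ mA); rewrite -(funext FE).
exact: measurable_fun_fubini_tonelli_F.
Qed.

Lemma measurable_fubini_setX2 : measurable_fun (A `*` B) f -> (forall z, 0 <= f z) ->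
  measurable_fun B (fun y => \int[m1]_(x in A) f (x, y)).
Proof.
move=> mf f0; have m' : measurable_fun setT (f \_ (A `*` B)).
  by apply: (measurable_restrictT _ (measurableX mA mB)).1.
have p' z : 0 <= (f \_ (A `*` B)) z by rewrite patchE; case: ifP.
apply/(measurable_restrictT _ mB); rewrite -(funext GE).
exact: measurable_fun_fubini_tonelli_G.
Qed.

Lemma tonelli_setX : measurable_fun (A `*` B) f -> (forall z, 0 <= f z) ->
  \int[m1]_(x in A) \int[m2]_(y in B) f (x, y) = \int[m2]_(y in B) \int[m1]_(x in A) f (x, y).
Proof. by move=> mf f0; rewrite -tonelli_setX1// tonelli_setX2. Qed.

End fubini_setX.

(** * Calculus on the torus *)

Section torus_calculus.
Variable R : realType.

Lemma lipschitz_continuous (V W : normedModType R) (f : V -> W) (C : R) :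
  (forall x y, `|f x - f y| <= C * `|x - y|) -> continuous f.
Proof.
move=> fC x; apply/cvgrPdist_le => e e0; near=> y.
have C1 : 0 < `|C| + 1 by rewrite ltr_wpDl.
rewrite (le_trans (fC _ _))// (@le_trans _ _ ((`|C| + 1) * `|x - y|))//.
  by rewrite ler_wpM2r// (le_trans (ler_norm _))// lerDl.
rewrite mulrC -ler_pdivlMr//; near: y.
by apply: cvgr_dist_le => //; rewrite divr_gt0.
Unshelve. all: by end_near. Qed.

Lemma continuous_bounded_cube N (g : 'rV[R]_N -> R) : continuous g ->
  exists B : R, forall x : 'rV[R]_N, (forall i, 0 <= x 0 i <= 1) -> `|g x| <= B.
Proof.
move=> cg; pose A : set 'rV[R]_N := [set v | forall i, `[0, 1]%classic (v ord0 i)].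
have cA : compact A by apply: (@rV_compact R N (fun=> `[0, 1]%classic)) => i; exact: segment_compact.
have A0 : A !=set0 by exists 0 => i /=; rewrite mxE in_itv/= lexx ler01.
have cg' : {within A, continuous (fun x => `|g x|)}.
  apply: continuous_subspaceT => x.
  by apply: continuous_comp; [exact: cg|exact: norm_continuous].
have [c _ cB] := EVT_max_rV A0 cA cg'.
exists `|g c| => x x01; apply: cB; rewrite inE => i /=; rewrite in_itv/=.
exact: x01.
Qed.

Lemma bounded_integrable d (T : measurableType d) (mu : {measure set T -> \bar R})
  (D : set T) (f : T -> R) (B : R) : measurable D -> (mu D < +oo)%E ->
  measurable_fun D f -> (forall x, D x -> `|f x| <= B) -> mu.-integrable D (EFin \o f).
Proof.
move=> mD Dfin mf fB; apply: measurable_bounded_integrable => //.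
exists `|B|; split; first exact: num_real.
by move=> b Bb x /fB /le_trans; apply; rewrite (le_trans (ler_norm _))// ltW.
Qed.

Lemma lebN_cubeN_lty N : (lebN R N (cubeN R N) < +oo)%E.
Proof. by rewrite lebN_cubeN ltry. Qed.

Lemma cubeN_le1 N (x : RN R N) : cubeN R N x -> forall i, 0 <= coordN x 0 i <= 1.
Proof. by move=> + i => /(_ i)/andP[-> /ltW]. Qed.

Lemma continuous_integrable_cube N (g : 'rV[R]_N -> R) : continuous g ->
  (lebN R N).-integrable (cubeN R N) (EFin \o (fun x => g (coordN x))).
Proof.
move=> cg; have [B gB] := continuous_bounded_cube cg.
apply: (@bounded_integrable _ _ _ _ _ B).
- exact: measurable_cubeN.
- exact: lebN_cubeN_lty.
- by apply: measurable_funTS; exact: continuous_measurable_coordN.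
- by move=> x /cubeN_le1; exact: gB.
Qed.

Lemma is_derive_line N (F : 'rV[R]_N -> R) (a v : 'rV[R]_N) (t d : R) :
  is_derive (a + t *: v) v F d -> is_derive t 1 (fun t => F (a + t *: v)) d.
Proof.
move=> Fd; have E : (fun h : R => h^-1 *: (((fun t => F (a + t *: v)) \o shift t) (h *: 1) - F (a + t *: v)))
   = (fun h : R => h^-1 *: ((F \o shift (a + t *: v)) (h *: v) - F (a + t *: v))).
  apply/funext => h /=; congr (_ *: (F _ - _)).
  by rewrite scalerDl addrCA [h%:A]mulr1.
have [dF Fv] := Fd; apply: DeriveDef.
  by rewrite /derivable E.
by rewrite /derive E.
Qed.

Definition rVcons N (t : R) (w : 'rV[R]_N) : 'rV[R]_N.+1 :=
  \row_i (if unlift ord0 i is Some j then w 0 j else t).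

Lemma coordN_cons N (z : RN R N.+1) : coordN z = rVcons z.1 (@coordN R N z.2).
Proof.
apply/rowP => i; rewrite !mxE.
by case: (unlift ord0 i).
Qed.

Lemma rVcons_line N (t s : R) (w : 'rV[R]_N) : rVcons (t + s) w = rVcons t w + s *: evec R ord0.
Proof.
apply/rowP => i; rewrite !mxE eqxx/=; case: unliftP => [j ->|->].
  by rewrite eq_sym (negbTE (neq_lift _ _)) mulr0 addr0.
by rewrite eqxx mulr1.
Qed.

Lemma rVcons_shift N (t : R) (w : 'rV[R]_N) k (h : R) :
  rVcons t (h *: evec R k + w) = h *: evec R (lift ord0 k) + rVcons t w.
Proof.
apply/rowP => i; rewrite !mxE eqxx/=; case: unliftP => [j ->|->].
  by rewrite !mxE eqxx/= (inj_eq (@lift_inj _ _)).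
by rewrite (negbTE (neq_lift _ _)) mulr0 add0r.
Qed.

Lemma is_derive_rVcons N (F : 'rV[R]_N.+1 -> R) t (w : 'rV[R]_N) k (d : R) :
  is_derive (rVcons t w) (evec R (lift ord0 k)) F d ->
  is_derive w (evec R k) (fun w => F (rVcons t w)) d.
Proof.
have E : (fun h : R => h^-1 *: (((fun w => F (rVcons t w)) \o shift w) (h *: evec R k) - F (rVcons t w)))
   = (fun h : R => h^-1 *: ((F \o shift (rVcons t w)) (h *: evec R (lift ord0 k)) - F (rVcons t w))).
  by apply/funext => h /=; rewrite rVcons_shift.
by move=> [dF Fv]; apply: DeriveDef; rewrite ?/derivable ?/derive E.
Qed.

Lemma continuous_rVcons N (t : R) : continuous (@rVcons N t).
Proof.
apply: (@lipschitz_continuous _ _ _ 1) => w w'; rewrite mul1r.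
apply: rVnorm_le => // i; rewrite !mxE; case: (unlift ord0 i) => [j|].
  by have := coord_le_rVnorm (w - w') j; rewrite !mxE.
by rewrite subrr normr0.
Qed.

Lemma continuous_line N (a v : 'rV[R]_N) : continuous (fun t : R => a + t *: v).
Proof.
apply: (@lipschitz_continuous _ _ _ `|v|) => s t.
by rewrite opprD addrACA subrr add0r -scalerBl normrZ mulrC.
Qed.

(** The increment over one period is kept on the right: it is 0 for a periodic f, and for the
    staircase it is the mass 1 of the mollifier. *)
Lemma integral_derive_periodic (f df : R -> R) : (forall t : R, is_derive t 1 f (df t)) ->
  continuous df -> (\int[lebesgue_measure]_(t in `[0%R, 1%R[) (df t)%:E = (f 1 - f 0)%:E)%E.
Proof.
move=> fd cdf.
have cf : continuous f.
  move=> x; apply: differentiable_continuous; apply/derivable1_diffP.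
  by have [] := is_derive1E (fd x).
rewrite integral_itv_bndo_bndc; last first.
  by apply/measurable_EFinP/measurable_funTS; exact: continuous_measurable_fun.
rewrite (@continuous_FTC2 _ _ f)//.
- by apply: continuous_subspaceT => x; exact: cdf.
- split.
  + by move=> x _; have [] := is_derive1E (fd x).
  + by apply: cvg_at_right_filter; exact: cf.
  + by apply: cvg_at_left_filter; exact: cf.
- by move=> x _; rewrite (derive1_ext fd).
Qed.

(** By Fubini the k-th variable runs over a full period, where the fundamental theorem of calculus
    gives 0. The induction peels off coordinates until the k-th one is the first. *)
Lemma integral_derive_torus N (F G : 'rV[R]_N -> R) (k : 'I_N) : Zperiodic F ->
  (forall x, is_derive x (evec R k) F (G x)) -> continuous G ->
  (\int[lebN R N]_(x in cubeN R N) (G (coordN x))%:E = 0)%E.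
Proof.
elim: N F G k => [_ _ []//|N IH] F G k pF Fd cG.
have iG := continuous_integrable_cube cG.
have mI : measurable (`[0, 1[%classic : set R) by [].
have mC := @measurable_cubeN R N.
rewrite cubeNS in iG *.
have [j kE|kE] := unliftP ord0 k.
  rewrite [LHS](@fubini_setX1 _ _ _ _ _ lebesgue_measure (lebN R N) _ _ mI mC _ iG).
  apply: integral0_eq => t _ /=.
  under eq_integral do rewrite coordN_cons/=.
  apply: (IH (fun w => F (rVcons t w)) (fun w => G (rVcons t w)) j).
  - move=> i w; rewrite addrC -[evec R i]scale1r rVcons_shift scale1r addrC.
    exact: pF.
  - by move=> w; apply: is_derive_rVcons; rewrite -kE; exact: Fd.
  - by move=> w; apply: continuous_comp; [exact: continuous_rVcons|exact: cG].
rewrite [LHS](@fubini_setX2 _ _ _ _ _ lebesgue_measure (lebN R N) _ _ mI mC _ iG).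
apply: integral0_eq => w _ /=.
pose a := rVcons 0 (@coordN R N w).
have E (t : R) : coordN ((t, w) : RN R N.+1) = a + t *: evec R ord0.
  by rewrite coordN_cons/= /a -rVcons_line add0r.
under eq_integral do rewrite E.
have dl (t : R) : is_derive t 1 (fun t => F (a + t *: evec R ord0)) (G (a + t *: evec R ord0)).
  by apply: is_derive_line; rewrite -kE; exact: Fd.
have cl : continuous (fun t : R => G (a + t *: evec R ord0)).
  by move=> t; apply: continuous_comp; [exact: continuous_line|exact: cG].
by rewrite (integral_derive_periodic dl cl) scale0r addr0 scale1r pF subrr.
Qed.

End torus_calculus.

(** * Convolution with tensor products of periodic kernels *)

Section convolution.
Variable R : realType.

Definition pker (k : R -> R) := smooth1 k /\ forall t, k (t + 1) = k t.

Lemma pker_derive k : pker k -> pker (derive1 k).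
Proof.
move=> [sk pk]; split; first exact: smooth1_derive.
move=> t; suff : is_derive t 1 k (derive1 k (t + 1)) by case/is_derive1E.
have := @is_derive_affine R k 1 1 t (derive1 k (1 * t + 1)) (smooth1_is_derive _ sk).
by rewrite !mul1r; under eq_fun do rewrite mul1r pk.
Qed.

Lemma pkerDz k (t : R) (n : int) : pker k -> k (t + n%:~R) = k t.
Proof.
move=> [_ pk]; have H (m : nat) s : k (s + m%:R) = k s.
  elim: m s => [|m IH] s; first by rewrite addr0.
  by rewrite -natr1 addrA pk.
case: n => n; first exact: H.
by rewrite NegzE intrN -[in RHS](subrK (n.+1%:R) t) H.
Qed.

Lemma pker_bounded k : pker k -> exists B : R, forall t, `|k t| <= B.
Proof.
move=> gk; have [|B kB] := @continuous_bounded_itv R k (-1) 1 _ (smooth1_continuous gk.1); first lra.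
exists B => t; have := pkerDz (t - (nint t)%:~R) (nint t) gk; rewrite subrK => ->.
by apply: kB; rewrite -ler_norml; have := cdist_le_half t; rewrite /cdist; lra.
Qed.

Lemma pker_lipschitz k : pker k -> exists B : R, forall s t, `|k s - k t| <= B * `|s - t|.
Proof.
move=> gk; have [B kB] := pker_bounded (pker_derive gk); exists B.
suff H s t : s <= t -> `|k t - k s| <= B * `|t - s|.
  move=> s t; have [st|/ltW st] := leP s t; last exact: H.
  by rewrite distrC [in X in _ <= X]distrC; exact: H.
move=> st; have ck : {within `[s, t], continuous k}.
  by apply: continuous_subspaceT => x; exact: (smooth1_continuous gk.1).
have [|c _ ->] := @MVT_segment R k (derive1 k) _ _ st _ ck.
  by move=> x _; exact: smooth1_is_derive gk.1.
by rewrite normrM ler_wpM2r.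
Qed.

Lemma ler_prod_bound (I : Type) (r : seq I) (a : I -> R) (B : R) :
  (forall i, `|a i| <= B) -> `|\prod_(i <- r) a i| <= B ^+ size r.
Proof.
move=> aB; elim: r => [|i r IH]; first by rewrite big_nil normr1.
by rewrite big_cons normrM exprS ler_pM.
Qed.

(** Telescoping: the factors are exchanged one at a time, the others staying bounded by B. *)
Lemma prod_lipschitz (I : Type) (r : seq I) (a b : I -> R) (B : R) : 1 <= B ->
  (forall i, `|a i| <= B) -> (forall i, `|b i| <= B) ->
  `|\prod_(i <- r) a i - \prod_(i <- r) b i| <= B ^+ size r * \sum_(i <- r) `|a i - b i|.
Proof.
move=> B1 aB bB; have B0 : 0 <= B by exact: le_trans B1.
elim: r => [|i r IH]; first by rewrite !big_nil subrr normr0 mulr0.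
rewrite !big_cons (_ : _ - _ = (a i - b i) * \prod_(j <- r) a j +
   b i * (\prod_(j <- r) a j - \prod_(j <- r) b j)); last by ring.
rewrite (le_trans (ler_normD _ _))// [leRHS]mulrDr lerD// normrM.
  rewrite mulrC ler_wpM2r// (le_trans (ler_prod_bound r aB))//.
  by rewrite /= exprS ler_peMl// exprn_ge0.
by rewrite /= exprS -mulrA ler_pM.
Qed.

Variable N : nat.
Implicit Types (K : 'I_N -> R -> R) (x y : 'rV[R]_N).

(** A partial derivative acts on a tensor product by replacing one factor by its derivative. *)
Definition kupd K (k : 'I_N) (f : R -> R) : 'I_N -> R -> R :=
  fun i => if i == k then f else K i.

Definition tensor K x : R := \prod_i K i (x 0 i).

Lemma pker_kupd K k f : (forall i, pker (K i)) -> pker f -> forall i, pker (kupd K k f i).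
Proof. by move=> gK gf i; rewrite /kupd; case: ifP. Qed.

Lemma pker_bounds K : (forall i, pker (K i)) -> exists2 B : R, 1 <= B & forall i t, `|K i t| <= B.
Proof.
move=> gK; have [B KB] := @choice _ R (fun i b => forall t, `|K i t| <= b) (fun i => pker_bounded (gK i)).
exists (1 + \sum_i `|B i|); first by rewrite lerDl sumr_ge0.
move=> i t; rewrite (le_trans (KB i t))// (bigD1 i)//= (le_trans (ler_norm _))//.
by rewrite addrCA lerDl addr_ge0// sumr_ge0.
Qed.

Lemma tensor_bounded K : (forall i, pker (K i)) -> exists2 B : R, 0 <= B & forall x, `|tensor K x| <= B.
Proof.
move=> /pker_bounds[B B1 KB]; exists (B ^+ size (index_enum 'I_N)) => [|x].
  by rewrite exprn_ge0// (le_trans _ B1).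
by apply: ler_prod_bound => i.
Qed.

Lemma tensor_lipschitz K : (forall i, pker (K i)) ->
  exists2 C : R, 0 <= C & forall x y, `|tensor K x - tensor K y| <= C * `|x - y|.
Proof.
move=> gK; have [B B1 KB] := pker_bounds gK.
have [L KL] := @choice _ R (fun i b => forall s t, `|K i s - K i t| <= b * `|s - t|)
  (fun i => pker_lipschitz (gK i)).
have BN : 0 <= B ^+ size (index_enum 'I_N) by rewrite exprn_ge0// (le_trans _ B1).
exists (B ^+ size (index_enum 'I_N) * \sum_i `|L i|) => [|x y].
  by rewrite mulr_ge0// sumr_ge0.
rewrite (le_trans (prod_lipschitz _ B1 _ _))// -mulrA ler_wpM2l// mulr_suml ler_sum// => i _.
rewrite (le_trans (KL i _ _))// (le_trans (ler_wpM2r _ (ler_norm _)))// ler_wpM2l//.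
by have := coord_le_rVnorm (x - y) i; rewrite !mxE.
Qed.

Lemma tensor_kupd K k f x : tensor (kupd K k f) x = f (x 0 k) * \prod_(i | i != k) K i (x 0 i).
Proof.
rewrite /tensor (bigD1 k)//= /kupd eqxx; congr (_ * _).
by apply: eq_bigr => i /negbTE ->.
Qed.

Lemma kupd_id K k : kupd K k (K k) = K.
Proof. by apply/funext => i; rewrite /kupd; case: eqP => [->|]. Qed.

Lemma is_derive_tensor_line K k x (t : R) : (forall i, pker (K i)) ->
  is_derive t 1 (fun s : R => tensor K (x + s *: evec R k))
    (tensor (kupd K k (derive1 (K k))) (x + t *: evec R k)).
Proof.
move=> gK; rewrite tensor_kupd.
have E (s : R) : tensor K (x + s *: evec R k) =
    K k (1 * s + x 0 k) * \prod_(i | i != k) K i (x 0 i).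
  rewrite -[in LHS](kupd_id K k) tensor_kupd !mxE !eqxx mulr1 mul1r addrC.
  congr (_ * _); apply: eq_bigr => i ik; rewrite !mxE eqxx/= (negbTE ik) mulr0 addr0//.
under eq_fun do rewrite E.
rewrite !mxE !eqxx mulr1 (_ : \prod_(i | i != k) K i _ = \prod_(i | i != k) K i (x 0 i)); last first.
  by apply: eq_bigr => i ik; rewrite !mxE eqxx/= (negbTE ik) mulr0 addr0.
have d1 := is_derive_affine (smooth1_is_derive (1 * t + x 0 k) (gK k).1).
have := is_deriveM d1 (is_derive_cst (\prod_(i | i != k) K i (x 0 i)) t (1 : R)).
by rewrite scaler0 add0r !mul1r [_ *: _]mulrC addrC.
Qed.

Lemma is_derive_from_line (F : 'rV[R]_N -> R) x (v : 'rV[R]_N) (d : R) :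
  is_derive (0 : R) 1 (fun t : R => F (x + t *: v)) d -> is_derive x v F d.
Proof.
have E : (fun h : R => h^-1 *: (((fun t => F (x + t *: v)) \o shift 0) (h *: 1) - F (x + 0 *: v)))
   = (fun h : R => h^-1 *: ((F \o shift x) (h *: v) - F x)).
  apply/funext => h /=; rewrite scale0r !addr0; congr (_ *: (F _ - _)).
  by rewrite [h%:A]mulr1 addrC.
by move=> [dF Fv]; apply: DeriveDef; move: dF Fv; rewrite ?/derivable ?/derive E.
Qed.

Lemma is_derive_tensor K k x : (forall i, pker (K i)) ->
  is_derive x (evec R k) (tensor K) (tensor (kupd K k (derive1 (K k))) x).
Proof.
move=> gK; apply: is_derive_from_line.
have := @is_derive_tensor_line K k x 0 gK.
by rewrite scale0r addr0.
Qed.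

Lemma continuous_tensor K : (forall i, pker (K i)) -> continuous (tensor K).
Proof. by move=> /tensor_lipschitz[C _]; exact: lipschitz_continuous. Qed.

Lemma smooth_tensor K : (forall i, pker (K i)) -> smooth_fun (tensor K).
Proof.
move=> gK s; suff [K' gK' ->] : exists2 K', (forall i, pker (K' i)) & pderivs s (tensor K) = tensor K'.
  split; first exact: continuous_tensor.
  by move=> k x; have [] := is_derive_tensor k x gK'.
elim: s => [|k s [K' gK' IH]]; first by exists K.
exists (kupd K' k (derive1 (K' k))); first by apply: pker_kupd => //; exact: pker_derive.
rewrite /= IH; apply/funext => x; have := is_derive_tensor k x gK'.
by move=> ?; exact: derive_val.
Qed.

Lemma Zperiodic_tensor K : (forall i, pker (K i)) -> Zperiodic (tensor K).
Proof.
move=> gK k x; apply: eq_bigr => i _; rewrite !mxE eqxx/=.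
by case: eqP => _; rewrite ?addr0//; have [_ ->] := gK i.
Qed.


Lemma measurable_tensorB K x : (forall i, pker (K i)) ->
  measurable_fun setT (fun z : RN R N => tensor K (x - coordN z)).
Proof.
move=> gK; apply: (@continuous_measurable_coordN _ _ (fun y => tensor K (x - y))) => y.
apply: continuous_comp; last exact: continuous_tensor.
by apply: continuousB; [exact: cst_continuous|].
Qed.

Variable U : RN R N -> R.
Hypothesis iU : (lebN R N).-integrable (cubeN R N) (EFin \o U).

(** [U] is integrated over the fundamental cube only; periodicity and smoothness in x are inherited
    from the kernel. *)
Definition convol K x : R :=
  \int[lebN R N]_(z in cubeN R N) (U z * tensor K (x - coordN z)).

Lemma conv_integrable K x : (forall i, pker (K i)) ->
  (lebN R N).-integrable (cubeN R N) (EFin \o (fun z => U z * tensor K (x - coordN z))).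
Proof.
move=> gK; have [B B0 KB] := tensor_bounded gK.
have := @integrableMl _ _ _ _ _ (@measurable_cubeN R N) _ (fun z => tensor K (x - coordN z)) iU.
apply; first exact/measurable_funTS/measurable_tensorB.
exists B; split; first exact: num_real.
by move=> b Bb z _ /=; rewrite (le_trans (KB _))// ltW.
Qed.

Lemma integrable_normU : (lebN R N).-integrable (cubeN R N) (EFin \o (fun z => `|U z|)).
Proof. by have := integrable_abse iU. Qed.

Lemma Zperiodic_conv K : (forall i, pker (K i)) -> Zperiodic (convol K).
Proof.
move=> gK k x; apply: eq_Rintegral => z _; congr (_ * _).
by rewrite addrAC Zperiodic_tensor.
Qed.

Lemma continuous_conv K : (forall i, pker (K i)) -> continuous (convol K).
Proof.
move=> gK; have [C C0 KC] := tensor_lipschitz gK.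
apply: (@lipschitz_continuous _ _ _ _ (C * \int[lebN R N]_(z in cubeN R N) `|U z|)) => x y.
have mC := @measurable_cubeN R N.
rewrite /convol -RintegralB//; [|exact: conv_integrable..].
have iB : (lebN R N).-integrable (cubeN R N) (EFin \o
   (fun z => U z * tensor K (x - coordN z) - U z * tensor K (y - coordN z))).
  have := integrableB mC (conv_integrable x gK) (conv_integrable y gK).
  by apply: eq_integrable => // z _; rewrite /= EFinB.
rewrite (le_trans (le_normr_Rintegral _ iB))//.
rewrite mulrAC -RintegralZl//; last exact: integrable_normU.
apply: le_Rintegral => //.
- exact: (integrable_abse iB).
- have := @integrableZl _ _ _ _ _ mC (C * `|x - y|) _ integrable_normU.
  exact: eq_integrable.
- move=> z Cz; rewrite -mulrBr normrM mulrC ler_wpM2r// (le_trans (KC _ _))//.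
  by rewrite opprB addrA subrK.
Qed.

(** Differentiation under the integral sign along the line x + t e_k: the derivative of the
    integrand is dominated by B |U|, where B bounds the differentiated kernel. *)
Lemma is_derive_conv K k x : (forall i, pker (K i)) ->
  is_derive x (evec R k) (convol K) (convol (kupd K k (derive1 (K k))) x).
Proof.
move=> gK; apply: is_derive_from_line.
have mC := @measurable_cubeN R N.
have gK' : forall i, pker (kupd K k (derive1 (K k)) i).
  by apply: pker_kupd => //; exact: pker_derive.
have [B B0 KB] := tensor_bounded gK'.
pose f (t : R) (z : RN R N) : R := U z * tensor K (x - coordN z + t *: evec R k).
have fd t z : is_derive t (1 : R) (f ^~ z)
    (U z * tensor (kupd K k (derive1 (K k))) (x - coordN z + t *: evec R k)).
  by apply: is_deriveZ; exact: is_derive_tensor_line.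
have d1f t z : partial1of2 f t z =
    U z * tensor (kupd K k (derive1 (K k))) (x - coordN z + t *: evec R k).
  by rewrite /partial1of2; have [] := is_derive1E (fd t z).
have convE (t : R) : convol K (x + t *: evec R k) = \int[lebN R N]_(z in cubeN R N) f t z.
  by apply: eq_Rintegral => z _; rewrite /f addrAC.
have I0 : `]-1, 1[%classic (0 : R) by rewrite /= in_itv/=; lra.
have H1 (t : R) : `]-1, 1[%classic t -> (lebN R N).-integrable (cubeN R N) (EFin \o f t).
  move=> _; have := conv_integrable (x + t *: evec R k) gK.
  by apply: eq_integrable => // z _; rewrite /= /f [in RHS]addrAC.
have H2 (t : R) z : `]-1, 1[%classic t -> cubeN R N z -> derivable (f ^~ z) t 1.
  by move=> _ _; have [] := is_derive1E (fd t z).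
have G0 z : 0 <= B * `|U z| by rewrite mulr_ge0.
have iG : (lebN R N).-integrable (cubeN R N) (EFin \o (fun z => B * `|U z|)).
  have := @integrableZl _ _ _ _ _ mC B _ integrable_normU.
  exact: eq_integrable.
have H3 (t : R) z : `]-1, 1[%classic t -> cubeN R N z -> `|partial1of2 f t z| <= B * `|U z|.
  by move=> _ _; rewrite d1f normrM mulrC ler_wpM2r.
have := derivable1_is_derive (derivable_under_integral mC I0 H1 H2 G0 iG H3).
rewrite (differentiation_under_integral mC I0 H1 H2 G0 iG H3).
rewrite (_ : (fun t : R => convol K (x + t *: evec R k)) =
   (fun t => \int[lebN R N]_(z in cubeN R N) f t z)); last exact/funext.
rewrite (_ : convol _ x = \int[lebN R N]_(y in cubeN R N) partial1of2 f 0 y)//.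
by apply: eq_Rintegral => z _; rewrite d1f scale0r addr0.
Qed.

End convolution.

(** * Signs of the exterior algebra *)

Section exterior_signs.
Variables (R : realType) (N : nat).
Implicit Types (A B C I J : {set 'I_N}) (k l : 'I_N).

(** In product form the sign is visibly multiplicative over disjoint unions in either argument,
    which reduces the identities below to signs of pairs. *)
Lemma wsignE A B : wsign R A B = \prod_(a in A) \prod_(b in B) (-1) ^+ (b < a)%N.
Proof.
rewrite /wsign pair_big_dep/= -prodr_const.
rewrite [RHS](bigID (fun p : 'I_N * 'I_N => (p.2 < p.1)%N))/=.
rewrite [X in _ = _ * X]big1 ?mulr1; last by move=> p /andP[_ /negbTE ->].
have E p : (p \in in_set [set p : 'I_N * 'I_N | (p.1 \in A) && (p.2 \in B) && (p.2 < p.1)%N]) =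
    (p.1 \in A) && (p.2 \in B) && (p.2 < p.1)%N.
  by apply/idP/idP => [/set_mem|h]//; exact/mem_set.
by apply: eq_big => [p|p]; rewrite E// => /andP[_ ->]; rewrite expr1.
Qed.

Lemma wsignUl A B C : [disjoint A & B]%B -> wsign R (A :|: B) C = wsign R A C * wsign R B C.
Proof. move=> AB; rewrite !wsignE (eq_bigl [predU A & B]) ?bigU// => i.
by rewrite !inE. Qed.

Lemma wsignUr A B C : [disjoint B & C]%B -> wsign R A (B :|: C) = wsign R A B * wsign R A C.
Proof. move=> BC; rewrite !wsignE -big_split; apply: eq_bigr => a _.
by rewrite (eq_bigl [predU B & C]) ?bigU// => i; rewrite !inE. Qed.

Lemma wsign11 k l : wsign R [set k] [set l] = (-1) ^+ (l < k)%N.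
Proof. by rewrite wsignE !big_set1. Qed.

Lemma wsign_sqr A B : wsign R A B * wsign R A B = 1.
Proof. by rewrite /wsign -signr_odd -expr2 sqrr_sign. Qed.

Lemma normr_wsign A B : `|wsign R A B| = 1.
Proof. by rewrite normrX normrN1 expr1n. Qed.

Lemma disjoint1U k A : k \notin A -> [disjoint [set k]%SET & A]%B.
Proof. by rewrite finset.disjoints1. Qed.

Lemma wsignD1 k l J : k \in J -> wsign R [set l] J = (-1) ^+ (k < l)%N * wsign R [set l] (J :\ k).
Proof.
move=> kJ; rewrite -[in LHS](finset.setD1K kJ) wsignUr ?wsign11//.
by rewrite disjoint1U// !inE eqxx.
Qed.

Lemma wsignD1_same k J : wsign R [set k] (J :\ k) = wsign R [set k] J.
Proof.
have [kJ|kJ] := boolP (k \in J); first by rewrite (wsignD1 _ kJ) ltnn mul1r.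
by congr wsign; apply/finset.setDidPl; rewrite disjoint_sym disjoint1U.
Qed.

Lemma wsignU1 k l J : k \notin J -> wsign R [set l] (k |: J) = (-1) ^+ (k < l)%N * wsign R [set l] J.
Proof. by move=> kJ; rewrite wsignUr ?wsign11// disjoint1U. Qed.

Lemma sign_lt_neq k l : k != l -> (-1) ^+ (k < l)%N * (-1) ^+ (l < k)%N = -1 :> R.
Proof.
by move=> kl; case: ltngtP => [||/val_inj/eqP]; rewrite ?(negbTE kl)//= ?mulr1 ?mul1r.
Qed.

Lemma wsign_swap A k : k \notin A -> wsign R A [set k] * wsign R [set k] A = (-1) ^+ #|A|.
Proof.
move=> kA; rewrite !wsignE big_set1 -big_split/= -prodr_const.
apply: eq_bigr => a aA; rewrite big_set1 sign_lt_neq//.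
by apply: contraNneq kA => ->.
Qed.

(** Commuting theta_k past theta_(~: J) produces the power of -1. The result separates a sign that
    depends on J alone from the sign that k carries in an exterior derivative. *)
Lemma wsign_dwedge J k : k \in J ->
  wsign R (~: (J :\ k)) (J :\ k) * wsign R [set k] (~: (J :\ k) :\ k)
  = wsign R (~: J) J * (-1) ^+ #|~: J| * wsign R [set k] J.
Proof.
move=> kJ; have kJ' : k \notin ~: J by rewrite inE negbK.
have E : ~: (J :\ k) = k |: ~: J by rewrite finset.setDE finset.setCI finset.setCK finset.setUC.
have -> : ~: (J :\ k) :\ k = ~: J.
  rewrite E finset.setU1K//.
rewrite E wsignUl ?disjoint1U// wsignD1_same.
rewrite (_ : wsign R (~: J) J = wsign R (~: J) [set k] * wsign R (~: J) (J :\ k)); last first.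
  by rewrite -wsignUr ?finset.setD1K// disjoint1U// !inE eqxx.
rewrite -(wsign_swap kJ').
have := wsign_sqr (~: J) [set k]; set a := wsign R (~: J) [set k] => aa.
set b := wsign R (~: J) _; set c := wsign R _ (~: J); set d := wsign R _ J.
have -> : a * b * (a * c) * d = (a * a) * b * c * d by ring.
by rewrite aa; ring.
Qed.

Lemma fext_in r (w : lamform R N r) (I : kset N r) : fext w (val I) = w I.
Proof. by rewrite /fext valK. Qed.

Lemma fext_out r (w : lamform R N r) J : #|J| != r -> fext w J = 0.
Proof. by move=> Jr; rewrite /fext insubN. Qed.

Lemma sum_kset r (w : lamform R N r) (F : {set 'I_N} -> R) :
  \sum_(I : kset N r) F (val I) * w I = \sum_(I : {set 'I_N} | #|I| == r) F I * fext w I.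
Proof.
have := @big_sub R 0 +%R {set 'I_N} [pred I : {set 'I_N} | #|I| == r] (fun I => F I * fext w I).
rewrite /= => ->.
by apply: eq_bigr => I _; rewrite -fext_in.
Qed.

Lemma fext_dform s (phi : 'rV[R]_N -> lamform R N s) x J : #|J| = s.+1 ->
  fext (dform phi x) J = \sum_(k in J) wsign R [set k] (J :\ k) *
     pderiv k (fun y => fext (phi y) (J :\ k)) x.
Proof.
move=> Js; have Js' : #|J| == s.+1 by apply/eqP.
by rewrite -[J]/(val (Sub J Js' : kset N s.+1)) fext_in.
Qed.

(** The part of the sign in [wsign_dwedge] that does not depend on k. Being nonzero, it cancels from
    closedness conditions. *)
Definition dsign J : R := wsign R (~: J) J * (-1) ^+ #|~: J|.

Lemma dsign_neq0 J : dsign J != 0.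
Proof. by rewrite mulf_neq0// -normr_eq0 ?normr_wsign ?normrX ?normrN1 ?expr1n oner_eq0. Qed.

(** Reindexing the pairs (I, k) with k outside I by (k |: I, k) groups the terms by J = k |: I. The
    group of J involves only the component of phi on ~: J, and it is the weak form of the
    J-component of dw. *)
Lemma wedge_dform r s (phi : 'rV[R]_N -> lamform R N s) (w : lamform R N r) x :
  (s.+1 + r)%N = N -> wedge_top (dform phi x) w =
  \sum_(J : {set 'I_N} | #|J| == r.+1) dsign J *
    \sum_(k in J) wsign R [set k] J * pderiv k (fun y => fext (phi y) (~: J)) x * fext w (J :\ k).
Proof.
move=> srN; rewrite /wedge_top.
rewrite (sum_kset w (fun I => wsign R (~: I) I * fext (dform phi x) (~: I))).
pose G J k := dsign J * (wsign R [set k] J * pderiv k (fun y => fext (phi y) (~: J)) x * fext w (J :\ k)).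
transitivity (\sum_(I : {set 'I_N} | #|I| == r) \sum_(k | k \notin I) G (k |: I) k).
  apply: eq_bigr => I /eqP Ir.
  have cI : #|~: I| = s.+1 by have := finset.cardsC I; rewrite card_ord Ir; lia.
  rewrite (fext_dform _ _ cI) mulr_sumr mulr_suml.
  apply: eq_big => [k|k]; first by rewrite inE.
  rewrite inE => kI; rewrite /G /dsign !mulrA -wsign_dwedge ?finset.setU11//.
  rewrite finset.setU1K// (_ : ~: (k |: I) = ~: I :\ k)//.
  by apply/setP => i; rewrite !inE negb_or.
transitivity (\sum_(J : {set 'I_N} | #|J| == r.+1) \sum_(k in J) G J k); last first.
  by apply: eq_bigr => J _; rewrite mulr_sumr.
rewrite !pair_big_dep/=.
rewrite [RHS](reindex_onto (fun p : {set 'I_N} * 'I_N => (p.2 |: p.1, p.2)) (fun p => (p.1 :\ p.2, p.2)))/=.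
  apply: eq_bigl => -[I k] /=; rewrite finset.setU11 andbT xpair_eqE eqxx andbT.
  have [kI|kI] := boolP (k \in I).
    rewrite andbF; apply/esym/negbTE; rewrite negb_and; apply/orP; right.
    by apply/negP => /eqP IE; move: kI; rewrite -IE !inE eqxx.
  by rewrite finset.cardsU1 kI add1n eqSS finset.setU1K// eqxx.
by move=> [J k]/= /andP[_ kJ]; rewrite finset.setD1K.
Qed.

End exterior_signs.

(** * Real-valued integrable functions *)

Section Rintegrable.
Context d (T : measurableType d) (R : realType) (mu : {measure set T -> \bar R}).
Variable D : set T.
Hypothesis mD : measurable D.
Implicit Types f g : T -> R.

Local Notation integ f := (mu.-integrable D (EFin \o f)).

Lemma Rintegral_EFin f : integ f -> (\int[mu]_(x in D) (f x)%:E = (\int[mu]_(x in D) f x)%:E)%E.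
Proof. by move=> fi; rewrite /Rintegral fineK//; exact: integrable_fin_num. Qed.

Lemma Rintegral0_eq f : (forall x, D x -> f x = 0) -> \int[mu]_(x in D) f x = 0.
Proof.
move=> f0; rewrite (@eq_Rintegral _ _ _ _ _ (cst 0) f); first by rewrite Rintegral_cst ?mul0r.
by move=> x /set_mem/f0.
Qed.

Lemma integ_eq f g : (forall x, D x -> f x = g x) -> integ f -> integ g.
Proof. by move=> fg; apply: eq_integrable => // x /set_mem Dx /=; rewrite fg. Qed.

Lemma integD f g : integ f -> integ g -> integ (fun x => f x + g x).
Proof. by move=> fi gi; have := integrableD mD fi gi; apply: eq_integrable. Qed.

Lemma integB f g : integ f -> integ g -> integ (fun x => f x - g x).
Proof. by move=> fi gi; have := integrableB mD fi gi; apply: eq_integrable. Qed.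

Lemma integZ (c : R) f : integ f -> integ (fun x => c * f x).
Proof. by move=> fi; have := integrableZl mD c fi; apply: eq_integrable. Qed.

Lemma integ_norm f : integ f -> integ (fun x => `|f x|).
Proof. by move=> fi; have := integrable_abse fi. Qed.

Lemma integ_measurable f : integ f -> measurable_fun D f.
Proof. by move=> /integrableP[/measurable_EFinP]. Qed.

Lemma integ_mul (B : R) f g : measurable_fun D g -> (forall x, D x -> `|g x| <= B) ->
  integ f -> integ (fun x => g x * f x).
Proof.
move=> mg gB fi; have bg : [bounded g x | x in D].
  exists B; split; first exact: num_real.
  by move=> b Bb z Dz /=; rewrite (le_trans (gB _ _))// ltW.
have := integrableMr mD mg bg fi; exact: eq_integrable.
Qed.

Lemma integ_sum (I : Type) (s : seq I) (P : pred I) (f : I -> T -> R) :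
  (forall i, P i -> integ (f i)) -> integ (fun x => \sum_(i <- s | P i) f i x).
Proof.
move=> fi; have := @integrable_sum _ _ _ mu _ mD _ s P (fun i => EFin \o f i) fi.
by apply: eq_integrable => // x _ /=; rewrite -sumEFin.
Qed.

Lemma Rintegral_sum (I : Type) (s : seq I) (P : pred I) (f : I -> T -> R) :
  (forall i, P i -> integ (f i)) ->
  \int[mu]_(x in D) (\sum_(i <- s | P i) f i x) = \sum_(i <- s | P i) \int[mu]_(x in D) f i x.
Proof.
move=> fi; elim: s => [|i s IH].
  under eq_Rintegral do rewrite big_nil.
  by rewrite big_nil Rintegral_cst// mul0r.
rewrite big_cons; under eq_Rintegral do rewrite big_cons.
case: ifP => Pi //; rewrite RintegralD ?IH//; [exact: fi|exact: integ_sum].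
Qed.

Lemma integ_dominated f g : measurable_fun D f -> (forall x, D x -> `|f x| <= g x) -> integ g -> integ f.
Proof.
move=> mf fg; apply: le_integrable => //; first exact/measurable_EFinP.
by move=> x Dx /=; rewrite lee_fin (le_trans (fg _ Dx))// ler_norm.
Qed.

End Rintegrable.

(** * Weak closedness, component by component *)

Section closed_forms.
Variables (R : realType) (N : nat).
Implicit Types (I J : {set 'I_N}) (k l : 'I_N) (x : 'rV[R]_N).
Local Notation mu := (lebN R N).
Local Notation Q := (cubeN R N).
Local Notation integ f := (mu.-integrable Q (EFin \o f)).

Let mQ : measurable Q := @measurable_cubeN R N.

(** One scalar test function and one index set at a time. No degree is fixed, which avoids the
    subtypes [kset N r]; a form of degree r enters through [fext], extended by 0 to sets of other
    sizes. *)
Definition wclosed (V : {set 'I_N} -> RN R N -> R) :=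
  forall f : 'rV[R]_N -> R, smooth_fun f -> Zperiodic f -> forall J,
  \sum_(k in J) wsign R [set k] J * \int[mu]_(z in Q) (pderiv k f (coordN z) * V (J :\ k) z) = 0.

Lemma integ_mul_continuous (g : 'rV[R]_N -> R) (f : RN R N -> R) : continuous g -> integ f ->
  integ (fun z => g (coordN z) * f z).
Proof.
move=> cg fi; have [B gB] := continuous_bounded_cube cg.
apply: (@integ_mul _ _ _ _ _ _ B) => //.
  exact/measurable_funTS/continuous_measurable_coordN.
by move=> x /cubeN_le1/gB.
Qed.

Lemma smooth_pderiv_continuous (f : 'rV[R]_N -> R) k : smooth_fun f -> continuous (pderiv k f).
Proof. by move=> sf; have [] := sf [:: k]. Qed.

Lemma fext_Sub r (w : lamform R N r) J (Jr : #|J| == r) : fext w J = w (Sub J Jr).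
Proof. by rewrite -fext_in. Qed.

Section dclosed_wclosed.
Variables (r : nat) (u : 'rV[R]_N -> lamform R N r).
Let U J (z : RN R N) := fext (u (coordN z)) J.
Hypothesis iU : forall J, integ (U J).

Lemma integral_wedge_dform s (phi : 'rV[R]_N -> lamform R N s) : (s.+1 + r)%N = N ->
  test_form phi ->
  (\int[mu]_(x in Q) (wedge_top (dform phi (coordN x)) (u (coordN x)))%:E =
   (\sum_(J : {set 'I_N} | #|J| == r.+1) dsign R J * \sum_(k in J) wsign R [set k] J *
     \int[mu]_(z in Q) (pderiv k (fun y => fext (phi y) (~: J)) (coordN z) * U (J :\ k) z))%:E)%E.
Proof.
move=> srN [pphi sphi].
have sphi' J : smooth_fun (fun y => fext (phi y) J).
  have [/eqP Js|Js] := boolP (#|J| == s).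
    have Js' : #|J| == s by apply/eqP.
    by rewrite (_ : (fun y => _) = phi ^~ (Sub J Js'))//; apply/funext => y; rewrite fext_Sub.
  under eq_fun do rewrite fext_out//.
  have H t : pderivs t (fun=> 0 : R) = (fun=> 0) :> ('rV[R]_N -> R).
    by elim: t => //= k t ->; apply/funext => x; exact: derive_cst.
  move=> t; rewrite H; split; first exact: cst_continuous.
  by move=> k x; exact: derivable_cst.
have i1 k J : integ (fun z => pderiv k (fun y => fext (phi y) (~: J)) (coordN z) * U (J :\ k) z).
  by apply: integ_mul_continuous => //; exact: smooth_pderiv_continuous.
under eq_integral do rewrite wedge_dform//.
have E z : \sum_(J : {set 'I_N} | #|J| == r.+1) dsign R J * (\sum_(k in J)
     wsign R [set k] J * pderiv k (fun y => fext (phi y) (~: J)) (coordN z) * fext (u (coordN z)) (J :\ k))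
   = \sum_(J : {set 'I_N} | #|J| == r.+1) dsign R J * \sum_(k in J)
     wsign R [set k] J * (pderiv k (fun y => fext (phi y) (~: J)) (coordN z) * U (J :\ k) z).
  by apply: eq_bigr => J _; congr (_ * _); apply: eq_bigr => k _; rewrite mulrA.
under eq_integral do rewrite E.
have i2 J : integ (fun z => \sum_(k in J)
     wsign R [set k] J * (pderiv k (fun y => fext (phi y) (~: J)) (coordN z) * U (J :\ k) z)).
  by apply: integ_sum => // k _; exact: integZ.
rewrite Rintegral_EFin//; last by apply: integ_sum => // J _; exact: integZ.
rewrite Rintegral_sum//; last by move=> J _; exact: integZ.
congr (_%:E); apply: eq_bigr => J _; rewrite RintegralZl//; congr (_ * _).
rewrite Rintegral_sum//; last by move=> k _; exact: integZ.
by apply: eq_bigr => k _; rewrite RintegralZl.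
Qed.

Lemma wclosed_dclosed : wclosed U -> dclosed u.
Proof.
move=> wU s phi srN tphi; rewrite integral_wedge_dform//.
rewrite big1// => J Jr; have [pphi sphi] := tphi.
have sr : #|~: J| == s by have := finset.cardsC J; rewrite card_ord (eqP Jr) => h; apply/eqP; lia.
rewrite wU ?mulr0//.
  by rewrite (_ : (fun y => _) = phi ^~ (Sub (~: J) sr))//; apply/funext => y; rewrite fext_Sub.
by move=> k x; rewrite pphi.
Qed.

(** The test form has f as its only component, on ~: J, so a single group of [wedge_dform] survives.
    If #|J| is not r + 1, each J :\ k has the wrong size and every term is 0. *)
Lemma dclosed_wclosed : dclosed u -> wclosed U.
Proof.
move=> du f sf pf J.
have [Jr|Jr] := boolP (#|J| == r.+1); last first.
  rewrite big1// => k kJ.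
  rewrite Rintegral0_eq ?mulr0// => z _; rewrite /U fext_out ?mulr0//.
  by move: Jr; rewrite (cardsD1 k) kJ.
have srN : ((N - r.+1).+1 + r)%N = N.
  have : (#|J| <= N)%N by rewrite -[X in (_ <= X)%N]card_ord max_card.
  by rewrite (eqP Jr); lia.
pose phi (y : 'rV[R]_N) : lamform R N (N - r.+1) :=
  fun S : kset N (N - r.+1) => if val S == ~: J then f y else 0.
have tphi : test_form phi.
  split; first by move=> k x; apply/funext => I'; rewrite /phi pf.
  move=> S; rewrite /phi; have [//|_ t] := eqVneq (val S) (~: J).
  have -> : pderivs t (fun=> 0 : R) = (fun=> 0) :> ('rV[R]_N -> R).
    by elim: t => //= k t ->; apply/funext => x; exact: derive_cst.
  by split; [exact: cst_continuous|move=> k x; exact: derivable_cst].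
have := du _ phi srN tphi; rewrite integral_wedge_dform// (bigD1 J)//=.
have Jc : #|~: J| == (N - r.+1)%N.
  by have := finset.cardsC J; rewrite card_ord (eqP Jr) => h; apply/eqP; lia.
rewrite [X in _ + X]big1 ?addr0; last first.
  move=> J' /andP[J'r J'J]; rewrite big1 ?mulr0// => k kJ.
  rewrite Rintegral0_eq ?mulr0// => z _; rewrite (_ : (fun y => _) = cst 0).
    by rewrite /pderiv derive_cst mul0r.
  apply/funext => y; have J'c : #|~: J'| == (N - r.+1)%N.
    by have := finset.cardsC J'; rewrite card_ord (eqP J'r) => h; apply/eqP; lia.
  rewrite (fext_Sub _ J'c) /phi/= ifF//.
  by rewrite (inj_eq (can_inj finset.setCK)); exact: negbTE.
move=> [] /eqP; rewrite mulf_eq0 (negbTE (dsign_neq0 _ _))/= => /eqP JE.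
have fE : (fun y => fext (phi y) (~: J)) = f.
  by apply/funext => y; rewrite (fext_Sub _ Jc) /phi/= eqxx.
by rewrite fE in JE.
Qed.

End dclosed_wclosed.

End closed_forms.

(** * Algebra of d and of contractions; classically closed forms *)

Section homotopy_algebra.
Variables (R : realType) (N : nat).
Implicit Types (I J : {set 'I_N}) (k l : 'I_N) (x : 'rV[R]_N).
Local Notation mu := (lebN R N).
Local Notation Q := (cubeN R N).
Local Notation integ f := (mu.-integrable Q (EFin \o f)).
Local Notation sg k J := (wsign R [set k] J).

Let mQ : measurable Q := @measurable_cubeN R N.

Lemma sg_sqr k J : sg k J * sg k J = 1.
Proof. exact: wsign_sqr. Qed.

(** Contraction by e_k and exterior multiplication by theta_l anticommute when k and l differ. *)
Lemma sg_swapU k l J : k \notin J -> l \in J -> sg l J * sg k (J :\ l) = - (sg k J * sg l (k |: J)).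
Proof.
move=> kJ lJ; have kl : k != l by apply: contraNneq kJ => ->.
rewrite (wsignU1 R l kJ) (@wsignD1 R N l k J lJ).
have := sign_lt_neq R kl; set a := (-1) ^+ _; set b := (-1) ^+ _ => ab.
transitivity (- (a * b) * (sg l J * sg k (J :\ l))); last by ring.
by rewrite ab opprK mul1r.
Qed.

(** Exterior multiplications by theta_k and theta_l anticommute. *)
Lemma sg_swapD k l J : k \in J -> l \in J -> k != l ->
  sg l J * sg k (J :\ l) = - (sg k J * sg l (J :\ k)).
Proof.
move=> kJ lJ kl; rewrite (@wsignD1 R N l k J lJ) (@wsignD1 R N k l J kJ).
have := sign_lt_neq R kl; set a := (-1) ^+ _; set b := (-1) ^+ _ => ab.
transitivity (- (a * b) * a * (sg l (J :\ k) * sg k (J :\ l))).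
  by rewrite ab opprK; ring.
rewrite (_ : - (a * b) * a = - b * (a * a)); last by ring.
by rewrite -expr2 sqrr_sign mulr1; ring.
Qed.

(* Cartan's formula for the constant fields e_k: A I l k stands for the l-th
   derivative of the I-component of the k-th closed form. *)
Lemma cartan_sum (A : {set 'I_N} -> 'I_N -> 'I_N -> R) J :
  (forall J k, \sum_(l in J) sg l J * A (J :\ l) l k = 0) ->
  \sum_(l in J) sg l J * \sum_(k | k \notin J :\ l) sg k (J :\ l) * A (k |: (J :\ l)) l k
  = \sum_k A J k k.
Proof.
move=> cA; rewrite [RHS](bigID (mem J))/=.
have E l : l \in J -> sg l J * \sum_(k | k \notin J :\ l) sg k (J :\ l) * A (k |: (J :\ l)) l k
   = A J l l + \sum_(k | k \notin J) sg l J * sg k (J :\ l) * A (k |: (J :\ l)) l k.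
  move=> lJ; rewrite (bigD1 l)/=; last by rewrite !inE eqxx.
  rewrite finset.setD1K// wsignD1_same mulrDr mulrA sg_sqr mul1r; congr (_ + _).
  rewrite mulr_sumr; apply: eq_big => [k|k _]; last by rewrite mulrA.
  rewrite !inE negb_and negbK andb_orl; have [->|kl] := eqVneq k l.
    by rewrite lJ.
  by rewrite /= andbT.
rewrite (eq_bigr _ E) big_split/=; congr (_ + _).
rewrite exchange_big/=; apply: eq_bigr => k kJ.
transitivity (- sg k J * \sum_(l in J) sg l (k |: J) * A ((k |: J) :\ l) l k).
  rewrite mulr_sumr; apply: eq_bigr => l lJ; rewrite mulrA sg_swapU// !mulNr.
  congr (- (_ * A _ l k)); apply/setP => i; rewrite !inE.
  have [->|ik] := eqVneq i k; last by [].
  by rewrite /= andbT; apply/esym/idP; apply: contraNneq kJ => ->.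
have := cA (k |: J) k; rewrite (bigD1 k) ?finset.setU11//= finset.setU1K//.
rewrite (_ : \sum_(i in _ | i != k) _ = \sum_(l in J) sg l (k |: J) * A ((k |: J) :\ l) l k); last first.
  apply: eq_bigl => i; rewrite !inE; have [->|ik] := eqVneq i k; last by rewrite andbT.
  by rewrite (negbTE kJ).
move/eqP; rewrite addrC addr_eq0 => /eqP ->.
rewrite mulrNN mulrA -[sg k (k |: J)]wsignD1_same finset.setU1K//.
by rewrite sg_sqr mul1r.
Qed.

(** This is d d = 0, with [B I k l] in the role of a second derivative of the I-component:
    exchanging k and l shows that the sum equals its opposite. *)
Lemma ddsum0 (B : {set 'I_N} -> 'I_N -> 'I_N -> R) J : (forall I k l, B I k l = B I l k) ->
  \sum_(k in J) sg k J * \sum_(l in J :\ k) sg l (J :\ k) * B (J :\ k :\ l) k l = 0.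
Proof.
move=> sB; set S := (LHS).
pose F k l := sg k J * sg l (J :\ k) * B (J :\ k :\ l) k l.
have SE : S = \sum_(k in J) \sum_(l in J | l != k) F k l.
  apply: eq_bigr => k kJ; rewrite mulr_sumr; apply: eq_big => [l|l _]; last by rewrite /F mulrA.
  by rewrite !inE andbC.
have SN : S = - S.
  rewrite SE [LHS](exchange_big_dep (mem J))//=; last by move=> k l _ /andP[].
  rewrite -sumrN.
  apply: eq_bigr => l lJ; rewrite -sumrN; apply: eq_big => [k|k].
    by rewrite lJ/= [in RHS]eq_sym.
  move=> /and3P[kJ _ lk]; rewrite /F (sg_swapD lJ kJ lk) mulNr sB.
  congr (- (_ * B _ _ _)); apply/setP => i; rewrite !inE.
  by rewrite andbCA.
by move: SN; clearbody S => SN; lra.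
Qed.

Lemma integral_by_parts_torus (f W : 'rV[R]_N -> R) (DW : 'rV[R]_N -> R) k :
  smooth_fun f -> Zperiodic f -> Zperiodic W -> continuous W -> continuous DW ->
  (forall x, is_derive x (evec R k) W (DW x)) ->
  \int[mu]_(z in Q) (pderiv k f (coordN z) * W (coordN z)) =
  - \int[mu]_(z in Q) (f (coordN z) * DW (coordN z)).
Proof.
move=> sf pf pW cW cDW dW.
have cf : continuous f by have [] := sf [::].
have cdf : continuous (pderiv k f) := smooth_pderiv_continuous sf.
have fd x : is_derive x (evec R k) f (pderiv k f x).
  by apply: DeriveDef => //; have [_] := sf [::]; exact.
have c1 : continuous (fun x => pderiv k f x * W x) by move=> x; apply: continuousM; [exact: cdf|exact: cW].
have c2 : continuous (fun x => f x * DW x) by move=> x; apply: continuousM; [exact: cf|exact: cDW].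
have pfW : Zperiodic (fun x => f x * W x) by move=> i x; rewrite pf pW.
have dfW x : is_derive x (evec R k) (fun x => f x * W x) (f x * DW x + pderiv k f x * W x).
  by have := is_deriveM (fd x) (dW x); rewrite /GRing.scale/= [W x * _]mulrC.
have c3 : continuous (fun x => f x * DW x + pderiv k f x * W x).
  by move=> x; exact: (cvgD (c2 x) (c1 x)).
have := integral_derive_torus pfW dfW c3.
rewrite Rintegral_EFin//; last exact: (continuous_integrable_cube c3).
rewrite RintegralD//; [|exact: (continuous_integrable_cube c2)|exact: (continuous_integrable_cube c1)].
by move=> [] /eqP; rewrite addrC addr_eq0 => /eqP.
Qed.

(** Integration by parts moves the derivative from the test function to [V], where the alternating
    sum vanishes pointwise. *)
Lemma classical_wclosed (V : {set 'I_N} -> 'rV[R]_N -> R)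
    (DV : 'I_N -> {set 'I_N} -> 'rV[R]_N -> R) :
  (forall J, Zperiodic (V J)) -> (forall J, continuous (V J)) ->
  (forall k J, continuous (DV k J)) ->
  (forall k J x, is_derive x (evec R k) (V J) (DV k J x)) ->
  (forall J x, \sum_(k in J) sg k J * DV k (J :\ k) x = 0) ->
  wclosed (fun J z => V J (coordN z)).
Proof.
move=> pV cV cDV dV clV f sf pf J.
transitivity (- \int[mu]_(z in Q) \sum_(k in J) sg k J * (f (coordN z) * DV k (J :\ k) (coordN z))).
  have cf : continuous f by have [] := sf [::].
  have i1 k I : integ (fun z => f (coordN z) * DV k I (coordN z)).
    apply: (@continuous_integrable_cube _ _ (fun x => f x * DV k I x)) => x.
    by apply: continuousM; [exact: cf|exact: cDV].
  rewrite Rintegral_sum//; last by move=> k _; apply: integZ.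
  rewrite -sumrN; apply: eq_bigr => k _; rewrite RintegralZl// -mulrN; congr (_ * _).
  exact: integral_by_parts_torus.
rewrite Rintegral0_eq ?oppr0// => z _.
transitivity (f (coordN z) * \sum_(k in J) sg k J * DV k (J :\ k) (coordN z)).
  by rewrite mulr_sumr; apply: eq_bigr => k _; rewrite mulrCA.
by rewrite clV mulr0.
Qed.

(** The function z |-> K(x - z) is smooth and periodic, hence a legitimate test function; testing
    with it gives closedness of the mollified form at x. The reflection changes the sign of every
    derivative, so the whole identity is negated. *)
Lemma wclosed_conv (U : {set 'I_N} -> RN R N -> R) (K : 'I_N -> R -> R) J x : wclosed U ->
  (forall I, integ (U I)) ->
  (forall i, pker (K i)) ->
  \sum_(k in J) sg k J * convol (U (J :\ k)) (kupd K k (derive1 (K k))) x = 0.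
Proof.
move=> clU iU gK; pose Kx (i : 'I_N) (t : R) : R := K i (-1 * t + x 0 i).
have gKx i : pker (Kx i).
  split; first by apply: smooth1_affine; have [] := gK i.
  move=> t; rewrite /Kx mulrDr mulr1 addrAC.
  by have := pkerDz (-1 * t + x 0 i) (-1) (gK i); rewrite intrN.
have dKx i (t : R) : derive1 (Kx i) t = -1 * derive1 (K i) (-1 * t + x 0 i).
  suff : is_derive t 1 (Kx i) (-1 * derive1 (K i) (-1 * t + x 0 i)) by case/is_derive1E.
  by apply: is_derive_affine; apply: smooth1_is_derive; have [] := gK i.
have := clU _ (smooth_tensor gKx) (Zperiodic_tensor gKx) J.
move=> H; apply/eqP; rewrite -oppr_eq0 -sumrN; apply/eqP; rewrite -[RHS]H.
apply: eq_bigr => k _; rewrite -mulrN; congr (_ * _).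
have gK' : forall i, pker (kupd K k (derive1 (K k)) i).
  by apply: pker_kupd => //; exact: pker_derive.
rewrite -mulN1r -RintegralZl//; last exact: conv_integrable.
apply: eq_Rintegral => z _.
have -> : pderiv k (tensor Kx) (coordN z) = tensor (kupd Kx k (derive1 (Kx k))) (coordN z).
  by have dt := is_derive_tensor k (coordN z) gKx; exact: derive_val.
have E i : -1 * coordN z 0 i + x 0 i = (x - coordN z) 0 i by rewrite !mxE mulN1r addrC.
rewrite !tensor_kupd dKx E (_ : \prod_(i | i != k) Kx i _ = \prod_(i | i != k) K i ((x - coordN z) 0 i)).
  by ring.
by apply: eq_bigr => i _; rewrite /Kx E.
Qed.

End homotopy_algebra.

(** * Periodic functions with continuous second derivatives *)

Section C2_periodic.
Variables (R : realType) (N : nat).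

(** Derivatives are carried as data. The second ones, with their symmetry, serve to show through
    [ddsum0] that the exterior derivative of a cut potential is closed. *)
Record C2per (g : 'rV[R]_N -> R) (G1 : 'I_N -> 'rV[R]_N -> R)
  (G2 : 'I_N -> 'I_N -> 'rV[R]_N -> R) : Prop := C2Per {
  C2_d1 : forall k x, is_derive x (evec R k) g (G1 k x);
  C2_d2 : forall k l x, is_derive x (evec R l) (G1 k) (G2 k l x);
  C2_sym : forall k l x, G2 k l x = G2 l k x;
  C2_c0 : continuous g;
  C2_c1 : forall k, continuous (G1 k);
  C2_c2 : forall k l, continuous (G2 k l);
  C2_p0 : Zperiodic g;
  C2_p1 : forall k, Zperiodic (G1 k) }.

Lemma continuous_sumr (V : normedModType R) (I : Type) (r : seq I) (P : pred I) (f : I -> V -> R) :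
  (forall i, P i -> continuous (f i)) -> continuous (fun x => \sum_(i <- r | P i) f i x).
Proof.
move=> cf; elim: r => [|i r IH].
  by under eq_fun do rewrite big_nil; exact: cst_continuous.
case Pi : (P i); under eq_fun do rewrite big_cons Pi; last exact: IH.
move=> x.
exact: (cvgD (cf i Pi x) (IH x)).
Qed.

Lemma is_derive_sumr (V : normedModType R) (I : Type) (r : seq I) (P : pred I) (f : I -> V -> R)
   (df : I -> R) (x v : V) : (forall i, P i -> is_derive x v (f i) (df i)) ->
  is_derive x v (fun x => \sum_(i <- r | P i) f i x) (\sum_(i <- r | P i) df i).
Proof.
move=> fd; elim: r => [|i r IH].
  rewrite big_nil; under eq_fun do rewrite big_nil; exact: is_derive_cst.
rewrite big_cons; case Pi : (P i); under eq_fun do rewrite big_cons Pi; last exact: IH.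
exact: (is_deriveD (fd i Pi) IH).
Qed.

Lemma is_deriveZr (V : normedModType R) (c : R) (f : V -> R) (x v : V) (d : R) :
  is_derive x v f d -> is_derive x v (fun x => c * f x) (c * d).
Proof. by move=> fd; exact: (is_deriveZ c fd). Qed.

Lemma is_deriveMr (V : normedModType R) (f g : V -> R) (x v : V) (d e : R) :
  is_derive x v f d -> is_derive x v g e -> is_derive x v (fun x => f x * g x) (d * g x + f x * e).
Proof.
move=> fd gd; have := is_deriveM fd gd.
by rewrite /GRing.scale/= addrC [g x * _]mulrC.
Qed.

Lemma continuousZr (V : normedModType R) (c : R) (f : V -> R) : continuous f -> continuous (fun x => c * f x).
Proof. by move=> cf x; apply: continuousM; [exact: cst_continuous|exact: cf]. Qed.

Lemma continuousMr (V : normedModType R) (f g : V -> R) : continuous f -> continuous g ->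
  continuous (fun x => f x * g x).
Proof. by move=> cf cg x; apply: continuousM; [exact: cf|exact: cg]. Qed.

Lemma continuousDr (V : normedModType R) (f g : V -> R) : continuous f -> continuous g ->
  continuous (fun x => f x + g x).
Proof. by move=> cf cg x; exact: (cvgD (cf x) (cg x)). Qed.

Lemma C2per_sum (I : Type) (r : seq I) (P : pred I) g G1 G2 :
  (forall i, P i -> C2per (g i) (G1 i) (G2 i)) ->
  C2per (fun x => \sum_(i <- r | P i) g i x) (fun k x => \sum_(i <- r | P i) G1 i k x)
    (fun k l x => \sum_(i <- r | P i) G2 i k l x).
Proof.
move=> gC; split.
- by move=> k x; apply: is_derive_sumr => i Pi; have [] := gC i Pi.
- by move=> k l x; apply: is_derive_sumr => i Pi; have [] := gC i Pi.
- by move=> k l x; apply: eq_bigr => i Pi; have [] := gC i Pi.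
- by apply: continuous_sumr => i Pi; have [] := gC i Pi.
- by move=> k; apply: continuous_sumr => i Pi; have [] := gC i Pi.
- by move=> k l; apply: continuous_sumr => i Pi; have [] := gC i Pi.
- by move=> k x; apply: eq_bigr => i Pi; have [] := gC i Pi.
- by move=> l k x; apply: eq_bigr => i Pi; exact: (C2_p1 (gC i Pi)).
Qed.

Lemma C2perZ (c : R) g G1 G2 : C2per g G1 G2 ->
  C2per (fun x => c * g x) (fun k x => c * G1 k x) (fun k l x => c * G2 k l x).
Proof.
move=> [gd1 gd2 gs gc0 gc1 gc2 gp0 gp1]; split.
- by move=> k x; exact: is_deriveZr.
- by move=> k l x; exact: is_deriveZr.
- by move=> k l x; rewrite gs.
- exact: continuousZr.
- by move=> k; exact: continuousZr.
- by move=> k l; exact: continuousZr.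
- by move=> k x; rewrite gp0.
- by move=> l k x; rewrite gp1.
Qed.

Lemma C2perM f F1 F2 g G1 G2 : C2per f F1 F2 -> C2per g G1 G2 ->
  C2per (fun x => f x * g x) (fun k x => F1 k x * g x + f x * G1 k x)
    (fun k l x => (F2 k l x * g x + F1 k x * G1 l x) + (F1 l x * G1 k x + f x * G2 k l x)).
Proof.
move=> [fd1 fd2 fs fc0 fc1 fc2 fp0 fp1] [gd1 gd2 gs gc0 gc1 gc2 gp0 gp1]; split.
- by move=> k x; exact: is_deriveMr.
- move=> k l x; apply: is_deriveD; exact: is_deriveMr.
- by move=> k l x; rewrite fs gs; ring.
- exact: continuousMr.
- by move=> k; apply: continuousDr; exact: continuousMr.
- by move=> k l; apply: continuousDr; apply: continuousDr; exact: continuousMr.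
- by move=> k x; rewrite fp0 gp0.
- by move=> l k x; rewrite fp0 gp0 fp1 gp1.
Qed.

Definition kder (K : 'I_N -> R -> R) k := kupd K k (derive1 (K k)).

Lemma pker_kder K k : (forall i, pker (K i)) -> forall i, pker (kder K k i).
Proof. by move=> gK; apply: pker_kupd => //; exact: pker_derive. Qed.

Lemma kderC K k l : kder (kder K k) l = kder (kder K l) k.
Proof.
apply/funext => i; rewrite /kder /kupd.
have [->//|lk] := eqVneq l k.
by have [->|//] := eqVneq i l; rewrite (negbTE lk).
Qed.

Lemma C2per_tensor K : (forall i, pker (K i)) ->
  C2per (tensor K) (fun k => tensor (kder K k)) (fun k l => tensor (kder (kder K k) l)).
Proof.
move=> gK; split.
- by move=> k x; exact: is_derive_tensor.
- by move=> k l x; apply: is_derive_tensor; exact: pker_kder.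
- by move=> k l x; rewrite kderC.
- exact: continuous_tensor.
- by move=> k; apply: continuous_tensor; exact: pker_kder.
- by move=> k l; apply: continuous_tensor; do 2 apply: pker_kder.
- exact: Zperiodic_tensor.
- by move=> k; apply: Zperiodic_tensor; exact: pker_kder.
Qed.

Lemma C2per_convol (U : RN R N -> R) K :
  (lebN R N).-integrable (cubeN R N) (EFin \o U) -> (forall i, pker (K i)) ->
  C2per (convol U K) (fun k => convol U (kder K k)) (fun k l => convol U (kder (kder K k) l)).
Proof.
move=> iU gK; split.
- by move=> k x; exact: is_derive_conv.
- by move=> k l x; apply: is_derive_conv => //; exact: pker_kder.
- by move=> k l x; rewrite kderC.
- exact: continuous_conv.
- by move=> k; apply: continuous_conv => //; exact: pker_kder.
- by move=> k l; apply: continuous_conv => //; do 2 apply: pker_kder.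
- exact: Zperiodic_conv.
- by move=> k; apply: Zperiodic_conv; exact: pker_kder.
Qed.

End C2_periodic.

(** * Mollifiers, primitives and bumps at dyadic scales *)

Section scales.
Variable R : realType.

Lemma exp2_ge1 j : 1 <= 2 ^+ j :> R.
Proof. by rewrite exprn_ege1// ler1n. Qed.

(** The mollifier at scale 2^-j: periodic, of mass 1, supported within 2^-j / 4 of the integers. *)
Definition hk j : R -> R := derive1 (pstep (2 ^+ j)).

(** A primitive of [hk j - hk j.+1]. It is periodic since the growth of the two staircases cancels,
    and of size at most 1 at every scale. *)
Definition ck j (t : R) : R := pstep (2 ^+ j) t - pstep (2 ^+ j.+1) t.

(** A bump near m / 2^j. For m < 2^j these telescope to pstep t - pstep (t - 1) = 1: a partition of
    unity on the circle. *)
Definition bk j m (t : R) : R :=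
  pstep (2 ^+ j) (t - m%:R / 2 ^+ j) - pstep (2 ^+ j) (t - m.+1%:R / 2 ^+ j).

Lemma pker_hk j : pker (hk j).
Proof.
split; first exact/smooth1_derive/smooth1_pstep/exp2_ge1.
move=> t; rewrite /hk; set P := pstep _.
have sP : smooth1 P by exact/smooth1_pstep/exp2_ge1.
have E : (fun t : R => P (1 * t + 1)) = (fun t => P t + 1).
  by apply/funext => s; rewrite mul1r; have := @pstepDz R _ (exp2_ge1 j) s 1.
have d1 := @is_derive_affine R P 1 1 t _ (smooth1_is_derive _ sP).
have d2 := is_deriveD (smooth1_is_derive t sP) (is_derive_cst (1 : R) t (1 : R)).
have [_ e1] := is_derive1E d1; have [_ e2] := is_derive1E d2.
have : derive1 (fun t : R => P (1 * t + 1)) t = derive1 (P + cst 1) t by rewrite E.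
rewrite [LHS]e1 [RHS]e2 (mul1r t) (mul1r (derive1 P (t + 1))) => ->.
exact: addr0.
Qed.

Lemma pker_ck j : pker (ck j).
Proof.
split; last first.
  move=> t; rewrite /ck -[1 in LHS]/(1%:~R) !pstepDz ?exp2_ge1//; ring.
apply: smooth1D; first exact/smooth1_pstep/exp2_ge1.
by apply: smooth1N; exact/smooth1_pstep/exp2_ge1.
Qed.

Lemma pker_bk j m : pker (bk j m).
Proof.
have sP : smooth1 (pstep (2 ^+ j : R)) by exact/smooth1_pstep/exp2_ge1.
have sA (c : R) : smooth1 (fun t => pstep (2 ^+ j) (t - c)).
  by have := smooth1_affine 1 (- c) sP; under eq_fun do rewrite mul1r.
split; first by apply: smooth1D => //; exact: smooth1N.
move=> t; rewrite /bk [t + 1 - _]addrAC [t + 1 - m.+1%:R / _]addrAC.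
rewrite -[1 in LHS]/(1%:~R) !pstepDz ?exp2_ge1//; ring.
Qed.

Lemma derive_ck j : derive1 (ck j) = (fun t => hk j t - hk j.+1 t).
Proof.
apply: derive1_ext => t; apply: is_deriveB; apply: smooth1_is_derive;
  exact/smooth1_pstep/exp2_ge1.
Qed.

Lemma hk_supp j t : hk j t != 0 -> cdist t <= 4^-1 / 2 ^+ j.
Proof. by move=> ?; apply: derive_pstep_supp => //; exact: exp2_ge1. Qed.

Lemma ckE j t : ck j t = sstep (2 ^+ j * (t - (nint t)%:~R)) - sstep (2 ^+ j.+1 * (t - (nint t)%:~R)).
Proof. by rewrite /ck /pstep opprD addrACA subrr add0r. Qed.

Lemma ck_supp j t : ck j t != 0 -> cdist t <= 4^-1 / 2 ^+ j.
Proof.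
rewrite leNgt => h; apply/negP => tM; move/eqP: h; apply.
rewrite ckE; set n := (nint t)%:~R.
have e0 : 0 < 2 ^+ j :> R by rewrite exprn_gt0.
have le2 : 4^-1 / 2 ^+ j.+1 <= 4^-1 / 2 ^+ j :> R.
  by rewrite ler_pM2l ?invr_gt0// lef_pV2 ?posrE ?exprn_gt0// exprS ler_peMl ?ler1n// ltW.
move: tM; rewrite /cdist -/n; have [n0|n0] := leP 0 (t - n) => tM.
  by rewrite !sstepM1 ?subrr ?exp2_ge1//; rewrite ger0_norm// in tM; lra.
by rewrite !sstepM0 ?subrr ?exp2_ge1//; rewrite ltr0_norm// in tM; rewrite mulNr; lra.
Qed.

Lemma ck_le1 j t : `|ck j t| <= 1.
Proof.
rewrite ckE; set a := sstep _; set b := sstep _.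
have /andP[a0 a1] : 0 <= a <= 1 := sstep_ge0_le1 _.
have /andP[b0 b1] : 0 <= b <= 1 := sstep_ge0_le1 _.
by rewrite ler_norml; apply/andP; split; lra.
Qed.

Lemma bk_supp j m t : bk j m t != 0 -> cdist (t - m%:R / 2 ^+ j) <= 2 / 2 ^+ j.
Proof.
move=> h; apply: pstepB_supp; first exact: exp2_ge1.
move: h; rewrite /bk -(natr1 m) mulrDl mul1r.
by rewrite (opprD (m%:R / _)) addrA.
Qed.

Lemma is_derive_bk j m (t : R) : is_derive t 1 (bk j m)
  (hk j (t - m%:R / 2 ^+ j) - hk j (t - m.+1%:R / 2 ^+ j)).
Proof.
have H (c : R) : is_derive t 1 (fun t : R => pstep (2 ^+ j) (t - c)) (hk j (t - c)).
  have sP : smooth1 (pstep (2 ^+ j : R)) by exact/smooth1_pstep/exp2_ge1.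
  have := @is_derive_affine R _ 1 (- c) t _ (smooth1_is_derive _ sP).
  by rewrite !mul1r; under eq_fun do rewrite mul1r.
exact: is_deriveB.
Qed.

Lemma derive_bk j m (t : R) :
  derive1 (bk j m) t = hk j (t - m%:R / 2 ^+ j) - hk j (t - m.+1%:R / 2 ^+ j).
Proof. by have [] := is_derive1E (is_derive_bk j m t). Qed.

Lemma derive_bk_supp j m (t : R) : derive1 (bk j m) t != 0 -> cdist (t - m%:R / 2 ^+ j) <= 2 / 2 ^+ j.
Proof.
have e0 : 0 < (2 ^+ j)^-1 :> R by rewrite invr_gt0 exprn_gt0.
rewrite derive_bk => h.
have [h0|/hk_supp] := eqVneq (hk j (t - m%:R / 2 ^+ j)) 0; last by move=> /le_trans; apply; lra.
have /hk_supp h1 : hk j (t - m.+1%:R / 2 ^+ j) != 0 by move: h; rewrite h0 sub0r oppr_eq0.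
rewrite (_ : t - _ = (t - m.+1%:R / 2 ^+ j) + (2 ^+ j)^-1); last by rewrite -(natr1 m); ring.
rewrite (le_trans (cdistD _ _))//.
have := @cdist_le_norm R (2 ^- j); rewrite (gtr0_norm e0); lra.
Qed.

Lemma sum_bk j (t : R) : \sum_(m < 2 ^ j) bk j m t = 1.
Proof.
rewrite -(big_mkord xpredT (fun m => bk j m t)).
under eq_bigr do rewrite /bk -opprB.
rewrite sumrN (telescope_sumr (fun m => pstep (2 ^+ j) (t - m%:R / 2 ^+ j)))//.
rewrite mul0r subr0 natrX divff ?expf_neq0 ?pnatr_eq0//.
have := @pstepDz R (2 ^+ j) (exp2_ge1 j) t (-1); rewrite intrN => ->.
by rewrite opprB opprD opprK addNKr.
Qed.

Section bounds.
Variable B : R.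
Hypothesis B1 : 1 <= B.
Hypothesis dB : forall t, `|derive1 (@sstep R) t| <= B.

Lemma hk_le j t : `|hk j t| <= B * 2 ^+ j.
Proof.
rewrite /hk derive_pstepE ?exp2_ge1// normrM (@ger0_norm _ (2 ^+ j)) ?exprn_ge0//.
by rewrite [leRHS]mulrC ler_wpM2l ?exprn_ge0.
Qed.

(** The staircase stays within 3/2 of the identity, so the difference of two values is at most 3
    plus the shift 2^-j <= 1. *)
Lemma bk_le j m t : `|bk j m t| <= 4.
Proof.
have P3 (s : R) : `|pstep (2 ^+ j) s - s| <= 3 / 2.
  rewrite /pstep (_ : _ - s = sstep (2 ^+ j * (s - (nint s)%:~R)) - (s - (nint s)%:~R)); last by ring.
  have := cdist_le_half s; rewrite /cdist => s2.
  rewrite (le_trans (ler_normB _ _))//.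
  have /andP[a0 a1] := sstep_ge0_le1 (2 ^+ j * (s - (nint s)%:~R)).
  by rewrite (ger0_norm a0); lra.
have e1 : 0 < (2 ^+ j : R)^-1 <= 1 by rewrite invr_gt0 exprn_gt0//= invf_le1 ?exprn_gt0// exp2_ge1.
rewrite /bk -(natr1 m) mulrDl mul1r; set s := t - _; set e := (2 ^+ j)^-1 in e1 *.
rewrite (_ : t - (_ + e) = s - e); last by rewrite /s opprD addrA.
rewrite (_ : _ - _ = (pstep (2 ^+ j) s - s) - (pstep (2 ^+ j) (s - e) - (s - e)) + e); last by ring.
rewrite (le_trans (ler_normD _ _))//; have := ler_normB (pstep (2 ^+ j) s - s) (pstep (2 ^+ j) (s - e) - (s - e)).
have := P3 s; have := P3 (s - e); case/andP: e1 => e1 e2; rewrite (gtr0_norm e1).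
by move=> *; lra.
Qed.

Lemma derive_bk_le j m t : `|derive1 (bk j m) t| <= 2 * B * 2 ^+ j.
Proof.
rewrite derive_bk (le_trans (ler_normB _ _))//.
by rewrite (_ : 2 * B * 2 ^+ j = B * 2 ^+ j + B * 2 ^+ j) ?lerD ?hk_le//; ring.
Qed.

End bounds.

End scales.

Import HBSimple.

(** * Density of Lipschitz functions in L^1 *)

Section L1_density.
Context d (T : measurableType d) (R : realType) (mu : {measure set T -> \bar R}).
Variables (D : set T) (clo : R -> T -> T -> Prop).
Hypotheses (mD : measurable D) (finD : (mu D < +oo)%E).
Local Notation integ f := (mu.-integrable D (EFin \o f)).
Implicit Types f g h : T -> R.

(** [clo s x z] stands for distance at most s, so that one argument serves the circle and the
    torus. *)
Definition lipD g := [/\ measurable_fun D g, exists B : R, forall x, D x -> `|g x| <= B &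
  exists2 M : R, 0 <= M & forall (s : R) x z, 0 <= s -> D x -> D z -> clo s x z ->
    `|g x - g z| <= M * s].

Definition apxD f := forall e : R, 0 < e -> exists2 g, lipD g & \int[mu]_(x in D) `|f x - g x| <= e.

Lemma lipD_integ g : lipD g -> integ g.
Proof. by move=> [mg [B gB] _]; exact: (bounded_integrable mD finD mg gB). Qed.

Lemma integ_indic (S : set T) : measurable S -> integ (\1_S).
Proof.
move=> mS; apply: (@bounded_integrable _ _ _ _ _ _ 1) => // x _.
by rewrite indicE; case: (_ \in _); rewrite ?normr1 ?normr0.
Qed.

Lemma integ_dist f g : integ f -> integ g -> integ (fun x => `|f x - g x|).
Proof. by move=> fi gi; apply: integ_norm => //; exact: integB. Qed.

Lemma lipDD g h : lipD g -> lipD h -> lipD (fun x => g x + h x).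
Proof.
move=> [mg [B gB] [M M0 gM]] [mh [B' hB] [M' M0' hM]]; split.
- exact: measurable_funD.
- by exists (B + B') => x Dx; rewrite (le_trans (ler_normD _ _))// lerD ?gB ?hB.
- exists (M + M'); first exact: addr_ge0.
  move=> s x z s0 Dx Dz xz; rewrite opprD addrACA (le_trans (ler_normD _ _))//.
  by rewrite mulrDl lerD ?gM ?hM.
Qed.

Lemma lipDZ (c : R) g : lipD g -> lipD (fun x => c * g x).
Proof.
move=> [mg [B gB] [M M0 gM]]; split.
- by apply: measurable_funM.
- by exists (`|c| * B) => x Dx; rewrite normrM ler_wpM2l// gB.
- exists (`|c| * M); first exact: mulr_ge0.
  by move=> s x z s0 Dx Dz xz; rewrite -mulrBr normrM -mulrA ler_wpM2l// gM.
Qed.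

Lemma lipD_cst (c : R) : lipD (cst c).
Proof.
split => //; first by exists `|c|.
by exists 0 => // s x z s0 _ _ _; rewrite subrr normr0 mul0r.
Qed.

Lemma dist_triangle f g h : integ f -> integ g -> integ h ->
  \int[mu]_(x in D) `|f x - h x| <=
  \int[mu]_(x in D) `|f x - g x| + \int[mu]_(x in D) `|g x - h x|.
Proof.
move=> fi gi hi; rewrite -RintegralD//; [|exact: integ_dist..].
apply: le_Rintegral => //; [exact: integ_dist| |].
- by apply: integD => //; exact: integ_dist.
- by move=> x _; exact: ler_distD.
Qed.

Lemma apxD_closed f : integ f ->
  (forall e : R, 0 < e -> exists g, [/\ apxD g, integ g & \int[mu]_(x in D) `|f x - g x| <= e]) -> apxD f.
Proof.
move=> fi fapx e e0; have e2 : 0 < e / 2 by rewrite divr_gt0.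
have [g [ag gi fg]] := fapx _ e2; have [h lh gh] := ag _ e2.
exists h => //; rewrite (le_trans (dist_triangle fi gi (lipD_integ lh)))//.
by rewrite [leRHS]splitr lerD.
Qed.

Lemma lipD_apxD g : lipD g -> apxD g.
Proof.
move=> lg e e0; exists g => //; rewrite Rintegral0_eq ?ltW// => x _.
by rewrite subrr normr0.
Qed.

Lemma apxDD f g : integ f -> integ g -> apxD f -> apxD g -> apxD (fun x => f x + g x).
Proof.
move=> fi gi af ag e e0; have e2 : 0 < e / 2 by rewrite divr_gt0.
have [f' lf ff'] := af _ e2; have [g' lg gg'] := ag _ e2.
have f'i := lipD_integ lf; have g'i := lipD_integ lg.
exists (fun x => f' x + g' x); first exact: lipDD.
rewrite [leRHS]splitr (le_trans _ (lerD ff' gg'))//.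
rewrite -RintegralD//; [|exact: integ_dist..].
apply: le_Rintegral => //; [by apply: integ_dist; exact: integD| |].
- by apply: integD => //; exact: integ_dist.
- by move=> x _; rewrite opprD addrACA; exact: ler_normD.
Qed.

Lemma apxDZ (c : R) f : integ f -> apxD f -> apxD (fun x => c * f x).
Proof.
move=> fi af e e0; have c1 : 0 < `|c| + 1 by rewrite ltr_wpDl.
have [f' lf ff'] := af (e / (`|c| + 1)) (divr_gt0 e0 c1).
have f'i := lipD_integ lf.
exists (fun x => c * f' x); first exact: lipDZ.
under eq_Rintegral do rewrite -mulrBr normrM.
rewrite RintegralZl//; last exact: integ_dist.
rewrite (le_trans (ler_wpM2l _ ff'))// mulrCA ger_pMr// ler_pdivrMr// mul1r.
by rewrite lerDl.
Qed.

Lemma apxD_sum (I : Type) (s : seq I) (f : I -> T -> R) :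
  (forall i, integ (f i)) -> (forall i, apxD (f i)) -> apxD (fun x => \sum_(i <- s) f i x).
Proof.
move=> fi af; elim: s => [|i s IH].
  by under eq_fun do rewrite big_nil; exact/lipD_apxD/lipD_cst.
under eq_fun do rewrite big_cons; apply: apxDD => //.
exact: integ_sum.
Qed.

Lemma bounded_cvg_L1 (F : nat -> T -> R) f (B : R) : (forall n, measurable_fun D (F n)) ->
  measurable_fun D f -> (forall n x, D x -> `|F n x| <= B) ->
  (forall x, D x -> F n x @[n --> \oo] --> f x) ->
  \int[mu]_(x in D) `|F n x - f x| @[n --> \oo] --> 0.
Proof.
move=> mF mf FB Ff.
have iB : mu.-integrable D (EFin \o cst B).
  by apply: (@bounded_integrable _ _ _ _ _ _ `|B|).
have [||||_ + _] := @dominated_convergence _ _ _ mu D mD (fun n => EFin \o F n) (EFin \o f) (EFin \o cst B) _ _ _ iB.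
- by move=> n; exact/measurable_EFinP.
- exact/measurable_EFinP.
- by apply: aeW => x Dx; apply: cvg_EFin; [exact: nearW|exact: Ff].
- by apply: aeW => x n Dx /=; rewrite lee_fin FB.
by move=> /fine_cvg.
Qed.

(** By disjointness the partial sums of the indicators stay below 1, so they converge in L^1 by
    dominated convergence. *)
Lemma apxD_indic_bigcup (F : (set T)^nat) : (forall n, measurable (F n)) -> trivIset setT F ->
  (forall n, apxD (\1_(F n))) -> apxD (\1_(\bigcup_k F k)).
Proof.
move=> mF tF aF.
have mU : measurable (\bigcup_k F k) by exact: bigcupT_measurable.
have E x : (\sum_(i < n) \1_(F i) x)%R @[n --> \oo] --> (\1_(\bigcup_k F k) x : R).
  have [[k _ Fkx]|nF] := pselect ((\bigcup_k F k) x).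
    apply: cvg_near_cst; exists k.+1 => // n /= kn.
    rewrite indicE mem_set; last by exists k.
    rewrite (bigD1 (Ordinal kn))//= indicE mem_set// big1 ?addr0// => i ik.
    rewrite indicE memNset// => Fix.
    by move/eqP: ik; apply; apply/val_inj => /=; apply: (tF i k) => //; exists x.
  rewrite indicE memNset//; apply: cvg_near_cst; apply: nearW => n; rewrite big1// => i _.
  by rewrite indicE memNset// => Fx; apply: nF; exists i.
have S1 n x : `|(\sum_(i < n) \1_(F i) x)%R : R| <= 1.
  rewrite ger0_norm; last by apply: sumr_ge0 => i _; rewrite indicE.
  have [[i Fi]|nF] := pselect (exists i : 'I_n, F i x).
    rewrite (bigD1 i)//= indicE mem_set// big1 ?addr0// => k ki.
    rewrite indicE memNset// => Fkx.
    by move/eqP: ki; apply; apply/val_inj => /=; apply: (tF k i) => //; exists x.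
  by rewrite big1 ?ler01// => i _; rewrite indicE memNset// => Fx; apply: nF; exists i.
apply: apxD_closed; first exact: integ_indic.
have mS n : measurable_fun D (fun x => \sum_(i < n) \1_(F i) x : R).
  have iS : integ (fun x => \sum_(i < n) \1_(F i) x : R).
    by apply: integ_sum => // i _; exact: integ_indic.
  exact: integ_measurable iS.
move=> e e0; have /cvgrPdist_le/(_ _ e0)[n _ /(_ n (leqnn n))] :=
  bounded_cvg_L1 mS (integ_measurable (integ_indic mU)) (fun n x _ => S1 n x) (fun x _ => E x).
rewrite sub0r normrN => h; exists (fun x => \sum_(i < n) \1_(F i) x); split.
- by apply: apxD_sum => i //; exact: integ_indic.
- by apply: integ_sum => // i _; exact: integ_indic.
- rewrite (le_trans _ h)// (le_trans _ (ler_norm _))//.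
  by under eq_Rintegral do rewrite distrC.
Qed.

(** Dynkin's theorem: the sets with an approximable indicator form a lambda-system, so a generating
    pi-system suffices. *)
Lemma apxD_indic (G : set (set T)) : @measurable _ T = <<s G >> -> setI_closed G ->
  (forall A, G A -> apxD (\1_A)) -> forall A, measurable A -> apxD (\1_A).
Proof.
move=> mG GI GA A mA.
have mGA : <<s G >> A by rewrite -mG.
apply: (dynkin_induction mG GI _ GA _ _ mGA).
- by apply: lipD_apxD; rewrite indicT; exact: lipD_cst.
- move=> S mS aS; rewrite (_ : \1_(~` S) = (fun x => cst 1 x + (-1) * \1_S x)); last first.
    by apply/funext => x; rewrite !indicE in_setC; case: (_ \in _); rewrite /= ?mulr1 ?mulr0 ?addr0 ?subrr.
  apply: apxDD.
  + exact: (lipD_integ (lipD_cst 1)).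
  + by apply: integZ => //; exact: integ_indic.
  + exact/lipD_apxD/lipD_cst.
  + by apply: apxDZ => //; exact: integ_indic.
- by move=> F mF tF aF; exact: apxD_indic_bigcup.
Qed.

Lemma apxD_integrable (G : set (set T)) : @measurable _ T = <<s G >> -> setI_closed G ->
  (forall A, G A -> apxD (\1_A)) -> forall f, integ f -> apxD f.
Proof.
move=> mG GI GA f fi; have aI := apxD_indic mG GI GA.
apply: apxD_closed => // e e0.
have [g [gi _ gf]] := approximation_sfun_integrable mD fi.
have i2 n : integ (fun z => `|f z - g n z|) by apply: integ_dist => //; exact: gi.
have gf' : (\int[mu]_(z in D) `|f z - g n z|) @[n --> \oo] --> (0 : R).
  apply: fine_cvg; move: gf; apply: cvg_trans; apply: near_eq_cvg; apply: nearW => n /=.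
  by apply: eq_integral => x _ /=.
have /cvgrPdist_le/(_ _ e0)[n _ /(_ n (leqnn n))] := gf'.
rewrite sub0r normrN => h; exists (g n); split.
- have -> : (g n : T -> R) = (fun x => \sum_(y <- finmap.enum_fset (fset_set (range (g n)))) y * \1_(g n @^-1` [set y]) x).
    by apply/funext => x; rewrite fimfunE fsbig_finite.
  have mg y : measurable (g n @^-1` [set y]) by exact: measurable_sfunP.
  by apply: apxD_sum => y; [apply: integZ => //; exact: integ_indic|apply: apxDZ; [exact: integ_indic|exact: aI]].
- exact: gi.
- exact: le_trans (ler_norm _) h.
Qed.

End L1_density.

(** * Density of Lipschitz functions on the torus *)

Section torus_density.
Variable R : realType.
Local Notation I01 := (`[0, 1[%classic : set R).

Let finI : (lebesgue_measure I01 < +oo)%E.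
Proof. by rewrite lebesgue_measure_itv/= lte_fin ltr01 oppr0 adde0 ltry. Qed.

(** For a >= 0 it vanishes at both 0 and 1, hence is continuous across the point where the circle is
    cut open. Its multiples capped at 1 tend to the indicator of ]a, 1[. *)
Definition tent (a t : R) : R := Num.max 0 (Num.min (t - a) (1 - t)).

Lemma tent_ge0 a t : 0 <= tent a t.
Proof. by rewrite /tent le_max lexx. Qed.

(** For t <= s the integer nearest to s - t is 0 or 1. In the first case the distance is that of the
    line; in the second the short way passes through the cut, and the two values are at most 1 - s
    and t. *)
Lemma tent_lip (a s t : R) : 0 <= a -> 0 <= s < 1 -> 0 <= t < 1 -> `|tent a s - tent a t| <= cdist (s - t).
Proof.
suff H (s' t' : R) : 0 <= a -> 0 <= s' < 1 -> 0 <= t' < 1 -> t' <= s' -> `|tent a s' - tent a t'| <= cdist (s' - t').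
  move=> a0 s01 t01; have [st|/ltW st] := leP s t; last exact: H.
  by rewrite distrC cdistB; exact: H.
move=> a0 /andP[s0 s1] /andP[t0 t1] ts.
have H1 : `|tent a s' - tent a t'| <= s' - t'.
  rewrite /tent /Num.max /Num.min ler_norml; do !case: ifPn; rewrite -?leNgt => *; apply/andP; split; lra.
have H2 : `|tent a s' - tent a t'| <= 1 - (s' - t').
  rewrite /tent /Num.max /Num.min ler_norml; do !case: ifPn; rewrite -?leNgt => *; apply/andP; split; lra.
rewrite /cdist; set n := nint _.
have n01 : (n == 0) || (n == 1).
  have /andP[f1 f2] := floor_itv (s' - t' + 2^-1); rewrite -/(nint _) -/n in f1 f2.
  have : (n%:~R < (2 : int)%:~R :> R) && ((-1)%:~R < n%:~R :> R).
    rewrite intrD in f2; apply/andP; split; rewrite ?intrN; lra.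
  by rewrite !ltr_int => /andP[]; clearbody n; clear; lia.
move: n01 => /orP[]/eqP ->.
  by rewrite subr0 (le_trans H1)// ler_norm.
by rewrite (le_trans H2)// distrC ler_norm.
Qed.

Definition clo1 (s x z : R) := cdist (x - z) <= s.

Lemma apxD_ray (a : R) : apxD lebesgue_measure I01 clo1 (\1_(`]a, +oo[%classic)).
Proof.
have mI : measurable I01 by [].
have mr : measurable_fun I01 (\1_(`]a, +oo[%classic) : R -> R).
  by apply: measurable_indic.
have ir : lebesgue_measure.-integrable I01 (EFin \o (\1_(`]a, +oo[%classic) : R -> R)).
  exact: integ_indic.
(* For a < 0 the ray contains [0, 1[, where its indicator is constant. *)
have [a0|a0] := ltP a 0.
  have l1 : lipD I01 clo1 (cst 1 : R -> R) by exact: lipD_cst.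
  move=> e e0; exists (cst 1) => //; rewrite Rintegral0_eq ?ltW// => x /=.
  rewrite in_itv/= => /andP[x0 _]; rewrite indicE mem_set ?subrr ?normr0//=.
  by rewrite in_itv/= andbT (lt_le_trans a0).
pose F (n : nat) (t : R) : R := Num.min 1 (n%:R * tent a t).
have ct : continuous (tent a).
  apply: (@lipschitz_continuous _ _ _ _ 1) => x y; rewrite mul1r /tent /Num.max /Num.min.
  by have [xy|xy] := leP 0 (x - y); rewrite ?(ger0_norm xy) ?(ltr0_norm xy) ler_norml;
   do !case: ifPn; rewrite -?leNgt => *; apply/andP; split; lra.
have mt : measurable_fun setT (tent a) by exact: continuous_measurable_fun.
have mF n : measurable_fun I01 (F n).
  by apply: measurable_funTS; apply: measurable_minr => //; apply: measurable_funM.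
have F0 n t : 0 <= F n t <= 1.
  by rewrite /F le_min ler01 mulr_ge0 ?tent_ge0//= ge_min lexx.
have lF n : lipD I01 clo1 (F n).
  split => //; first by exists 1 => x _; have /andP[h0 h1] := F0 n x; rewrite ger0_norm.
  exists n%:R => // s x z s0 /=; rewrite !in_itv/= => Dx Dz xz.
  have := tent_lip a0 Dx Dz; rewrite /clo1 in xz => /le_trans/(_ xz) h.
  rewrite (@le_trans _ _ (`|n%:R * tent a x - n%:R * tent a z|))//.
    rewrite /F /Num.min; set p := n%:R * tent a x; set q := n%:R * tent a z.
    by have [pq|pq] := leP 0 (p - q); rewrite ?(ger0_norm pq) ?(ltr0_norm pq) ler_norml;
      do !case: ifPn; rewrite -?leNgt => *; apply/andP; split; lra.
  by rewrite -mulrBr normrM ger0_norm// ler_wpM2l.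
have iF n := @lipD_integ _ _ _ lebesgue_measure _ _ mI finI _ (lF n).
apply: apxD_closed => // e e0.
have FB n x : I01 x -> `|F n x| <= 1 by move=> _; have /andP[h0 h1] := F0 n x; rewrite ger0_norm.
have Fc x : I01 x -> F n x @[n --> \oo] --> (\1_(`]a, +oo[%classic) x : R).
  rewrite /= in_itv/= => /andP[x0 x1]; rewrite indicE; have [xa|ax] := leP x a.
    rewrite memNset/=; last by rewrite in_itv/= andbT; apply/negP; rewrite -leNgt.
    apply: cvg_near_cst; apply: nearW => n; rewrite /F /tent.
    have -> : Num.max 0 (Num.min (x - a) (1 - x)) = 0.
      by apply/max_idPl; rewrite ge_min subr_le0 xa.
    by rewrite mulr0; apply/min_idPr.
  rewrite mem_set/=; last by rewrite in_itv/= andbT.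
  have tp : 0 < tent a x.
    by rewrite /tent lt_max lt_min !subr_gt0 ax x1/= orbT.
  apply: cvg_near_cst; near=> n; apply/min_idPl.
  rewrite -ler_pdivrMr// div1r; near: n; exact: nbhs_infty_ger.
have /cvgrPdist_le/(_ _ e0)[n _ /(_ n (leqnn n))] :=
  @bounded_cvg_L1 _ _ _ lebesgue_measure _ mI finI _ _ _ mF mr FB Fc.
rewrite sub0r normrN => h; exists (F n); split => //.
  exact: (@lipD_apxD _ _ _ lebesgue_measure _ _ mI _ (lF n)).
rewrite (le_trans _ h)// (le_trans _ (ler_norm _))//.
by under eq_Rintegral do rewrite distrC.
Unshelve. all: by end_near. Qed.

Lemma apxD_circle (A : set R) : measurable A -> apxD lebesgue_measure I01 clo1 (\1_A).
Proof.
apply: (@apxD_indic _ _ _ _ _ _ _ finI (RGenOInfty.G (R:=R))) => //.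
- exact: RGenOInfty.measurableE.
- move=> _ _ [a ->] [b ->]; exists (Num.max a b).
  apply/seteqP; split => x /=; rewrite !in_itv/= !andbT.
    by move=> [ax bx]; rewrite gt_max ax.
  by rewrite gt_max => /andP[].
- by move=> _ [a ->]; exact: apxD_ray.
Qed.

Definition cloN N (s : R) (x z : RN R N) := forall i, cdist (coordN x 0 i - coordN z 0 i) <= s.

(** Rectangles generate the measurable sets of a product, and the product of approximants of two
    indicators approximates the indicator of the rectangle. *)
Lemma apxD_torus N (f : RN R N -> R) : (lebN R N).-integrable (cubeN R N) (EFin \o f) ->
  apxD (lebN R N) (cubeN R N) (@cloN N) f.
Proof.
have mC n := @measurable_cubeN R n; have fC n := @lebN_cubeN_lty R n.
elim: N f => [|N IH] f fi.
  apply: lipD_apxD; split.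
  - exact: (integ_measurable fi).
  - by exists `|f tt| => -[].
  - exists 0 => // s [] [] s0 _ _ _; rewrite subrr normr0 mul0r//.
have mI : measurable I01 by [].
apply: (@apxD_integrable _ _ _ _ _ _ (mC N.+1) (fC N.+1)
  [set A `*` B | A in measurable & B in measurable]) => //.
- exact: measurable_prod_measurableType.
- move=> _ _ [A1 mA1 [A2 mA2 <-]] [B1 mB1 [B2 mB2 <-]].
  exists (A1 `&` B1); first exact: measurableI.
  by exists (A2 `&` B2); [exact: measurableI|rewrite setXI].
move=> _ [A1 mA1 [A2 mA2 <-]] e e0.
have e2 : 0 < e / 2 by rewrite divr_gt0.
have [g1 l1 d1] := apxD_circle mA1 e2.
have ig1 := @lipD_integ _ _ _ lebesgue_measure _ _ mI finI _ l1.
have [mg1 [B1 gB1] [M1 M10 gM1]] := l1.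
have B0 : 0 < `|B1| + 1 by rewrite ltr_wpDl.
have iA2 := integ_indic (mC N) (fC N) mA2.
(* The error in the second factor is later multiplied by [g1], whose size is at most |B1| + 1. *)
have [g2 l2 d2] := IH _ iA2 (e / 2 / (`|B1| + 1)) (divr_gt0 e2 B0).
have ig2 := lipD_integ (mC N) (fC N) l2.
have [mg2 [B2 gB2] [M2 M20 gM2]] := l2.
have CS z : cubeN R N.+1 z -> I01 z.1 /\ cubeN R N z.2 by rewrite cubeNS => -[].
have mp1 (g : R -> R)  : measurable_fun I01 g -> measurable_fun (cubeN R N.+1) (fun z => g z.1).
  move=> mg; apply: (@measurable_comp _ _ _ _ _ _ I01 _ (cubeN R N.+1) fst) => //.
    by move=> _ [z /CS[z1 _] <-].
  by apply: measurable_funTS; exact: (@measurable_fst _ _ _ (RN R N)).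
have mp2 (g : RN R N -> R) : measurable_fun (cubeN R N) g -> measurable_fun (cubeN R N.+1) (fun z => g z.2).
  move=> mg; apply: (@measurable_comp _ _ _ _ _ _ (cubeN R N) _ (cubeN R N.+1) snd) => //.
    by move=> _ [z /CS[_ z2] <-].
  by apply: measurable_funTS; exact: (@measurable_snd _ _ _ (RN R N)).
have lg : lipD (cubeN R N.+1) (@cloN N.+1) (fun z => g1 z.1 * g2 z.2).
  split.
  - by apply: measurable_funM; [exact: mp1|exact: mp2].
  - by exists (B1 * B2) => z /CS[z1 z2]; rewrite normrM ler_pM ?gB1 ?gB2.
  - exists (M1 * `|B2| + `|B1| * M2); first by rewrite addr_ge0 ?mulr_ge0.
    move=> s x z s0 /CS[x1 x2] /CS[z1 z2] xz.
    rewrite (_ : _ - _ = (g1 x.1 - g1 z.1) * g2 x.2 + g1 z.1 * (g2 x.2 - g2 z.2)); last by ring.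
    rewrite (le_trans (ler_normD _ _))// [leRHS]mulrDl lerD//.
      rewrite normrM mulrAC ler_pM//; last by rewrite (le_trans (gB2 _ x2))// ler_norm.
      by apply: gM1 => //; rewrite /clo1 -!coordN0; exact: xz.
    rewrite normrM -mulrA ler_pM//; first by rewrite (le_trans (gB1 _ z1))// ler_norm.
    by apply: gM2 => // i; have := xz (lift ord0 i); rewrite !coordNS.
exists (fun z => g1 z.1 * g2 z.2) => //.
have F1 (g : R -> R)  : lebesgue_measure.-integrable I01 (EFin \o g) -> (forall t, 0 <= g t) ->
    (lebN R N.+1).-integrable (cubeN R N.+1) (EFin \o (fun z => g z.1)) /\
    \int[lebN R N.+1]_(z in cubeN R N.+1) g z.1 = \int[lebesgue_measure]_(t in I01) g t.
  move=> gi g0; have mg : measurable_fun I01 g by have /integrableP[/measurable_EFinP] := gi.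
  have E : (\int[lebN R N.+1]_(z in cubeN R N.+1) (g z.1)%:E = \int[lebesgue_measure]_(t in I01) (g t)%:E)%E.
    rewrite cubeNS [LHS](@tonelli_setX1 _ _ _ _ _ lebesgue_measure (lebN R N) _ _ mI (mC N) (fun z => (g z.1)%:E)).
    - apply: eq_integral => t _; transitivity ((g t)%:E * lebN R N (cubeN R N))%E.
        exact: (integral_cst (lebN R N) (mC N) (g t)%:E).
      by rewrite lebN_cubeN mule1.
    - by rewrite -cubeNS; apply/measurable_EFinP; apply: mp1.
    - by move=> z; rewrite lee_fin.
  split; last by rewrite /Rintegral E.
  apply/integrableP; split; first by apply/measurable_EFinP; apply: mp1.
  have /integrableP[_] := gi; under eq_integral do rewrite /= ger0_norm//.
  by rewrite -E => h; under eq_integral do rewrite /= ger0_norm//.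
have F2 (g : RN R N -> R) : (lebN R N).-integrable (cubeN R N) (EFin \o g) -> (forall t, 0 <= g t) ->
    (lebN R N.+1).-integrable (cubeN R N.+1) (EFin \o (fun z => g z.2)) /\
    \int[lebN R N.+1]_(z in cubeN R N.+1) g z.2 = \int[lebN R N]_(t in cubeN R N) g t.
  move=> gi g0; have mg : measurable_fun (cubeN R N) g by have /integrableP[/measurable_EFinP] := gi.
  have E : (\int[lebN R N.+1]_(z in cubeN R N.+1) (g z.2)%:E = \int[lebN R N]_(t in cubeN R N) (g t)%:E)%E.
    rewrite cubeNS [LHS](@tonelli_setX2 _ _ _ _ _ lebesgue_measure (lebN R N) _ _ mI (mC N) (fun z => (g z.2)%:E)).
    - apply: eq_integral => t _; transitivity ((g t)%:E * lebesgue_measure I01)%E.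
        exact: (integral_cst lebesgue_measure mI (g t)%:E).
      by rewrite lebesgue_measure_itv/= lte_fin ltr01 oppr0 adde0 mule1.
    - by rewrite -cubeNS; apply/measurable_EFinP; apply: mp2.
    - by move=> z; rewrite lee_fin.
  split; last by rewrite /Rintegral E.
  apply/integrableP; split; first by apply/measurable_EFinP; apply: mp2.
  have /integrableP[_] := gi; under eq_integral do rewrite /= ger0_norm//.
  by rewrite -E => h; under eq_integral do rewrite /= ger0_norm//.
have j1 : lebesgue_measure.-integrable I01 (EFin \o (fun t : R => `|\1_A1 t - g1 t| : R)).
  by apply: integ_dist => //; exact: integ_indic.
have [i1 E1] := F1 (fun t : R => `|\1_A1 t - g1 t|) j1 (fun=> normr_ge0 _).
have [i2 E2] := F2 (fun t => `|\1_A2 t - g2 t|) (integ_dist (mC N) iA2 ig2) (fun=> normr_ge0 _).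
have iX : (lebN R N.+1).-integrable (cubeN R N.+1) (EFin \o (\1_(A1 `*` A2) : RN R N.+1 -> R)).
  exact: (integ_indic (mC N.+1) (fC N.+1) (measurableX mA1 mA2)).
have ilg := lipD_integ (mC N.+1) (fC N.+1) lg.
rewrite (@le_trans _ _ (\int[lebN R N.+1]_(z in cubeN R N.+1)
   (`|\1_A1 z.1 - g1 z.1| + (`|B1| + 1) * `|\1_A2 z.2 - g2 z.2|)))//.
  apply: le_Rintegral => //.
  - exact: integ_dist.
  - by apply: integD => //; exact: integZ.
  - move=> z /CS[z1 z2].
    have -> : \1_(A1 `*` A2) z = \1_A1 z.1 * \1_A2 z.2 :> R.
      by rewrite !indicE in_setX; case: (_ \in _); case: (_ \in _); rewrite /= ?mulr1 ?mulr0.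
    rewrite (_ : _ - _ = (\1_A1 z.1 - g1 z.1) * \1_A2 z.2 + g1 z.1 * (\1_A2 z.2 - g2 z.2)); last by ring.
    rewrite (le_trans (ler_normD _ _))// lerD// normrM.
      by rewrite ler_piMr// indicE; case: (_ \in _); rewrite ?normr1 ?normr0.
    by rewrite ler_wpM2r// (le_trans (gB1 _ z1))// (le_trans (ler_norm _))// lerDl.
rewrite RintegralD//; last exact: integZ.
rewrite RintegralZl// E1 E2 [leRHS]splitr lerD//.
by rewrite mulrC -ler_pdivlMr.
Qed.

End torus_density.

(** * Balls of the torus and kernels supported in them *)

Section mollification.
Variable R : realType.

Lemma cdist_lip (s t : R) : `|cdist s - cdist t| <= 1 * `|s - t|.
Proof.
suff H (a b : R) : cdist a - cdist b <= `|a - b|.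
  by rewrite mul1r ler_norml H andbT lerNl opprB (le_trans (H _ _))// distrC.
rewrite lerBlDr (le_trans _ (lerD (cdist_le_norm (a - b)) (lexx _)))//.
by have := cdistD (a - b) b; rewrite subrK.
Qed.

Lemma measurable_cdist_lt (q s : R) : measurable [set t | cdist (t - q) < s].
Proof.
have cf : continuous (fun t : R => cdist (t - q)).
  apply: (@lipschitz_continuous _ _ _ _ 1) => x y.
  by rewrite (le_trans (cdist_lip _ _))// opprB addrA subrK.
have := @continuous_measurable_fun R _ cf measurableT _ (measurable_itv `]-oo, s[).
by rewrite setTI (_ : _ @^-1` _ = [set t | cdist (t - q) < s]).
Qed.

Definition arc (q s : R) : set R := `[0, 1[%classic `&` [set t | cdist (q - t) <= s].

Lemma measurable_arc (q s : R) : measurable (arc q s).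
Proof.
apply: measurableI => //.
have cf : continuous (fun t : R => cdist (q - t)).
  apply: (@lipschitz_continuous _ _ _ _ 1) => x y.
  rewrite (le_trans (cdist_lip _ _))// !mul1r.
  by rewrite (_ : q - x - (q - y) = y - x) 1?distrC//; ring.
have := @continuous_measurable_fun R (fun t : R => cdist (q - t)) cf measurableT `]-oo, s]%classic.
move=> /(_ _); rewrite setTI => h.
rewrite (_ : [set t | _] = (fun t => cdist (q - t)) @^-1` `]-oo, s]%classic); first exact: h.
by apply/seteqP; split => t /=; rewrite in_itv.
Qed.

(** For t in [0, 1[ the integer nearest to q - t differs from the floor of q by at most 1, so the
    arc is covered by three intervals of length 2 s. *)
Lemma lebesgue_arc_le (q s : R) : 0 <= s -> (lebesgue_measure (arc q s) <= (6 * s)%:E)%E.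
Proof.
move=> s0; pose n := Num.floor q.
pose I (m : int) : set R := `[q - m%:~R - s, q - m%:~R + s]%classic.
have mI m : (lebesgue_measure (I m) = (2 * s)%:E)%E.
  rewrite /I lebesgue_measure_itv/= lte_fin ltrD2l.
  case: ifPn => [_|]; first by rewrite -EFinB; congr EFin; ring.
  rewrite -leNgt => s1; have -> : s = 0 by lra.
  by rewrite mulr0.
have sub : arc q s `<=` I (n - 1) `|` (I n `|` I (n + 1)).
  move=> t [] /=; rewrite in_itv/= => /andP[t0 t1]; rewrite /cdist; set m := nint _ => ts.
  have Im : I m t by move: ts; rewrite /I/= in_itv/= ler_norml => /andP[a b]; apply/andP; split; lra.
  have /andP[n1 n2] := floor_itv q; rewrite -/n intrD in n1 n2.
  have := cdist_le_half (q - t); rewrite /cdist -/m ler_norml => /andP[m1 m2].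
  have : ((n - 2)%:~R < m%:~R :> R) && (m%:~R < (n + 2)%:~R :> R).
    by rewrite intrB intrD; apply/andP; split; rewrite -[2%:~R]/(2 : R); lra.
  rewrite !ltr_int => /andP[mn1 mn2].
  have : [|| m == n - 1, m == n | m == n + 1].
    by clear -mn1 mn2; clearbody m n; lia.
  by case/or3P => /eqP mE; rewrite mE in Im; [left|right; left|right; right].
have mII m : measurable (I m) by exact: measurable_itv.
have mU : measurable (I n `|` I (n + 1)) by exact: measurableU.
apply: (@le_trans _ _ (lebesgue_measure (I (n - 1) `|` (I n `|` I (n + 1))))).
  apply: le_measure => //; rewrite inE; first exact: measurable_arc.
  exact: (measurableU _ _ (mII _) mU).
have -> : (6 * s)%:E = ((2 * s)%:E + ((2 * s)%:E + (2 * s)%:E))%E.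
  by rewrite -!EFinD; congr EFin; ring.
apply: (le_trans (measureU2 (@lebesgue_measure R) (mII _) mU)).
have mI' m : (lebesgue_measure (I m) <= (2 * s)%:E)%E by rewrite mI.
apply: leeD; first exact: mI'.
by apply: (le_trans (measureU2 (@lebesgue_measure R) (mII _) (mII _))); apply: leeD; exact: mI'.
Qed.

Variable N : nat.
Local Notation mu := (lebN R N).
Local Notation Q := (cubeN R N).
Let mQ : measurable Q := @measurable_cubeN R N.

Definition cball (x : 'rV[R]_N) (s : R) : set (RN R N) :=
  [set z | Q z /\ forall i, cdist (x 0 i - coordN z 0 i) <= s].

Lemma cball_box x s : cball x s = boxN (fun i => arc (x 0 i) s).
Proof.
apply/seteqP; split => [z [Qz zs] i|z zB].
  by split; [rewrite /= in_itv/=; exact: Qz|exact: zs].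
by split => i; have [] := zB i; rewrite /= in_itv.
Qed.

Lemma measurable_cball x s : measurable (cball x s).
Proof. by rewrite cball_box; apply: measurable_boxN => i; exact: measurable_arc. Qed.

Lemma lebN_cball_le x s : 0 <= s -> (mu (cball x s) <= ((6 * s) ^+ N)%:E)%E.
Proof.
move=> s0; rewrite cball_box; apply: lebN_box_le => [|i|i].
- by rewrite mulr_ge0.
- exact: measurable_arc.
- exact: lebesgue_arc_le.
Qed.

Lemma tensor_neq0 (K : 'I_N -> R -> R) (y : 'rV[R]_N) : tensor K y != 0 -> forall i, K i (y 0 i) != 0.
Proof. by move=> /prodf_neq0 h i; exact: h. Qed.

Lemma tensor_le (K : 'I_N -> R -> R) (y : 'rV[R]_N) (b : 'I_N -> R) :
  (forall i, `|K i (y 0 i)| <= b i) -> `|tensor K y| <= \prod_i b i.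
Proof. by move=> Kb; rewrite normr_prod; apply: ler_prod => i _; rewrite normr_ge0 Kb. Qed.

Section supported_kernel.
Variables (F : RN R N -> R) (x : 'rV[R]_N) (s b : R).
Hypotheses (s0 : 0 <= s) (mF : measurable_fun Q F).
Hypotheses (Fb : forall z, Q z -> `|F z| <= b) (Fs : forall z, Q z -> F z != 0 -> cball x s z).

Lemma integral_supported_le (f : RN R N -> R) : mu.-integrable Q (EFin \o f) ->
  \int[mu]_(z in Q) (`|F z| * `|f z|) <= b * \int[mu]_(z in cball x s) `|f z|.
Proof.
move=> fi; have fi' := integ_norm fi.
have mB := measurable_cball x s.
have sB : cball x s `<=` Q by move=> z [].
have fB : mu.-integrable (cball x s) (EFin \o (fun z => `|f z|)).
  exact: (integrableS mQ mB sB fi').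
have b0 z : Q z -> 0 <= b by move=> /Fb; apply: le_trans.
rewrite -RintegralZl// [leRHS]Rintegral_mkcond.
have -> : \int[mu]_x0 ((fun x0 => b * `|f x0|) \_ (cball x s)) x0 =
   \int[mu]_(z in Q) ((fun x0 => b * `|f x0|) \_ (cball x s)) z.
  rewrite [RHS]Rintegral_mkcond; apply: eq_Rintegral => z _; rewrite !patchE.
  case: ifPn => [|zB]; last by case: ifP; rewrite ?(negbTE zB).
  by rewrite inE => zB; rewrite mem_set//; exact: sB.
apply: le_Rintegral => //.
- apply: (@integ_mul _ _ _ _ _ _ b) => //.
    by apply: measurableT_comp => //.
  by move=> z /Fb; rewrite normr_id.
- have := @integrableZl _ _ _ mu _ mB b _ fB.
  rewrite (integrable_mkcond _ mB) => h.
  have := integrableS measurableT mQ (@subsetT _ Q) h.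
  by apply: eq_integrable => // z _ /=; rewrite !patchE; case: ifP.
- move=> z Qz; rewrite patchE; case: ifPn => [_|zB].
    by rewrite ler_wpM2r// Fb.
  have -> : F z = 0 by apply/eqP; apply: contraNT zB => Fz; rewrite inE; exact: Fs.
  by rewrite normr0 mul0r.
Qed.

Lemma integral_kernel_le : \int[mu]_(z in Q) `|F z| <= b * (6 * s) ^+ N.
Proof.
have i1 : mu.-integrable Q (EFin \o (cst 1 : RN R N -> R)).
  apply: (@bounded_integrable _ _ _ _ _ _ 1) => //; first exact: lebN_cubeN_lty.
  by move=> z _; rewrite normr1.
have := integral_supported_le i1.
under eq_Rintegral do rewrite normr1 mulr1.
move=> /le_trans; apply.
have [Q0|/set0P[z Qz]] := eqVneq Q set0.
  have := lebN_cubeN R N; rewrite Q0 measure0 => /eqP.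
  by rewrite eqe eq_sym oner_eq0.
have b0 : 0 <= b by apply: le_trans (Fb Qz).
rewrite ler_wpM2l//; under eq_Rintegral do rewrite normr1.
rewrite Rintegral_cst ?mul1r; last exact: measurable_cball.
rewrite -lee_fin fineK ?lebN_cball_le// ge0_fin_numE//.
by rewrite (le_lt_trans (lebN_cball_le x s0))// ltry.
Qed.

End supported_kernel.

End mollification.

(** * Mass of tensor kernels *)

Section tensor_mass.
Variable R : realType.

Lemma integral_tensor1 N (K : 'I_N -> R -> R) : (forall i, pker (K i)) ->
  (forall i, (\int[lebesgue_measure]_(t in `[0%R, 1%R[) (K i t)%:E = 1)%E) ->
  (\int[lebN R N]_(z in cubeN R N) (tensor K (coordN z))%:E = 1)%E.
Proof.
elim: N K => [|N IH] K gK K1.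
  rewrite (eq_integral (cst 1%E)) => [|z _]; last by rewrite /tensor big_ord0.
  rewrite integral_cst; last exact: measurable_cubeN.
  by rewrite mul1e; exact: lebN_cubeN.
have mI : measurable (`[0, 1[%classic : set R) by [].
have mC := @measurable_cubeN R N.
have iK := continuous_integrable_cube (continuous_tensor gK).
rewrite cubeNS in iK *.
rewrite [LHS](@fubini_setX1 _ _ _ _ _ lebesgue_measure (lebN R N) _ _ mI mC _ iK).
rewrite -[RHS](K1 ord0); apply: eq_integral => t _ /=.
pose K' (j : 'I_N) := K (lift ord0 j).
have gK' j : pker (K' j) by exact: gK.
have iK' := continuous_integrable_cube (continuous_tensor gK').
transitivity (\int[lebN R N]_(w in cubeN R N) ((K ord0 t)%:E * (tensor K' (coordN w))%:E))%E.
  apply: eq_integral => w _; rewrite -EFinM; congr EFin; rewrite /tensor big_ord_recl coordN0.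
  by congr (_ * _); apply: eq_bigr => j _; rewrite coordNS.
rewrite (integralZl mC iK') (IH K' gK') ?mule1// => i; exact: K1.
Qed.

(** The kernel z |-> K(x - z), written again as a tensor kernel in z. *)
Definition krefl N (K : 'I_N -> R -> R) (x : 'rV[R]_N) (i : 'I_N) (t : R) : R := K i (-1 * t + x 0 i).

Lemma pker_krefl N (K : 'I_N -> R -> R) x : (forall i, pker (K i)) -> forall i, pker (krefl K x i).
Proof.
move=> gK i; split; first by apply: smooth1_affine; have [] := gK i.
move=> t; rewrite /krefl mulrDr mulr1 addrAC.
by have := pkerDz (-1 * t + x 0 i) (-1) (gK i); rewrite intrN.
Qed.

Lemma tensor_krefl N (K : 'I_N -> R -> R) (x y : 'rV[R]_N) : tensor (krefl K x) y = tensor K (x - y).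
Proof. by apply: eq_bigr => i _; rewrite /krefl !mxE mulN1r addrC. Qed.

Definition eta N j : 'I_N -> R -> R := fun=> @hk R j.

Lemma pker_eta N j (i : 'I_N) : pker (eta j i).
Proof. exact: pker_hk. Qed.

(** In each coordinate the integral is the increment pstep (x_i) - pstep (x_i - 1) = 1. *)
Lemma integral_eta N j (x : 'rV[R]_N) :
  \int[lebN R N]_(z in cubeN R N) tensor (eta j) (x - coordN z) = 1.
Proof.
rewrite /Rintegral; under eq_integral do rewrite -tensor_krefl.
have ge := pker_krefl x (@pker_eta N j).
rewrite (integral_tensor1 ge)//.
move=> i; rewrite /krefl /eta.
have sP : smooth1 (pstep (2 ^+ j : R)) by exact/smooth1_pstep/exp2_ge1.
have dP (t : R) : is_derive t 1 (fun t => - pstep (2 ^+ j) (-1 * t + x 0 i)) (hk j (-1 * t + x 0 i)).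
  have := is_deriveN (is_derive_affine (smooth1_is_derive (-1 * t + x 0 i) sP)).
  by rewrite (_ : - (-1 * _) = hk j (-1 * t + x 0 i))// mulN1r opprK.
have ch : continuous (fun t : R => hk j (-1 * t + x 0 i)).
  by have [sh _] := pker_krefl x (@pker_eta N j) i; exact: (smooth1_continuous sh).
rewrite (integral_derive_periodic dP ch) mulr0 mulr1 add0r -[-1 + _]addrC.
have := @pstepDz R (2 ^+ j) (exp2_ge1 _ j) (x 0 i) (-1); rewrite intrN => ->.
by congr EFin; ring.
Qed.

End tensor_mass.

(** * Convergence of mollifications in L^1 *)

Section mollifier_convergence.
Variables (R : realType) (N : nat).
Local Notation mu := (lebN R N).
Local Notation Q := (cubeN R N).
Local Notation integ f := (mu.-integrable Q (EFin \o f)).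
Let mQ : measurable Q := @measurable_cubeN R N.
Variable B : R.
Hypothesis B1 : 1 <= B.
Hypothesis dB : forall t, `|derive1 (@sstep R) t| <= B.

Lemma Rintegral_cube_cst (c : R) : \int[mu]_(_ in Q) c = c.
Proof.
rewrite Rintegral_cst// (_ : fine _ = 1) ?mulr1//.
exact: (congr1 fine (lebN_cubeN R N)).
Qed.

Lemma eta_le j y : `|tensor (@eta R N j) y| <= (B * 2 ^+ j) ^+ N.
Proof.
rewrite (le_trans (tensor_le (b := fun=> B * 2 ^+ j) _))//.
  by move=> i; exact: hk_le.
by rewrite prodr_const card_ord.
Qed.

Lemma eta_supp j x z : Q z -> tensor (@eta R N j) (x - coordN z) != 0 -> cball x (4^-1 / 2 ^+ j) z.
Proof.
move=> Qz /tensor_neq0 h; split => // i.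
by have := hk_supp (h i); rewrite !mxE.
Qed.

(** The supremum of the mollifier times the bound for the volume of its support; the powers of 2^j
    cancel. *)
Definition Ceta : R := (B * (6 / 4)) ^+ N.

Lemma scale_powE j : (B * 2 ^+ j) ^+ N * (6 * (4^-1 / 2 ^+ j)) ^+ N = Ceta.
Proof.
rewrite -exprMn /Ceta; congr (_ ^+ N).
have : 2 ^+ j != 0 :> R by rewrite expf_neq0// pnatr_eq0.
by move=> h; field.
Qed.

Let q0 j : 0 <= 4^-1 / 2 ^+ j :> R.
Proof. by rewrite divr_ge0 ?exprn_ge0. Qed.

Lemma integral_eta_le j x : \int[mu]_(z in Q) `|tensor (@eta R N j) (x - coordN z)| <= Ceta.
Proof.
rewrite -(scale_powE j); apply: (integral_kernel_le (x := x)).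
- exact: q0.
- by apply: measurable_funTS; apply: measurable_tensorB => i; exact: pker_eta.
- by move=> z _; exact: eta_le.
- by move=> z; exact: eta_supp.
Qed.

Lemma integral_eta_le_swap j (z : RN R N) : Q z ->
  \int[mu]_(x in Q) `|tensor (@eta R N j) (coordN x - coordN z)| <= Ceta.
Proof.
move=> Qz; rewrite -(scale_powE j); apply: (integral_kernel_le (x := coordN z)).
- exact: q0.
- apply: measurable_funTS.
  apply: (@continuous_measurable_coordN _ _ (fun y => tensor (eta j) (y - coordN z))) => y.
  apply: continuous_comp; last by apply: continuous_tensor => i; exact: pker_eta.
  by apply: continuousB; [|exact: cst_continuous].
- by move=> x _; exact: eta_le.
- move=> x Qx /tensor_neq0 h; split => // i.
  by have := hk_supp (h i); rewrite !mxE cdistB.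
Qed.

(** As the mollifier has mass 1, the difference is the integral of g(z) - g(x) against it, and z is
    within 2^-j / 4 of x on its support. *)
Lemma convol_eta_lip (g : RN R N -> R) (M : R) j x : integ g -> 0 <= M ->
  (forall (s : R) x z, 0 <= s -> Q x -> Q z -> cloN s x z -> `|g x - g z| <= M * s) -> Q x ->
  `|convol g (eta j) (coordN x) - g x| <= M * (4^-1 / 2 ^+ j) * Ceta.
Proof.
move=> gi M0 gM Qx; have ge := @pker_eta R N j.
have ik : integ (fun z => tensor (eta j) (coordN x - coordN z)).
  apply: (@bounded_integrable _ _ _ _ _ _ ((B * 2 ^+ j) ^+ N)) => //.
  - exact: lebN_cubeN_lty.
  - by apply: measurable_funTS; exact: measurable_tensorB.
  - by move=> z _; exact: eta_le.
have gxE : g x = \int[mu]_(z in Q) (g x * tensor (eta j) (coordN x - coordN z)).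
  by rewrite RintegralZl// integral_eta mulr1.
rewrite [X in _ - X]gxE.
rewrite -RintegralB//; [|exact: conv_integrable|exact: integZ].
under eq_Rintegral do rewrite -mulrBl.
have i1 : integ (fun z => (g z - g x) * tensor (eta j) (coordN x - coordN z)).
  have := integB mQ (conv_integrable gi (coordN x) ge) (integZ mQ (g x) ik).
  by apply: integ_eq => // z _; rewrite mulrBl.
rewrite (le_trans (le_normr_Rintegral _ i1))//.
rewrite (@le_trans _ _ (\int[mu]_(z in Q) (M * (4^-1 / 2 ^+ j) * `|tensor (eta j) (coordN x - coordN z)|)))//.
  apply: le_Rintegral => //.
  - exact: integ_norm.
  - by apply: integZ => //; exact: integ_norm.
  - move=> z Qz; rewrite normrM.
    have [->|h] := eqVneq (tensor (eta j) (coordN x - coordN z)) 0; first by rewrite normr0 !mulr0.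
    rewrite ler_wpM2r// distrC gM//.
    by have [] := eta_supp Qz h.
rewrite RintegralZl//; last exact: integ_norm.
by rewrite ler_wpM2l ?integral_eta_le// mulr_ge0.
Qed.

Lemma measurable_convol (f : RN R N -> R) K : integ f -> (forall i, pker (K i)) ->
  measurable_fun Q (fun x => convol f K (coordN x)).
Proof.
move=> fi gK; apply: measurable_funTS.
by apply: continuous_measurable_coordN; exact: continuous_conv.
Qed.

Lemma integ_convol (f : RN R N -> R) K : integ f -> (forall i, pker (K i)) ->
  integ (fun x => convol f K (coordN x)).
Proof. by move=> fi gK; apply: continuous_integrable_cube; exact: continuous_conv. Qed.

(** Young's inequality: after Tonelli the kernel is integrated in x first, where its L^1 norm is at
    most [Ceta]. *)
Lemma young_eta (f : RN R N -> R) j : integ f ->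
  \int[mu]_(x in Q) `|convol f (eta j) (coordN x)| <= Ceta * \int[mu]_(z in Q) `|f z|.
Proof.
move=> fi; have ge := @pker_eta R N j.
pose k (x z : RN R N) : R := tensor (eta j) (coordN x - coordN z).
have mf : measurable_fun Q f := integ_measurable fi.
have mk : measurable_fun setT (fun p : RN R N * RN R N => k p.1 p.2).
  rewrite /k /tensor; apply: measurable_prod => i _; under eq_fun do rewrite !mxE.
  apply: (@measurableT_comp _ _ _ _ _ _ (hk j)).
    by apply: continuous_measurable_fun; apply: smooth1_continuous; have [] := pker_hk R j.
  apply: measurable_funB.
    apply: (@measurableT_comp _ _ _ _ _ _ (fun y : RN R N => coordN y 0 i) _ fst).
      exact: measurable_coordN.
    exact: measurable_fst.
  apply: (@measurableT_comp _ _ _ _ _ _ (fun y : RN R N => coordN y 0 i) _ snd).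
      exact: measurable_coordN.
    exact: measurable_snd.
have mf2 : measurable_fun (Q `*` Q) (fun p : RN R N * RN R N => f p.2).
  apply: (@measurable_comp _ _ _ _ _ _ Q _ (Q `*` Q) snd) => //.
    by move=> _ [p [_ p2] <-].
  by apply: measurable_funTS; exact: measurable_snd.
pose G (p : RN R N * RN R N) := (`|f p.2| * `|k p.1 p.2|)%:E.
have mG : measurable_fun (Q `*` Q) G.
  apply/measurable_EFinP; apply: measurable_funM; first exact: measurableT_comp.
  by apply: measurableT_comp => //; exact: measurable_funTS.
have G0 p : (0 <= G p)%E by rewrite lee_fin mulr_ge0.
have mkx x : measurable_fun Q (fun z => k x z).
  by apply: measurable_funTS; exact: measurable_tensorB.
rewrite -lee_fin -Rintegral_EFin//; last by apply: integ_norm; exact: integ_convol.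
apply: (@le_trans _ _ (\int[mu]_(x in Q) \int[mu]_(z in Q) G (x, z))%E).
  apply: ge0_le_integral => //.
  - by apply/measurable_EFinP; apply: measurableT_comp => //; exact: measurable_convol.
  - exact: measurable_fubini_setX1.
  - move=> x Qx; have ik := conv_integrable fi (coordN x) ge.
    have ik' : integ (fun z => `|f z| * `|k x z|).
      by have := integ_norm ik; apply: integ_eq => // z _; rewrite normrM.
    rewrite (Rintegral_EFin mQ ik') lee_fin (le_trans (le_normr_Rintegral _ ik))//.
    by under eq_Rintegral do rewrite normrM.
rewrite tonelli_setX// EFinM -Rintegral_EFin//; last exact: integ_norm.
rewrite -integralZl//; last exact: integ_norm.
apply: ge0_le_integral => //.
- by move=> z _; apply: integral_ge0.
- exact: measurable_fubini_setX2.
- by apply/measurable_EFinP; apply: measurable_funM => //; apply: measurableT_comp.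
move=> z Qz.
have ik : integ (fun x => k x z).
  apply: (@bounded_integrable _ _ _ _ _ _ ((B * 2 ^+ j) ^+ N)) => //.
  - exact: lebN_cubeN_lty.
  - apply: measurable_funTS.
    apply: (@continuous_measurable_coordN _ _ (fun y => tensor (eta j) (y - coordN z))) => y.
    apply: continuous_comp; last exact: continuous_tensor.
    by apply: continuousB; [|exact: cst_continuous].
  - by move=> x _; exact: eta_le.
rewrite (Rintegral_EFin mQ (f := fun x => `|f z| * `|k x z|)); last first.
  by apply: integZ => //; exact: integ_norm.
rewrite -EFinM lee_fin RintegralZl//; last exact: integ_norm.
by rewrite [leRHS]mulrC ler_wpM2l// integral_eta_le_swap.
Qed.

(** f is replaced by a Lipschitz g, whose mollifications converge uniformly; [young_eta] controls
    the mollified error uniformly in j. *)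
Lemma mollify_cvg (f : RN R N -> R) : integ f ->
  \int[mu]_(x in Q) `|convol f (eta j) (coordN x) - f x| @[j --> \oo] --> 0.
Proof.
move=> fi; have C0 : 0 <= Ceta by rewrite exprn_ge0// mulr_ge0 ?divr_ge0// (le_trans _ B1).
have C1 : 0 < Ceta + 1 by rewrite ltr_wpDl.
apply/cvgrPdist_le => e e0.
(* The division absorbs the factor [Ceta] of [young_eta]. *)
have e3 : 0 < e / 3 / (Ceta + 1) by rewrite !divr_gt0.
have [g lg fg] := apxD_torus fi e3.
have gi := lipD_integ mQ (lebN_cubeN_lty R N) lg.
have [mg _ [M M0 gM]] := lg.
have MC : 0 < M * Ceta / 4 + 1 by rewrite ltr_wpDl// divr_ge0// mulr_ge0.
near=> j; rewrite sub0r normrN ger0_norm; last first.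
  by apply: Rintegral_ge0 => x _.
have ge := @pker_eta R N j.
have ifg : integ (fun x => f x - g x) by exact: integB.
have cB x : convol f (eta j) x - convol g (eta j) x = convol (fun z => f z - g z) (eta j) x.
  rewrite /convol -RintegralB//; [|exact: conv_integrable..].
  by under eq_Rintegral do rewrite -mulrBl.
have ic := integ_convol fi ge; have icg := integ_convol gi ge.
have T1 := dist_triangle mQ ic icg fi.
have T2 := dist_triangle mQ icg gi fi.
have D1 : \int[mu]_(x in Q) `|convol f (eta j) (coordN x) - convol g (eta j) (coordN x)| <= e / 3.
  under eq_Rintegral do rewrite cB.
  rewrite (le_trans (young_eta j ifg))// (le_trans (ler_wpM2l C0 fg))//.
  by rewrite mulrC mulrAC ler_pdivrMr// ler_wpM2l ?divr_ge0 ?(ltW e0)// lerDl.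
have D3 : \int[mu]_(x in Q) `|g x - f x| <= e / 3.
  under eq_Rintegral do rewrite distrC.
  by rewrite (le_trans fg)// ler_pdivrMr// ler_peMr ?divr_ge0 ?(ltW e0)// lerDr.
have D2 : \int[mu]_(x in Q) `|convol g (eta j) (coordN x) - g x| <= e / 3.
  rewrite (@le_trans _ _ (\int[mu]_(x in Q) (M * (4^-1 / 2 ^+ j) * Ceta)))//.
    apply: le_Rintegral => //.
    - exact: integ_dist.
    - apply: (@bounded_integrable _ _ _ _ _ _ `|M * (4^-1 / 2 ^+ j) * Ceta|) => //.
      exact: lebN_cubeN_lty.
    - by move=> x Qx; exact: convol_eta_lip.
  rewrite Rintegral_cube_cst.
  rewrite (_ : M * _ * Ceta = (M * Ceta / 4) * (2 ^+ j)^-1); last by ring.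
  rewrite (@le_trans _ _ ((M * Ceta / 4 + 1) * (2 ^+ j)^-1))//.
    by rewrite ler_wpM2r ?invr_ge0 ?exprn_ge0// lerDl.
  rewrite mulrC -ler_pdivlMr// -exprVn; near: j.
  by apply: near_half_pow_le; rewrite divr_gt0// divr_gt0.
by lra.
Unshelve. all: by end_near. Qed.

End mollifier_convergence.

(** * Dyadic cubes, bad cubes and stopping sets *)

Section dyadic.
Variables (R : realType) (N : nat).
Local Notation mu := (lebN R N).
Local Notation Q := (cubeN R N).
Let mQ : measurable Q := @measurable_cubeN R N.
Implicit Types (j n : nat) (k : 'I_N -> nat).

Definition ditv j (m : nat) : set R := [set t | m%:R <= 2 ^+ j * t < m.+1%:R].

(** The index takes values in [nat] so that parents and children are plain arithmetic; the cube lies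
    in the unit cube when all [k i < 2 ^ j]. *)
Definition dcube j k : set (RN R N) := boxN (fun i => ditv j (k i)).

Let p2 j : 0 < 2 ^+ j :> R. Proof. by rewrite exprn_gt0. Qed.

Lemma ditvE j m : ditv j m = `[m%:R / 2 ^+ j, m.+1%:R / 2 ^+ j[%classic.
Proof.
apply/seteqP; split => t /=; rewrite in_itv/= ler_pdivrMr// ltr_pdivlMr// [t * _]mulrC//.
Qed.

Lemma measurable_ditv j m : measurable (ditv j m).
Proof. by rewrite ditvE. Qed.

Lemma lebesgue_ditv j m : (lebesgue_measure (ditv j m) = (2 ^- j)%:E)%E.
Proof.
rewrite ditvE lebesgue_measure_itv/= lte_fin ltr_pM2r ?invr_gt0// ltr_nat ltnSn.
by rewrite -EFinB -mulrBl -natrB// subSnn mul1r.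
Qed.

Lemma measurable_dcube j k : measurable (dcube j k).
Proof. by apply: measurable_boxN => i; exact: measurable_ditv. Qed.

Lemma lebN_dcube j k : (mu (dcube j k) = (2 ^- j ^+ N)%:E)%E.
Proof.
by apply: lebN_box => i; [exact: measurable_ditv|exact: lebesgue_ditv].
Qed.

Lemma nat_itv_uniq (y : R) (a b : nat) : a%:R <= y < a.+1%:R -> b%:R <= y < b.+1%:R -> a = b.
Proof.
move=> /andP[a1 a2] /andP[b1 b2].
have : (a%:R < b.+1%:R :> R) && (b%:R < a.+1%:R :> R).
  by rewrite (le_lt_trans a1 b2) (le_lt_trans b1 a2).
by rewrite !ltr_nat => /andP[]; lia.
Qed.

Lemma dcube_uniq j k k' z : dcube j k z -> dcube j k' z -> k = k'.
Proof. by move=> kz k'z; apply/funext => i; apply: nat_itv_uniq (kz i) (k'z i). Qed.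

Lemma dcube_sub j k : (forall i, (k i < 2 ^ j)%N) -> dcube j k `<=` Q.
Proof.
move=> kj z kz i; have /andP[k1 k2] := kz i; apply/andP; split.
  by rewrite -(pmulr_rge0 _ (p2 j)) (le_trans _ k1).
rewrite -(ltr_pM2l (p2 j)) mulr1 (lt_le_trans k2)//.
by rewrite -natrX ler_nat.
Qed.

Definition kn j (k : {ffun 'I_N -> 'I_(2 ^ j)}) : 'I_N -> nat := fun i => k i.

Lemma trivIset_dcube j (X : set {ffun 'I_N -> 'I_(2 ^ j)}) : trivIset X (fun a => dcube j (kn a)).
Proof.
move=> a b _ _ [z [az bz]]; apply/ffunP => i; apply: val_inj.
exact: (congr1 (fun h => h i) (dcube_uniq az bz)).
Qed.

Lemma lebN_dcubes j (s : seq {ffun 'I_N -> 'I_(2 ^ j)}) : uniq s ->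
  (\sum_(a <- s) mu (dcube j (kn a)) = mu (\big[setU/set0]_(a <- s) dcube j (kn a)))%E.
Proof.
move=> us; rewrite -[RHS]mul1e -integral_cst ?ge0_integral_bigsetU//.
- by apply: eq_bigr => a _; rewrite integral_cst ?mul1e//; exact: measurable_dcube.
- by move=> a; exact: measurable_dcube.
- exact: trivIset_dcube.
- by apply: bigsetU_measurable => a _; exact: measurable_dcube.
Qed.

Lemma dcube_exists j z : Q z -> exists k : {ffun 'I_N -> 'I_(2 ^ j)}, dcube j (kn k) z.
Proof.
move=> Qz; have b i : (absz (Num.floor (2 ^+ j * coordN z 0%R i))%R < 2 ^ j)%N.
  have /andP[z0 z1] := Qz i.
  have f0 : 0 <= Num.floor (2 ^+ j * coordN z 0 i) by rewrite floor_ge0 mulr_ge0// ltW.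
  have /andP[f1 f2] := floor_itv (2 ^+ j * coordN z 0 i).
  have : (Num.floor (2 ^+ j * coordN z 0 i))%:~R < (2 ^ j)%N%:R :> R.
    by rewrite (le_lt_trans f1)// natrX -[ltRHS]mulr1 ltr_pM2l.
  rewrite -{1}(gez0_abs f0) -pmulrn ltr_nat; exact.
exists [ffun i => Ordinal (b i)] => i; rewrite /kn ffunE /ditv/=.
have /andP[z0 z1] := Qz i.
have f0 : 0 <= Num.floor (2 ^+ j * coordN z 0 i) by rewrite floor_ge0 mulr_ge0// ltW.
have /andP[f1 f2] := floor_itv (2 ^+ j * coordN z 0 i).
have nE : (absz (Num.floor (2 ^+ j * coordN z 0 i)))%:R = (Num.floor (2 ^+ j * coordN z 0 i))%:~R :> R.
  by rewrite pmulrn gez0_abs.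
by rewrite -(natr1 (absz _)) nE f1/=; move: f2; rewrite intrD.
Qed.

Lemma dcube0 : dcube 0 (fun=> 0%N) = Q.
Proof.
apply/seteqP; split; first exact: dcube_sub.
by move=> z Qz i; rewrite /ditv/= expr0 mul1r; exact: Qz.
Qed.

Definition child k (e : {ffun 'I_N -> bool}) : 'I_N -> nat := fun i => ((k i).*2 + e i)%N.

Lemma dcube_children j k : dcube j k =
  \big[setU/set0]_(e <- index_enum {ffun 'I_N -> bool}) dcube j.+1 (child k e).
Proof.
apply/seteqP; split => z.
  move=> kz; pose e := [ffun i => ((k i).*2.+1%:R <= 2 ^+ j.+1 * coordN z 0 i)].
  have ez : dcube j.+1 (child k e) z.
    move=> i; rewrite /child ffunE /ditv/=; have := kz i; rewrite /ditv/= => /andP[k1 k2].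
    have d1 : (k i).*2%:R <= 2 ^+ j.+1 * coordN z 0 i.
      by rewrite exprS -mulrA -muln2 mulnC natrM ler_wpM2l.
    have d2 : 2 ^+ j.+1 * coordN z 0 i < (k i).*2.+2%:R.
      by rewrite exprS -mulrA -doubleS -muln2 mulnC natrM ltr_pM2l.
    by case: (leP (k i).*2.+1%:R _) => h; rewrite /= ?addn1 ?addn0 ?h ?d1 ?d2.
  by rewrite (bigD1_seq e) ?index_enum_uniq ?mem_index_enum//=; left.
elim/big_ind : _ => // [A B IA IB []//|e _] ez i; rewrite /ditv/=.
have := ez i; rewrite /ditv/= /child => /andP[e1 e2].
have h0 : 0 < 2 :> R by [].
apply/andP; split.
  rewrite -(ler_pM2l h0) mulrA -exprS (le_trans _ e1)// -natrM ler_nat mul2n leq_addr//.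
rewrite -(ltr_pM2l h0) mulrA -exprS (lt_le_trans e2)// -natrM ler_nat mul2n doubleS.
by case: (e i); rewrite ?addn1 ?addn0.
Qed.

Lemma child_inj k : injective (child k).
Proof.
move=> e e' ee'; apply/ffunP => i; have := congr1 (fun h => h i) ee'; rewrite /child.
by case: (e i); case: (e' i) => //; lia.
Qed.

Variables (f : RN R N -> R) (L : R).
Hypotheses (L0 : 0 < L) (f0 : forall z, 0 <= f z) (mf : measurable_fun Q f).
Hypothesis fi : (\int[mu]_(z in Q) (f z)%:E < +oo)%E.

Definition dmass j k : \bar R := (\int[mu]_(z in dcube j k) (f z)%:E)%E.

Definition bad j k : bool := ((L * 2 ^- j ^+ N)%:E < dmass j k)%E.

Lemma dmass_ge0 j k : (0 <= dmass j k)%E.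
Proof. by apply: integral_ge0 => z _; rewrite lee_fin. Qed.

Lemma child_lt j k e : (forall i, (k i < 2 ^ j)%N) -> forall i, (child k e i < 2 ^ j.+1)%N.
Proof. by move=> kj i; have := kj i; rewrite /child expnS; case: (e i) => /=; lia. Qed.

Lemma dmass_children j k : (forall i, (k i < 2 ^ j)%N) ->
  (dmass j k = \sum_(e <- index_enum {ffun 'I_N -> bool}) dmass j.+1 (child k e))%E.
Proof.
move=> kj; rewrite /dmass {1}dcube_children ge0_integral_bigsetU//.
- by move=> e; exact: measurable_dcube.
- exact: index_enum_uniq.
- move=> e e' _ _ [z [ez e'z]]; apply: (@child_inj k); exact: dcube_uniq ez e'z.
- rewrite -dcube_children; apply/measurable_EFinP; apply: measurable_funS mf => //.
  exact: dcube_sub.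
- by move=> z _; rewrite lee_fin.
Qed.

Definition dpt j k : 'rV[R]_N := \row_i ((k i)%:R / 2 ^+ j).

(** 10 = 8 + 2: the 8 is spent on the growth of the stopping sets, and the remaining 2 / 2^j still
    reaches every point whose ball of radius 2^-j / 4 meets the cube. *)
Definition enl j k : set (RN R N) :=
  [set z | Q z /\ forall i, cdist (coordN z 0 i - dpt j k 0 i) < 10 / 2 ^+ j].

Lemma measurable_enl j k : measurable (enl j k).
Proof.
rewrite (_ : enl j k = boxN (fun i => `[0, 1[%classic `&` [set t | cdist (t - dpt j k 0 i) < 10 / 2 ^+ j])).
  apply: measurable_boxN => i; apply: measurableI => //.
  exact: measurable_cdist_lt.
apply/seteqP; split => [z [Qz zk] i|z zk].
  by split; [rewrite /= in_itv/=; exact: Qz|exact: zk].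
by split => i; have [] := zk i; rewrite /= in_itv.
Qed.

Lemma lebN_enl_le j k : (mu (enl j k) <= (60 ^+ N * 2 ^- j ^+ N)%:E)%E.
Proof.
apply: (@le_trans _ _ (mu (cball (dpt j k) (10 / 2 ^+ j)))).
  apply: le_measure; rewrite ?inE; [exact: measurable_enl|exact: measurable_cball|].
  by move=> z [Qz zk]; split => // i; rewrite cdistB ltW.
apply: (le_trans (lebN_cball_le _ _)); first by rewrite divr_ge0// ltW.
(* 60 is the factor 6 of [lebN_cball_le] times the radius 10. *)
by rewrite lee_fin -exprMn mulrA (_ : 6 * 10 = 60 :> R)//; ring.
Qed.

(** The corner of a cube is within 2^-j / 2 of that of its parent in each coordinate, and 5 + 1/2 <=
    10. *)
Lemma enl_parent j k : enl j.+1 k `<=` enl j (fun i => (k i)./2).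
Proof.
move=> z [Qz zk]; split => // i; have := zk i.
have := cdist_tri (dpt j.+1 k 0 i) (coordN z 0 i) (dpt j (fun i => (k i)./2) 0 i).
have := cdist_le_norm (dpt j.+1 k 0 i - dpt j (fun i => (k i)./2) 0 i).
rewrite !mxE; have -> : (k i)%:R / 2 ^+ j.+1 - (k i)./2%:R / 2 ^+ j = (odd (k i))%:R / 2 / 2 ^+ j :> R.
  rewrite -{1}(odd_double_half (k i)) natrD -muln2 natrM exprS invfM.
  have := p2 j => h; field.
  by rewrite gt_eqF.
have -> : 10 / 2 ^+ j.+1 = 5 / 2 ^+ j :> R.
  by rewrite exprS invfM mulrA; congr (_ / _); field.
have q := p2 j; set p := (2 ^+ j)^-1; have q' : 0 < p by rewrite invr_gt0.
rewrite (@ger0_norm _ (_ * p)); last by rewrite !mulr_ge0 ?invr_ge0// ltW.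
have : (odd (k i))%:R / 2 * p <= p / 2.
  by case: (odd (k i)); rewrite /= ?mul0r ?mul1r ?[p / 2]mulrC//; lra.
by move=> *; lra.
Qed.

Lemma enl_anc d j k : enl (j + d) k `<=` enl j (fun i => (k i %/ 2 ^ d)%N).
Proof.
elim: d k => [|d IH] k z; first by rewrite addn0 (_ : (fun i => _) = k)//; apply/funext => i; rewrite divn1.
rewrite addnS => /enl_parent/IH; rewrite (_ : (fun i => _) = (fun i => (k i %/ 2 ^ d.+1)%N))//.
by apply/funext => i; rewrite -divn2 -divnMA expnS.
Qed.

(** The enlargements of the maximal bad cubes among the descendants of a cube down to depth n: the
    recursion ends at the first bad cube on each branch. *)
Fixpoint tree n j k : set (RN R N) :=
  if bad j k then enl j k else
  if n is m.+1 then \big[setU/set0]_(e <- index_enum {ffun 'I_N -> bool}) tree m j.+1 (child k e)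
  else set0.

Lemma measurable_tree n j k : measurable (tree n j k).
Proof.
elim: n j k => [|n IH] j k /=; case: ifP => // _; try exact: measurable_enl.
by apply: bigsetU_measurable => e _; exact: IH.
Qed.

Lemma measure_bigsetU_le (I : Type) (s : seq I) (A : I -> set (RN R N)) :
  (forall i, measurable (A i)) ->
  (mu (\big[setU/set0]_(i <- s) A i) <= \sum_(i <- s) mu (A i))%E.
Proof.
move=> mA; elim: s => [|i s IH]; first by rewrite !big_nil measure0.
rewrite !big_cons; apply: (le_trans (measureU2 _ _ _)) => //; last exact: leeD.
by apply: bigsetU_measurable => k _.
Qed.

(** The volume of a bad cube is at most 1/L times its mass of f, and its enlargement costs 60^N. The
    maximal bad cubes are disjoint, so their masses add up along the recursion. *)
Lemma lebN_tree_le n j k : (forall i, (k i < 2 ^ j)%N) ->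
  (mu (tree n j k) <= (60 ^+ N / L)%:E * dmass j k)%E.
Proof.
have C0 : 0 <= 60 ^+ N / L by rewrite divr_ge0 ?exprn_ge0// ltW.
have H j' k' : bad j' k' -> (mu (enl j' k') <= (60 ^+ N / L)%:E * dmass j' k')%E.
  move=> b; apply: (le_trans (lebN_enl_le j' k')).
  apply: (@le_trans _ _ ((60 ^+ N / L)%:E * (L * 2 ^- j' ^+ N)%:E)%E).
    by rewrite -EFinM lee_fin mulrA divfK ?gt_eqF.
  by rewrite lee_wpmul2l ?lee_fin// ltW.
elim: n j k => [|n IH] j k kj /=; case: ifPn => b; try exact: H.
  by rewrite measure0 mule_ge0 ?lee_fin ?dmass_ge0.
apply: (@le_trans _ _ (\sum_(e <- index_enum {ffun 'I_N -> bool}) mu (tree n j.+1 (child k e)))%E).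
  by apply: measure_bigsetU_le => e; exact: measurable_tree.
rewrite dmass_children// ge0_sume_distrr; last by move=> e _; exact: dmass_ge0.
by apply: lee_sum => e _; apply: IH; exact: child_lt.
Qed.

Lemma tree_nd n j k : tree n j k `<=` tree n.+1 j k.
Proof.
elim: n j k => [|n IH] j k z; first by rewrite /=; case: ifP.
rewrite [tree n.+1 j k]/= [tree n.+2 j k]/=; case: ifP => // _.
elim/big_ind2 : _ => //.
  by move=> A A' B B' AA' BB' [/AA'|/BB']; [left|right].
by move=> e _; exact: IH.
Qed.

(** The bad cube may fail to be maximal, but its enlargement lies in that of each ancestor, in
    particular of the bad one where the recursion ends. *)
Lemma tree_cover d j k : bad (j + d) k -> enl (j + d) k `<=` tree d j (fun i => (k i %/ 2 ^ d)%N).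
Proof.
elim: d j => [|d IH] j b z ez.
  move: b ez; rewrite addn0 (_ : (fun i => (k i %/ 2 ^ 0)%N) = k).
    by rewrite /= => ->.
  by apply/funext => i; rewrite divn1.
rewrite /=; case: ifP => _; first exact: enl_anc ez.
pose e := [ffun i => odd (k i %/ 2 ^ d)].
rewrite addnS -addSn in b ez.
have := IH j.+1 b z ez; rewrite (_ : (fun i => (k i %/ 2 ^ d)%N) = child (fun i => (k i %/ 2 ^ d.+1)%N) e).
  by move=> tz; rewrite (bigD1_seq e) ?index_enum_uniq ?mem_index_enum//=; left.
apply/funext => i; rewrite /child ffunE expnSr divnMA divn2 addnC.
by rewrite odd_double_half.
Qed.

Definition badset : set (RN R N) :=
  \bigcup_n tree n 0 (fun=> 0%N).

Lemma measurable_badset : measurable badset.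
Proof. by apply: bigcupT_measurable => n; exact: measurable_tree. Qed.

Lemma lebN_badset_le : (mu badset <= (60 ^+ N / L)%:E * \int[mu]_(z in Q) (f z)%:E)%E.
Proof.
have nd : nondecreasing_seq (fun n => tree n 0 (fun=> 0%N)).
  by apply/nondecreasing_seqP => n; apply/subsetPset; exact: tree_nd.
have cv := @nondecreasing_cvg_mu _ _ _ mu _ (fun n => measurable_tree n 0 (fun=> 0%N)) measurable_badset nd.
have <- := cvg_lim (@ereal_hausdorff R) cv; apply: lime_le.
  apply: ereal_nondecreasing_is_cvgn; apply/nondecreasing_seqP => n.
  by apply: le_measure; rewrite ?inE; [exact: measurable_tree..|exact: tree_nd].
apply: nearW => n; rewrite (le_trans (lebN_tree_le _ _))// /dmass dcube0//.
Qed.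

Lemma bad_enl_badset j k z : (forall i, (k i < 2 ^ j)%N) -> bad j k -> enl j k z -> badset z.
Proof.
move=> kj b ez; exists j => //; have := @tree_cover j 0 k b z ez.
by rewrite (_ : (fun i => _) = (fun=> 0%N))//; apply/funext => i; rewrite divn_small.
Qed.

(* The 8 / 2 ^+ j makes these sets grow with j: a point within 4 / 2 ^+ j of the
   j-th one lies in the next one, and all of them stay in the enlarged bad cubes. *)
Definition stop j (x : 'rV[R]_N) : Prop := exists i k, [/\ forall l, (k l < 2 ^ i)%N, bad i k &
  forall l, cdist (x 0 l - dpt i k 0 l) < 10 / 2 ^+ i - 8 / 2 ^+ j].

Lemma stop_badset j z : Q z -> stop j (coordN z) -> badset z.
Proof.
move=> Qz [i [k [ki b zk]]]; apply: (bad_enl_badset ki b); split => // l.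
by rewrite (lt_le_trans (zk l))// gerBl divr_ge0// ltW.
Qed.

Lemma stop_near j (x y : 'rV[R]_N) : stop j x -> (forall l, cdist (x 0 l - y 0 l) <= 4 / 2 ^+ j) -> stop j.+1 y.
Proof.
move=> [i [k [ki b xk]]] xy; exists i, k; split => // l.
rewrite (le_lt_trans (cdist_tri (x 0 l) _ _))//.
have := xk l; have := xy l; rewrite [in X in X -> _]cdistB.
have -> : 8 / 2 ^+ j = 4 / 2 ^+ j + 4 / 2 ^+ j :> R by rewrite -mulrDl; congr (_ / _); ring.
have -> : 8 / 2 ^+ j.+1 = 4 / 2 ^+ j :> R by rewrite exprS invfM mulrA; congr (_ / _); field.
by move=> *; lra.
Qed.

Lemma stop_mono j x : stop j x -> stop j.+1 x.
Proof. by move=> sx; apply: stop_near sx _ => l; rewrite subrr (le_trans (cdist_le_norm _))// normr0 divr_ge0// ltW. Qed.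

Lemma stop_periodic j x l : stop j (x + evec R l) <-> stop j x.
Proof.
suff H (m : int) y : stop j y -> stop j (y + m%:~R *: evec R l).
  split; last by move/(H 1); rewrite scale1r.
  by move/(H (-1)); rewrite intrN scaleN1r addrK.
move=> [i [k [ki b yk]]]; exists i, k; split => // l'.
rewrite !mxE eqxx/=; case: eqP => _; rewrite ?mulr1 ?mulr0 ?addr0; last by have := yk l'; rewrite mxE.
by rewrite addrAC cdistDz; have := yk l'; rewrite mxE.
Qed.

Lemma measurable_stop j : measurable [set z : RN R N | Q z /\ stop j (coordN z)].
Proof.
pose A (i : nat) (k : {ffun 'I_N -> 'I_(2 ^ i)}) : set (RN R N) :=
  if bad i (kn k) then boxN (fun l => `[0, 1[%classic `&`
    [set t : R | cdist (t - dpt i (kn k) 0 l) < 10 / 2 ^+ i - 8 / 2 ^+ j]) else set0.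
rewrite (_ : [set z | _] = \bigcup_i \big[setU/set0]_(k <- index_enum {ffun 'I_N -> 'I_(2 ^ i)}) A i k).
  apply: bigcupT_measurable => i; apply: bigsetU_measurable => k _.
  rewrite /A; case: ifP => // _; apply: measurable_boxN => l; apply: measurableI => //.
  exact: measurable_cdist_lt.
apply/seteqP; split => [z [Qz [i [k [ki b zk]]]]|z [i _]].
  exists i => //; pose k' := [ffun l => Ordinal (ki l)].
  have kk' : kn k' = k by apply/funext => l; rewrite /kn ffunE.
  rewrite (bigD1_seq k') ?index_enum_uniq ?mem_index_enum//=; left.
  rewrite /A kk' b => l; split; first by rewrite /= in_itv/=; exact: Qz.
  exact: zk.
elim/big_ind : _ => // [S S' IS IS' []//|k _].
rewrite /A; case: ifPn => // b zA; split; first by move=> l; have [] := zA l; rewrite /= in_itv.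
by exists i, (kn k); split => // l; [exact: ltn_ord|have [] := zA l].
Qed.

Lemma dcube_dist j k z l : dcube j k z -> `|coordN z 0 l - dpt j k 0 l| <= (2 ^+ j)^-1.
Proof.
move=> /(_ l); rewrite ditvE /= in_itv/= mxE => /andP[z1 z2].
rewrite ger0_norm ?subr_ge0// lerBlDl (le_trans (ltW z2))//.
by rewrite -(natr1 (k l)) mulrDl mul1r.
Qed.

(** A bad cube of scale j meeting the ball would have its corner within (1/4 + 1) / 2^j of x, below
    the margin (10 - 8) / 2^j of [stop j]. *)
Lemma cball_dcube_good j k x z : (forall l, (k l < 2 ^ j)%N) -> ~ stop j x ->
  dcube j k z -> cball x (4^-1 / 2 ^+ j) z -> ~~ bad j k.
Proof.
move=> kj sx kz [_ xz]; apply/negP => b; apply: sx; exists j, k; split => // l.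
rewrite (le_lt_trans (cdist_tri (coordN z 0 l) _ _))//.
have q : 0 < (2 ^+ j)^-1 :> R by rewrite invr_gt0.
have := xz l; have := le_trans (cdist_le_norm _) (dcube_dist l kz).
by move=> *; lra.
Qed.

(** The ball is covered by dyadic cubes of its own scale, all good, each carrying at most L times
    its volume. They are disjoint and lie in the ball of radius (1/4 + 1 + 1) / 2^j, of volume at
    most (13.5 / 2^j)^N; 14 rounds this up. *)
Lemma cball_mass j x : ~ stop j x ->
  (\int[mu]_(z in cball x (4^-1 / 2 ^+ j)) (f z)%:E <= (L * (14 / 2 ^+ j) ^+ N)%:E)%E.
Proof.
move=> sx; set s := 4^-1 / 2 ^+ j.
have q : 0 < (2 ^+ j)^-1 :> R by rewrite invr_gt0.
pose P (k : {ffun 'I_N -> 'I_(2 ^ j)}) := `[< exists z, dcube j (kn k) z /\ cball x s z >].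
pose S := [seq k <- index_enum {ffun 'I_N -> 'I_(2 ^ j)} | P k].
pose D := \big[setU/set0]_(k <- S) dcube j (kn k).
have mD : measurable D by apply: bigsetU_measurable => k _; exact: measurable_dcube.
have DP z : D z -> exists2 k, P k & dcube j (kn k) z.
  rewrite /D /S big_filter; elim/big_ind : _ => // [A A' IA IA' []//|k Pk kz].
  by exists k.
have sD : cball x s `<=` D.
  move=> z xz; have [Qz _] := xz; have [k kz] := dcube_exists j Qz.
  rewrite /D (bigD1_seq k)/=; first by left.
    by rewrite mem_filter mem_index_enum andbT; apply/asboolP; exists z.
  by rewrite filter_uniq// index_enum_uniq.
have DQ : D `<=` Q.
  by move=> z /DP[k _]; apply: dcube_sub => i; exact: ltn_ord.
have sD' : D `<=` cball x (s + (2 ^+ j)^-1 + (2 ^+ j)^-1).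
  move=> z' Dz'; split; first exact: DQ.
  move=> l; have [k /asboolP[z [kz [_ xz]]] kz'] := DP _ Dz'.
  rewrite (le_trans (cdist_tri (coordN z 0 l) _ _))// -addrA lerD//.
  rewrite (le_trans (cdist_tri (dpt j (kn k) 0 l) _ _))// lerD//.
    exact: le_trans (cdist_le_norm _) (dcube_dist l kz).
  by rewrite cdistB; exact: le_trans (cdist_le_norm _) (dcube_dist l kz').
have uS : uniq S by rewrite filter_uniq// index_enum_uniq.
apply: (@le_trans _ _ (\int[mu]_(z in D) (f z)%:E)%E).
  apply: ge0_subset_integral => //.
  - exact: measurable_cball.
  - by apply/measurable_EFinP; apply: measurable_funS mf.
  - by move=> z _; rewrite lee_fin.
rewrite ge0_integral_bigsetU//; last 4 first.
- by move=> k; exact: measurable_dcube.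
- exact: trivIset_dcube.
- by apply/measurable_EFinP; apply: measurable_funS mf.
- by move=> z _; rewrite lee_fin.
apply: (@le_trans _ _ (\sum_(k <- S) (L%:E * mu (dcube j (kn k))))%E).
  rewrite big_seq [leRHS]big_seq; apply: lee_sum => k.
  rewrite mem_filter => /andP[/asboolP[z [kz xz]] _].
  rewrite lebN_dcube -EFinM leNgt; apply: cball_dcube_good kz xz => // i.
  exact: ltn_ord.
rewrite -ge0_sume_distrr// EFinM lee_wpmul2l ?lee_fin ?(ltW L0)//.
rewrite lebN_dcubes//.
apply: (@le_trans _ _ (mu (cball x (s + (2 ^+ j)^-1 + (2 ^+ j)^-1)))).
  by apply: le_measure; rewrite ?inE//; exact: measurable_cball.
apply: (le_trans (lebN_cball_le _ _)); first by rewrite !addr_ge0 ?divr_ge0 ?(ltW q)// ltW.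
rewrite lee_fin; apply: lerXn2r; rewrite ?nnegrE ?mulr_ge0 ?addr_ge0 ?divr_ge0 ?(ltW q)// ?ltW//.
rewrite /s; lra.
Qed.

End dyadic.

(** * The potentials between consecutive scales *)

Section homotopy_forms.
Variables (R : realType) (N : nat).
Implicit Types (I J : {set 'I_N}) (k l : 'I_N) (x : 'rV[R]_N) (j n : nat).
Local Notation mu := (lebN R N).
Local Notation Q := (cubeN R N).
Local Notation integ f := (mu.-integrable Q (EFin \o f)).
Local Notation sg k J := (wsign R [set k] J).
Let mQ : measurable Q := @measurable_cubeN R N.

Variable U : {set 'I_N} -> RN R N -> R.
Hypothesis iU : forall J, integ (U J).

Definition kappa j k : 'I_N -> R -> R :=
  fun i => if (i < k)%N then @hk R j.+1 else if i == k then @ck R j else @hk R j.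

Lemma pker_kappa j k i : pker (kappa j k i).
Proof.
by rewrite /kappa; case: ifP => _; [|case: ifP => _]; [exact: pker_hk|exact: pker_ck|exact: pker_hk].
Qed.

Definition moll j J x : R := convol (U J) (@eta R N j) x.

(* A primitive of [moll j - moll j.+1]: the coordinates are switched one at a
   time from scale j to scale j.+1, and [ck j] is a primitive of the change. *)
Definition omega j I x : R :=
  \sum_(k | k \notin I) sg k I * convol (U (k |: I)) (kappa j k) x.

Definition domega j l I x : R :=
  \sum_(k | k \notin I) sg k I * convol (U (k |: I)) (kder (kappa j k) l) x.

Definition ddomega j l l' I x : R :=
  \sum_(k | k \notin I) sg k I * convol (U (k |: I)) (kder (kder (kappa j k) l) l') x.

Lemma C2per_omega j I : C2per (omega j I) (fun l => domega j l I) (fun l l' => ddomega j l l' I).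
Proof.
apply: (@C2per_sum _ _ _ _ _ (fun k x => sg k I * convol (U (k |: I)) (kappa j k) x)
  (fun k l x => sg k I * convol (U (k |: I)) (kder (kappa j k) l) x)
  (fun k l l' x => sg k I * convol (U (k |: I)) (kder (kder (kappa j k) l) l') x)) => k _.
apply: (@C2perZ _ _ _ (convol (U (k |: I)) (kappa j k)) (fun l => convol (U (k |: I)) (kder (kappa j k) l))
  (fun l l' => convol (U (k |: I)) (kder (kder (kappa j k) l) l'))).
by apply: C2per_convol => // i; exact: pker_kappa.
Qed.

(** The mollifier whose first m coordinates are already at scale j + 1; it leads from [eta j] to
    [eta j.+1] in N steps. *)
Let mix j (m : nat) : 'I_N -> R -> R := fun i => if (i < m)%N then @hk R j.+1 else @hk R j.

Let pker_mix j m i : pker (mix j m i).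
Proof. by rewrite /mix; case: ifP => _; exact: pker_hk. Qed.

Let tensor_kder_kappa j k x : tensor (kder (kappa j k) k) x = tensor (mix j k) x - tensor (mix j k.+1) x.
Proof.
rewrite /kder tensor_kupd /kappa ltnn eqxx derive_ck.
rewrite /tensor [in RHS](bigD1 k)//= [X in _ = _ - X](bigD1 k)//= /mix ltnn ltnSn mulrBl.
congr (_ * _ - _ * _); apply: eq_bigr => i ik; rewrite (negbTE ik)//.
by rewrite (_ : (i < k.+1)%N = (i < k)%N)// ltnS leq_eqVlt (negbTE (ik : (i != k :> nat)%N)).
Qed.

Hypothesis clU : wclosed U.

(** Cartan's formula leaves the terms where the derivative in direction k falls on the factor [ck j]
    of [kappa j k]. Such a term is the passage from [mix j k] to [mix j k.+1], and the sum over k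
    telescopes. *)
Lemma domega_sum j J x :
  \sum_(l in J) sg l J * domega j l (J :\ l) x = moll j J x - moll j.+1 J x.
Proof.
rewrite /domega (cartan_sum (A := fun I l k => convol (U I) (kder (kappa j k) l) x)); last first.
  by move=> J' k; apply: wclosed_conv => // i; exact: pker_kappa.
pose F m := convol (U J) (mix j m) x.
transitivity (\sum_(k < N) (F k - F k.+1)).
  apply: eq_bigr => k _; rewrite /F /convol -RintegralB//; try exact: conv_integrable.
  by apply: eq_Rintegral => z _; rewrite tensor_kder_kappa mulrBr.
rewrite -(big_mkord xpredT (fun m => F m - F m.+1)); under eq_bigr do rewrite -opprB.
rewrite sumrN telescope_sumr// opprB /F /moll.
by congr (convol _ _ _ - convol _ _ _); apply/funext => i; rewrite /mix /eta ?ltn_ord.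
Qed.

End homotopy_forms.

(** * Cutoff functions adapted to the stopping sets *)

Section cutoffs.
Variables (R : realType) (N : nat).
Implicit Types (k l : 'I_N) (x : 'rV[R]_N) (j n : nat).
Local Notation mu := (lebN R N).
Local Notation Q := (cubeN R N).
Let mQ : measurable Q := @measurable_cubeN R N.

Variable B : R.
Hypothesis B1 : 1 <= B.
Hypothesis dB : forall t, `|derive1 (@sstep R) t| <= B.

Local Notation grid j := {ffun 'I_N -> 'I_(2 ^ j)}.

Definition bker j (c : grid j) : 'I_N -> R -> R := fun i => @bk R j (c i).

Lemma pker_bker j (c : grid j) i : pker (bker c i).
Proof. exact: pker_bk. Qed.

(** Volume count: the cubes at these grid points are disjoint and lie in the ball of radius 3 / 2^j,
    of volume at most (18 / 2^j)^N. *)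
Lemma card_near_grid j x (P : pred (grid j)) :
  (forall c, P c -> forall l, cdist (x 0 l - dpt R j (kn c) 0 l) <= 2 / 2 ^+ j) ->
  #|P|%:R <= 18 ^+ N :> R.
Proof.
move=> Pc; have q : 0 < (2 ^+ j)^-1 :> R by rewrite invr_gt0 exprn_gt0.
pose S := [seq c <- index_enum (grid j) | P c].
have uS : uniq S by rewrite filter_uniq// index_enum_uniq.
pose D := \big[setU/set0]_(c <- S) @dcube R N j (kn c).
have mD : measurable D by apply: bigsetU_measurable => c _; exact: measurable_dcube.
have DP z : D z -> exists2 c, P c & dcube j (kn c) z.
  rewrite /D /S big_filter; elim/big_ind : _ => // [A A' IA IA' []//|c c' cz].
  by exists c.
have sD : D `<=` cball x (3 / 2 ^+ j).
  move=> z /DP[c c' cz]; split; first by apply: dcube_sub cz => i; exact: ltn_ord.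
  move=> l; rewrite (le_trans (cdist_tri (dpt R j (kn c) 0 l) _ _))//.
  have := Pc c c' l; rewrite [cdist (dpt _ _ _ _ _ - _)]cdistB.
  have := le_trans (cdist_le_norm _) (dcube_dist l cz).
  move=> *; lra.
have H : (\sum_(c <- S) mu (@dcube R N j (kn c)) <= ((18 / 2 ^+ j) ^+ N)%:E)%E.
  rewrite lebN_dcubes//.
  apply: (@le_trans _ _ (mu (cball x (3 / 2 ^+ j)))).
    by apply: le_measure; rewrite ?inE//; exact: measurable_cball.
  apply: (le_trans (lebN_cball_le _ _)); first by rewrite mulr_ge0// ltW.
  by rewrite lee_fin mulrA (_ : 6 * 3 = 18 :> R)//; ring.
move: H; under eq_bigr do rewrite lebN_dcube.
rewrite /S big_filter sumEFin lee_fin exprMn.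
rewrite (_ : \sum_(c | P c) _ = 2 ^- j ^+ N *+ #|P|); last exact: (sumr_const P).
by rewrite -mulr_natl ler_pM2r// exprn_gt0.
Qed.

Variables (f : RN R N -> R) (L : R).
Local Notation stop := (stop f L).

(** Scale j + 1 lies halfway between [stop j], where the cutoff has to vanish, and [stop j.+2], off
    which it has to be 1. The bump radius 2 / 2^j = 4 / 2^(j+1) fits the displacement that
    [stop_near] allows in both passages. *)
Definition sel j (c : grid j) : bool := ~~ `[< stop j.+1 (dpt R j (kn c)) >].

Definition chi j x : R := \sum_(c : grid j | sel c) tensor (bker c) x.

Definition dchi j k x : R := \sum_(c : grid j | sel c) tensor (kder (bker c) k) x.

Definition ddchi j k l x : R := \sum_(c : grid j | sel c) tensor (kder (kder (bker c) k) l) x.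

Lemma C2per_chi j : C2per (chi j) (dchi j) (ddchi j).
Proof.
apply: (@C2per_sum _ _ _ _ _ (fun c : grid j => tensor (bker c)) (fun c k => tensor (kder (bker c) k))
  (fun c k l => tensor (kder (kder (bker c) k) l))) => c _.
by apply: C2per_tensor => i; exact: pker_bker.
Qed.

Lemma bker_supp j (c : grid j) x : tensor (bker c) x != 0 ->
  forall l, cdist (x 0 l - dpt R j (kn c) 0 l) <= 2 / 2 ^+ j.
Proof. by move=> /tensor_neq0 h l; rewrite mxE; apply: bk_supp; exact: h. Qed.

Lemma dbker_supp j (c : grid j) k x : tensor (kder (bker c) k) x != 0 ->
  forall l, cdist (x 0 l - dpt R j (kn c) 0 l) <= 2 / 2 ^+ j.
Proof.
move=> /tensor_neq0 h l; rewrite mxE; have := h l; rewrite /kder /kupd.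
by have [->|_] := eqVneq l k; [exact: derive_bk_supp|exact: bk_supp].
Qed.

Lemma sum_bker j x : \sum_(c : grid j) tensor (bker c) x = 1.
Proof.
rewrite /tensor -(bigA_distr_bigA (fun i (m : 'I_(2 ^ j)) => @bk R j m (x 0 i))).
by rewrite big1// => i _; exact: sum_bk.
Qed.

Lemma sum_dbker j k x : \sum_(c : grid j) tensor (kder (bker c) k) x = 0.
Proof.
have H : is_derive x (evec R k) (fun x => \sum_(c : grid j) tensor (bker c) x)
    (\sum_(c : grid j) tensor (kder (bker c) k) x).
  by apply: is_derive_sumr => c _; apply: is_derive_tensor => i; exact: pker_bker.
have E : (fun x => \sum_(c : grid j) tensor (bker c) x) = cst 1.
  by apply/funext => y; rewrite sum_bker.
rewrite E in H; rewrite -(@derive_val _ _ _ _ _ _ _ H).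
exact: derive_cst.
Qed.

Lemma sel_stop j (c : grid j) x : stop j x ->
  (forall l, cdist (x 0 l - dpt R j (kn c) 0 l) <= 2 / 2 ^+ j) -> ~~ sel c.
Proof.
move=> sx xc; rewrite negbK; apply/asboolP; apply: stop_near sx _ => l.
by rewrite (le_trans (xc l))// ler_pM2r ?invr_gt0 ?exprn_gt0//; lra.
Qed.

Lemma sel_nstop j (c : grid j) x : ~ stop j.+2 x ->
  (forall l, cdist (x 0 l - dpt R j (kn c) 0 l) <= 2 / 2 ^+ j) -> sel c.
Proof.
move=> sx xc; apply/negP => /asboolP sc; apply: sx; apply: stop_near sc _ => l.
rewrite cdistB (le_trans (xc l))// exprS invfM mulrA ler_pM2r ?invr_gt0 ?exprn_gt0//; lra.
Qed.

Lemma chi_stop j x : stop j x -> chi j x = 0.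
Proof.
move=> sx; rewrite /chi big1// => c; apply: contraTeq => /bker_supp.
exact: sel_stop.
Qed.

Lemma dchi_stop j k x : stop j x -> dchi j k x = 0.
Proof.
move=> sx; rewrite /dchi big1// => c; apply: contraTeq => /dbker_supp.
exact: sel_stop.
Qed.

Lemma chi_nstop j x : ~ stop j.+2 x -> chi j x = 1.
Proof.
move=> sx; rewrite -(sum_bker j x) [RHS](bigID (@sel j))/= [X in _ + X]big1 ?addr0//.
by move=> c; apply: contraNeq => /bker_supp; exact: sel_nstop.
Qed.

(** Every bump with nonzero derivative at x is selected, and over the whole partition of unity these
    derivatives sum to 0. *)
Lemma dchi_nstop j k x : ~ stop j.+2 x -> dchi j k x = 0.
Proof.
move=> sx; rewrite -(sum_dbker j k x) [RHS](bigID (@sel j))/= [X in _ + X]big1 ?addr0//.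
by move=> c; apply: contraNeq => /dbker_supp; exact: sel_nstop.
Qed.

Lemma sum_near_grid_le j x (F : grid j -> R) (b : R) (P : pred (grid j)) :
  (forall c, F c != 0 -> forall l, cdist (x 0 l - dpt R j (kn c) 0 l) <= 2 / 2 ^+ j) ->
  0 <= b -> (forall c, `|F c| <= b) -> `|\sum_(c | P c) F c| <= 18 ^+ N * b.
Proof.
move=> Fs b0 Fb; rewrite (bigID (fun c => F c != 0))/= [X in _ + X]big1 ?addr0; last first.
  by move=> c /andP[_]; rewrite negbK => /eqP.
pose P' : pred (grid j) := [pred c | P c && (F c != 0)].
rewrite (le_trans (ler_norm_sum _ _ _))// (le_trans (y := \sum_(c | P' c) b))//.
  exact: ler_sum.
rewrite (_ : \sum_(c | P' c) b = b *+ #|P'|); last exact: (sumr_const P').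
rewrite -(mulr_natl b) ler_wpM2r//; apply: (@card_near_grid j x) => c /andP[_]; exact: Fs.
Qed.

(** At most 18^N bumps are nonzero at a given point, and each is a product of N factors bounded by
    4. *)
Definition Cchi : R := 18 ^+ N * 4 ^+ N.

Lemma Cchi_ge0 : 0 <= Cchi.
Proof. by rewrite mulr_ge0 ?exprn_ge0. Qed.

Lemma chi_le j x : `|chi j x| <= Cchi.
Proof.
apply: (@sum_near_grid_le j x) => [c||c]; [exact: bker_supp|exact: exprn_ge0|].
rewrite (le_trans (tensor_le (b := fun=> 4) _))//; first by move=> i; exact: bk_le.
by rewrite prodr_const card_ord.
Qed.

Lemma dchi_le j k x : `|dchi j k x| <= Cchi * (B * 2 ^+ j).
Proof.
have b0 : 0 <= B * 2 ^+ j by rewrite mulr_ge0 ?exprn_ge0 ?(le_trans _ B1).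
rewrite /Cchi -mulrA; apply: (@sum_near_grid_le j x) => [c||c].
- exact: dbker_supp.
- by rewrite mulr_ge0 ?exprn_ge0.
(* The differentiated factor is at most 2 B 2^j; 4 in its place keeps the constant [Cchi]. *)
rewrite (le_trans (tensor_le (b := fun i => 4 * (if i == k then B * 2 ^+ j else 1)) _))//.
  move=> i; rewrite /kder /kupd; case: eqP => [->|_]; last by rewrite mulr1; exact: bk_le.
  rewrite (le_trans (derive_bk_le dB _ _ _))// -mulrA ler_wpM2r//; lra.
by rewrite big_split/= prodr_const card_ord -big_mkcond/= big_pred1_eq.
Qed.

End cutoffs.

(** * The truncated forms and their uniform bound *)

Section truncation.
Variables (R : realType) (N : nat).
Implicit Types (I J : {set 'I_N}) (k l : 'I_N) (x : 'rV[R]_N) (j n : nat).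
Local Notation mu := (lebN R N).
Local Notation Q := (cubeN R N).
Local Notation integ f := (mu.-integrable Q (EFin \o f)).
Local Notation sg k J := (wsign R [set k] J).
Let mQ : measurable Q := @measurable_cubeN R N.

Variable B : R.
Hypothesis B1 : 1 <= B.
Hypothesis dB : forall t, `|derive1 (@sstep R) t| <= B.

Variable U : {set 'I_N} -> RN R N -> R.
Hypothesis iU : forall J, integ (U J).
Hypothesis clU : wclosed U.

Variables (f : RN R N -> R) (L : R).
Hypotheses (L0 : 0 < L) (f0 : forall z, 0 <= f z) (mf : measurable_fun Q f).
Hypothesis fi : (\int[mu]_(z in Q) (f z)%:E < +oo)%E.
Hypothesis UfL : forall J z, Q z -> `|U J z| <= f z + L.
Local Notation stop := (stop f L).
Local Notation chi := (chi f L).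
Local Notation dchi := (@dchi _ _ f L).
Local Notation moll := (moll U).
Local Notation omega := (omega U).
Local Notation domega := (domega U).

Lemma stop_mono_le j n x : (j <= n)%N -> stop j x -> stop n x.
Proof. by move=> /subnK <-; elim: (n - j)%N => [//|d IH] /IH; exact: stop_mono. Qed.

Definition cutder j k I x : R := dchi j k x * omega j I x + chi j x * domega j k I x.

Definition cutdder j k l I x : R :=
  (ddchi f L j k l x * omega j I x + dchi j k x * domega j l I x) +
  (dchi j l x * domega j k I x + chi j x * ddomega U j k l I x).

(* the exterior derivative of [chi j * omega j] *)
Definition dcut j J x : R := \sum_(k in J) sg k J * cutder j k (J :\ k) x.

Definition trunc n J x : R := moll 0 J x - \sum_(j < n) dcut j J x.

Lemma C2per_cut j I : C2per (fun x => chi j x * omega j I x) (fun k => cutder j k I) (fun k l => cutdder j k l I).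
Proof. exact: (C2perM (C2per_chi f L j) (C2per_omega iU j I)). Qed.

Lemma continuous_trunc n J : continuous (trunc n J).
Proof.
apply: continuousDr; first by apply: continuous_conv => // i; exact: pker_eta.
under eq_fun do rewrite -mulN1r; apply: continuousZr; apply: continuous_sumr => j _.
apply: (continuous_sumr (f := fun k x => sg k J * cutder j k (J :\ k) x)) => k _.
by apply: (continuousZr (f := cutder j k (J :\ k))); have [] := C2per_cut j (J :\ k).
Qed.

Lemma Zperiodic_trunc n J : Zperiodic (trunc n J).
Proof.
move=> i x; rewrite /trunc /moll Zperiodic_conv; last by move=> l; exact: pker_eta.
congr (_ - _); apply: eq_bigr => j _; apply: eq_bigr => k _.
by have [_ _ _ _ _ _ _ ->] := C2per_cut j (J :\ k).
Qed.

(** Each part is closed in the classical sense: [moll 0] as a mollification of a closed form, and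
    [dcut j] as an exterior derivative, by symmetry of the second derivatives. *)
Lemma wclosed_trunc n : wclosed (fun J z => trunc n J (coordN z)).
Proof.
pose DV l J x := convol (U J) (kder (@eta R N 0) l) x +
  -1 * \sum_(j < n) \sum_(k in J) sg k J * cutdder j k l (J :\ k) x.
have pe := @pker_eta R N 0.
apply: (@classical_wclosed _ _ _ DV).
- exact: Zperiodic_trunc.
- exact: continuous_trunc.
- move=> l J; apply: continuousDr; first by apply: continuous_conv => // i; exact: pker_kder.
  apply: continuousZr; apply: continuous_sumr => j _.
  apply: (continuous_sumr (f := fun k x => sg k J * cutdder j k l (J :\ k) x)) => k _.
  by apply: (continuousZr (f := cutdder j k l (J :\ k))); have [] := C2per_cut j (J :\ k).
- move=> l J x; rewrite (_ : trunc n J = (fun y => moll 0 J y + -1 * \sum_(j < n) dcut j J y)); last first.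
    by apply/funext => y; rewrite mulN1r.
  apply: (@is_deriveD R 'rV[R]_N R); first exact: is_derive_conv.
  apply: is_deriveZr; apply: (@is_derive_sumr _ 'rV[R]_N _ _ _ (fun (j : 'I_n) y => dcut j J y)) => j _.
  apply: (@is_derive_sumr _ 'rV[R]_N _ _ _ (fun k y => sg k J * cutder j k (J :\ k) y)) => k _.
  by apply: (@is_deriveZr _ 'rV[R]_N _ (cutder j k (J :\ k))); have [] := C2per_cut j (J :\ k).
- move=> J x; rewrite /DV; under eq_bigr do rewrite mulrDr mulrCA.
  rewrite big_split/= -mulr_sumr wclosed_conv// add0r.
  under eq_bigr do rewrite mulr_sumr; rewrite exchange_big/= big1 ?mulr0// => j _.
  apply: (ddsum0 (B := fun I l k => cutdder j k l I x)) => I k l.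
  by have [_ _ ->] := C2per_cut j I.
Qed.

(** Leibniz: d(chi w) = d chi /\ w + chi dw, with dw given by [domega_sum]. *)
Lemma dcutE j J x : dcut j J x = \sum_(k in J) sg k J * (dchi j k x * omega j (J :\ k) x)
  + chi j x * (moll j J x - moll j.+1 J x).
Proof.
rewrite -domega_sum// mulr_sumr -big_split/=; apply: eq_bigr => k _.
by rewrite /cutder mulrDr [chi j x * (sg k J * _)]mulrCA.
Qed.

Lemma dcut_stop j J x : stop j x -> dcut j J x = 0.
Proof.
move=> sx; rewrite dcutE chi_stop// mul0r addr0 big1// => k _.
by rewrite dchi_stop// mul0r mulr0.
Qed.

Lemma dcut_nstop j J x : ~ stop j.+2 x -> dcut j J x = moll j J x - moll j.+1 J x.
Proof.
move=> sx; rewrite dcutE chi_nstop// mul1r big1 ?add0r// => k _.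
by rewrite dchi_nstop// mul0r mulr0.
Qed.

Lemma truncS n J x : trunc n.+1 J x = trunc n J x - dcut n J x.
Proof. by rewrite /trunc big_ord_recr/= opprD addrA. Qed.

(** From scale i on the point is in every stopping set, so all later terms vanish. *)
Lemma trunc_stop i n J x : stop i x -> (i <= n)%N -> trunc n J x = trunc i J x.
Proof.
move=> sx /subnK <-; elim: (n - i)%N => [//|d IH].
by rewrite addSn truncS dcut_stop ?subr0//; apply: stop_mono_le sx; exact: leq_addl.
Qed.

(** For j < n the point is off [stop j.+2], so every cutoff is 1 near the terms involved and the sum
    telescopes. *)
Lemma trunc_nstop n J x : ~ stop n.+1 x -> trunc n J x = moll n J x.
Proof.
elim: n => [|n IH] sx; first by rewrite /trunc big_ord0 subr0.
rewrite truncS dcut_nstop// IH; last by move/stop_mono.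
by rewrite opprB addrC subrK.
Qed.

(** By [UfL] the mass splits into that of f, bounded by [cball_mass], and L times the volume, which
    obeys the same bound; whence the 2. *)
Lemma integral_cball_le j J x : ~ stop j x ->
  \int[mu]_(z in cball x (4^-1 / 2 ^+ j)) `|U J z| <= 2 * L * (14 / 2 ^+ j) ^+ N.
Proof.
move=> sx; set A := cball x _; have mA : measurable A by exact: measurable_cball.
have AQ : A `<=` Q by move=> z [].
have q : 0 < (2 ^+ j)^-1 :> R by rewrite invr_gt0 exprn_gt0.
have iA : mu.-integrable A (EFin \o (fun z => `|U J z|)).
  by apply: integrableS (integ_norm (iU J)).
rewrite -lee_fin -Rintegral_EFin//.
have mfA : measurable_fun A (fun z => (f z)%:E) by apply/measurable_EFinP; exact: measurable_funS mf.
apply: (@le_trans _ _ (\int[mu]_(z in A) ((f z)%:E + L%:E))%E).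
  apply: ge0_le_integral => //.
  - by have /integrableP[] := iA.
  - exact: emeasurable_funD.
  - by move=> z Az; rewrite -EFinD lee_fin UfL//; exact: AQ.
rewrite ge0_integralD//; last 2 first.
- by move=> z _; rewrite lee_fin.
- by move=> z _; rewrite lee_fin ltW.
rewrite (_ : 2 * L * _ = L * (14 / 2 ^+ j) ^+ N + L * (14 / 2 ^+ j) ^+ N); last by ring.
rewrite EFinD leeD//; first exact: cball_mass.
rewrite integral_cst// EFinM lee_wpmul2l ?lee_fin ?(ltW L0)//.
apply: (le_trans (lebN_cball_le _ _)); first by rewrite mulr_ge0 ?(ltW q)// invr_ge0.
rewrite lee_fin; apply: lerXn2r; rewrite ?nnegrE ?mulr_ge0 ?(ltW q) ?invr_ge0//; lra.
Qed.

Lemma convol_le j J x K (b : R) : ~ stop j x -> 0 <= b -> (forall i, pker (K i)) ->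
  (forall y, `|tensor K y| <= b) ->
  (forall y, tensor K y != 0 -> forall i, cdist (y 0 i) <= 4^-1 / 2 ^+ j) ->
  `|convol (U J) K x| <= b * (2 * L * (14 / 2 ^+ j) ^+ N).
Proof.
move=> sx b0 gK Kb Ks.
apply: (@le_trans _ _ (\int[mu]_(z in Q) (`|tensor K (x - coordN z)| * `|U J z|))).
  rewrite (le_trans (le_normr_Rintegral _ _))//; first exact: conv_integrable.
  rewrite le_eqVlt; apply/orP; left; apply/eqP; apply: eq_Rintegral => z _.
  by rewrite normrM mulrC.
apply: (@le_trans _ _ (b * \int[mu]_(z in cball x (4^-1 / 2 ^+ j)) `|U J z|)); last first.
  by rewrite ler_wpM2l//; exact: integral_cball_le.
apply: (integral_supported_le (F := fun z => tensor K (x - coordN z))) => //.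
- by apply: measurable_funTS; exact: measurable_tensorB.
- by move=> z Qz /Ks h; split => // i; have := h i; rewrite !mxE.
Qed.

(** From the kernel bound (B 2^(j+1))^N times the mass 2 L (14 / 2^j)^N, with 28 = 2 * 14. The scale
    j + 1 lets one constant serve [moll j], [moll j.+1] and [omega j]. *)
Definition Cmoll : R := 2 * (28 * B) ^+ N.

Let B0 : 0 < B. Proof. exact: lt_le_trans B1. Qed.

Lemma Cmoll_ge0 : 0 <= Cmoll.
Proof. by rewrite mulr_ge0// exprn_ge0// mulr_ge0// ltW. Qed.

Lemma scaleE j : (B * 2 ^+ j.+1) ^+ N * (2 * L * (14 / 2 ^+ j) ^+ N) = Cmoll * L.
Proof.
rewrite /Cmoll (_ : 28 * B = (B * 2 ^+ j.+1) * (14 / 2 ^+ j)) ?exprMn; first by ring.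
by rewrite exprS; field; rewrite expf_neq0// pnatr_eq0.
Qed.

(** The support at scale j + 1 lies in the ball of scale j, so the mass bound at scale j applies
    even if the point is stopped at scale j + 1. *)
Lemma moll_succ_le j J x : ~ stop j x -> `|moll j.+1 J x| <= Cmoll * L.
Proof.
move=> sx; rewrite -(scaleE j); apply: convol_le => //.
- by rewrite exprn_ge0// mulr_ge0 ?exprn_ge0// ltW.
- by move=> i; exact: pker_eta.
- exact: eta_le.
- move=> y /tensor_neq0 h i; rewrite (le_trans (hk_supp (h i)))//.
  by rewrite ler_pM2l ?invr_gt0// lef_pV2 ?posrE ?exprn_gt0// exprS ler_peMl ?exprn_ge0// ler1n.
Qed.

Lemma scale_le j : (B * 2 ^+ j) ^+ N <= (B * 2 ^+ j.+1) ^+ N.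
Proof.
apply: lerXn2r; rewrite ?nnegrE ?mulr_ge0 ?exprn_ge0 ?(ltW B0)//.
by rewrite ler_pM2l// exprS ler_peMl ?exprn_ge0// ler1n.
Qed.

Lemma moll_le j J x : ~ stop j x -> `|moll j J x| <= Cmoll * L.
Proof.
move=> sx; rewrite -(scaleE j); apply: convol_le => //.
- by rewrite exprn_ge0// mulr_ge0 ?exprn_ge0// ltW.
- by move=> i; exact: pker_eta.
- by move=> y; exact: le_trans (eta_le dB j y) (scale_le j).
- by move=> y /tensor_neq0 h i; exact: (hk_supp (h i)).
Qed.

(** The factor [ck j] is at most 1, where a mollifier is only bounded by B 2^(j+1): this is the
    source of the gain 2^-j. *)
Lemma kappa_le j k y : `|tensor (@kappa R N j k) y| <= (B * 2 ^+ j.+1) ^+ N / 2 ^+ j.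
Proof.
have p0 : 0 < 2 ^+ j :> R by rewrite exprn_gt0.
have p1 : 0 < 2 ^+ j.+1 :> R by rewrite exprn_gt0.
rewrite (le_trans (tensor_le (b := fun i => (B * 2 ^+ j.+1) * (if i == k then (2 ^+ j)^-1 else 1)) _))//.
  move=> i; rewrite /kappa; have [->|ik] := eqVneq i k.
    rewrite ltnn (le_trans (ck_le1 _ _))// ler_pdivlMr// mul1r.
    have B2 : 1 <= B * 2 by have := B1; lra.
    by rewrite exprS mulrA ler_peMl// ltW.
  rewrite mulr1; case: ifP => _; first exact: hk_le.
  by rewrite (le_trans (hk_le dB _ _))// ler_pM2l// exprS ler_peMl ?(ltW p0)// ler1n.
by rewrite big_split/= prodr_const card_ord -big_mkcond/= big_pred1_eq.
Qed.

Lemma omega_le j I x : ~ stop j x -> `|omega j I x| <= N%:R * (Cmoll * L) / 2 ^+ j.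
Proof.
move=> sx; have p0 : 0 < 2 ^+ j :> R by rewrite exprn_gt0.
rewrite (le_trans (ler_norm_sum _ _ _))// (le_trans (y := \sum_(k < N) (Cmoll * L) / 2 ^+ j))//; last first.
  by rewrite sumr_const card_ord -[leLHS]mulr_natl mulrA.
rewrite [leRHS](bigID (fun k => k \notin I))/= ler_wpDr//.
  by apply: sumr_ge0 => k _; rewrite divr_ge0 ?(ltW p0)// mulr_ge0 ?Cmoll_ge0// ltW.
apply: ler_sum => k _; rewrite normrM normr_wsign mul1r -(scaleE j) mulrAC.
apply: convol_le => //.
- by rewrite divr_ge0 ?(ltW p0)// exprn_ge0// mulr_ge0 ?exprn_ge0// ltW.
- by move=> i; exact: pker_kappa.
- exact: kappa_le.
- move=> y /tensor_neq0 h i; have := h i; rewrite /kappa; case: ifP => _.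
    move=> /hk_supp/le_trans; apply.
    by rewrite ler_pM2l ?invr_gt0// lef_pV2 ?posrE ?exprn_gt0// exprS ler_peMl ?(ltW p0)// ler1n.
  by case: ifP => _; [exact: ck_supp|exact: hk_supp].
Qed.

Definition Ccut : R := Cchi R N * (N%:R * (B * N%:R * Cmoll) + 2 * Cmoll).

Lemma Ccut_ge0 : 0 <= Ccut.
Proof.
have c0 := Cmoll_ge0; apply: mulr_ge0; first exact: Cchi_ge0.
move: c0; set c := Cmoll; clearbody c => c0.
by apply: addr_ge0; rewrite ?mulr_ge0// ltW.
Qed.

(** The 2^j of the gradient of the cutoff meets the 2^-j of [omega_le]. In [Ccut] one factor N
    counts the directions k, the other the summands of omega; 2 Cmoll bounds the difference of two
    mollifications. *)
Lemma dcut_le j J x : ~ stop j x -> `|dcut j J x| <= Ccut * L.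
Proof.
move=> sx; have p0 : 0 < 2 ^+ j :> R by rewrite exprn_gt0.
rewrite dcutE (le_trans (ler_normD _ _))// /Ccut -mulrA mulrDl mulrDr lerD//; last first.
  rewrite normrM ler_pM// ?chi_le// (le_trans (ler_normB _ _))//.
  rewrite (_ : 2 * Cmoll * L = Cmoll * L + Cmoll * L); last by ring.
  by apply: lerD; [exact: moll_le|exact: moll_succ_le].
set b := Cchi R N * (B * N%:R * Cmoll * L).
rewrite (le_trans (ler_norm_sum _ _ _))// (le_trans (y := \sum_(k < N) b))//; last first.
  rewrite sumr_const card_ord -(mulr_natl b) /b le_eqVlt; apply/orP; left; apply/eqP; ring.
have b0 : 0 <= b.
  have := Cmoll_ge0; have := Cchi_ge0 R N; rewrite /b.
  set c := Cmoll; set c' := Cchi R N; clearbody c c' => c0 c0'.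
  by rewrite !mulr_ge0 ?(ltW L0) ?(ltW B0).
rewrite [leRHS](bigID (mem J))/= ler_wpDr//; first exact: sumr_ge0.
apply: ler_sum => k _; rewrite normrM normr_wsign mul1r normrM.
rewrite (_ : b = (Cchi R N * (B * 2 ^+ j)) * (N%:R * (Cmoll * L) / 2 ^+ j)); last first.
  by rewrite /b; field; rewrite gt_eqF.
by rewrite ler_pM// ?dchi_le ?omega_le.
Qed.

Hypothesis nstop0 : forall x, ~ stop 0 x.

(** A point first stopped at scale n + 1 sees a plain mollification up to index n - 1, then at most
    two altered terms, of index n - 1 and n; afterwards the value is frozen. *)
Lemma trunc_le n J x : `|trunc n J x| <= (Cmoll + 2 * Ccut) * L.
Proof.
have CL : 0 <= Ccut * L by rewrite mulr_ge0 ?Ccut_ge0// ltW.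
(* Off [stop m] only the last term, of index m - 1, can differ from a difference of
   mollifications. *)
have H0 m : ~ stop m x -> `|trunc m J x| <= Cmoll * L + Ccut * L.
  case: m => [|m] sx; first by rewrite /trunc big_ord0 subr0 ler_wpDr ?moll_le.
  have sx' : ~ stop m x by move/stop_mono.
  rewrite truncS trunc_nstop// (le_trans (ler_normB _ _))// lerD ?moll_le ?dcut_le//.
have E : (Cmoll + 2 * Ccut) * L = Cmoll * L + Ccut * L + Ccut * L by ring.
elim: n => [|n IH]; first by rewrite E (le_trans (H0 0 _))// lerDl.
have [sx|sx] := pselect (stop n x); first by rewrite truncS dcut_stop ?subr0.
by rewrite truncS E (le_trans (ler_normB _ _))// lerD ?H0 ?dcut_le.
Qed.

End truncation.

(** * The limit form *)

Section limit_form.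
Variables (R : realType) (N : nat).
Hypothesis N0 : (0 < N)%N.
Implicit Types (J : {set 'I_N}) (k l : 'I_N) (x : 'rV[R]_N) (j n : nat).
Local Notation mu := (lebN R N).
Local Notation Q := (cubeN R N).
Local Notation integ f := (mu.-integrable Q (EFin \o f)).
Let mQ : measurable Q := @measurable_cubeN R N.

Variable B : R.
Hypothesis B1 : 1 <= B.
Hypothesis dB : forall t, `|derive1 (@sstep R) t| <= B.

Variable W : {set 'I_N} -> 'rV[R]_N -> R.
Let U J (z : RN R N) := W J (coordN z).
Hypothesis iU : forall J, integ (U J).
Hypothesis clU : wclosed U.
Hypothesis pW : forall J, Zperiodic (W J).

Variables (f : RN R N -> R) (L : R).
Hypotheses (L0 : 0 < L) (f0 : forall z, 0 <= f z) (mf : measurable_fun Q f).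
Hypothesis fL : (\int[mu]_(z in Q) (f z)%:E <= L%:E)%E.
Hypothesis UfL : forall J z, Q z -> `|U J z| <= f z + L.
Local Notation stop := (stop f L).
Local Notation trunc := (trunc U f L).

(** At scale 0 the margin 10 / 2^i - 8 is positive only for i = 0, and the unit cube is good by
    [fL]. A coordinate in which to read this off exists because N > 0. *)
Lemma nstop0 x : ~ stop 0 x.
Proof.
move=> [i [k [ki b xk]]].
have i0 : i = 0%N.
  have := le_lt_trans (cdist_ge0 _) (xk (Ordinal N0)); rewrite expr0 divr1 subr_gt0.
  case: i {ki b xk} => // i; rewrite exprS invfM mulrA => h.
  have p1 : (2 ^+ i)^-1 <= 1 :> R by rewrite invf_le1 ?exprn_gt0// exp2_ge1.
  by exfalso; move: h p1; set c := (2 ^+ i)^-1 => h p1; lra.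
subst i; move: b; rewrite /bad expr0 invr1 expr1n mulr1.
rewrite /dmass (_ : k = fun=> 0%N); last by apply/funext => l; have := ki l; rewrite expn0; case: (k l).
by rewrite dcube0 ltNge fL.
Qed.

Definition stopped x : Prop := exists j, stop j x.

(** By [trunc_stop], every scale at which the point is stopped gives the same value, so the choice
    made here is harmless. *)
Definition vlim J x : R :=
  match pselect (stopped x) with left e => trunc (sval (cid e)) J x | right _ => W J x end.

Lemma vlim_stop i J x : stop i x -> vlim J x = trunc i J x.
Proof.
move=> sx; rewrite /vlim; case: pselect => [e|[]]; last by exists i.
case: (cid e) => i' sx' /=.
have [ii'|ii'] := leqP i i'; first by rewrite (trunc_stop iU clU _ sx).
by rewrite [RHS](trunc_stop iU clU _ sx')// ltnW.
Qed.

Lemma vlim_nstop J x : ~ stopped x -> vlim J x = W J x.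
Proof. by rewrite /vlim; case: pselect. Qed.

Lemma Zperiodic_vlim J : Zperiodic (vlim J).
Proof.
move=> k x; have [[i sx]|nsx] := pselect (stopped x).
  rewrite (vlim_stop _ sx) (@vlim_stop i) ?Zperiodic_trunc//.
  exact/stop_periodic.
rewrite !vlim_nstop ?pW// => -[i /stop_periodic sx]; apply: nsx; by exists i.
Qed.

Let S : set (RN R N) := [set z | Q z /\ stopped (coordN z)].

Lemma measurable_stopped : measurable S.
Proof.
rewrite (_ : S = \bigcup_j [set z | Q z /\ stop j (coordN z)]).
  by apply: bigcupT_measurable => j; exact: measurable_stop.
by apply/seteqP; split => [z [Qz [j sz]]|z [j _ [Qz sz]]]; [exists j|split => //; exists j].
Qed.

Let m1S : measurable_fun Q (\1_S : RN R N -> R).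
Proof. exact: measurable_indic measurable_stopped. Qed.

Let mtrunc n J : measurable_fun Q (fun z => trunc n J (coordN z)).
Proof.
by apply: measurable_funTS; apply: continuous_measurable_coordN; exact: continuous_trunc.
Qed.

Let trunc_cvg J z : S z -> trunc n J (coordN z) @[n --> \oo] --> vlim J (coordN z).
Proof.
move=> [Qz [i sz]]; apply: cvg_near_cst; near=> n.
rewrite (vlim_stop _ sz) (trunc_stop iU clU _ sz)//.
by near: n; exact: nbhs_infty_ge.
Unshelve. all: by end_near. Qed.

Lemma measurable_vlim J : measurable_fun Q (fun z => vlim J (coordN z)).
Proof.
apply: (@measurable_fun_cvg _ _ _ _ (fun n z => trunc n J (coordN z) * \1_S z + U J z * (1 - \1_S z))).
  move=> n; apply: measurable_funD; apply: measurable_funM => //.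
    exact: integ_measurable (iU J).
  by apply: measurable_funB.
move=> z Qz; rewrite indicE; have [Sz|Sz] := pselect (S z).
  rewrite mem_set//= subrr mulr0; under eq_fun do rewrite mulr1 addr0.
  exact: trunc_cvg.
rewrite memNset//= subr0 mulr1; under eq_fun do rewrite mulr0 add0r.
by rewrite vlim_nstop; [exact: cvg_cst|move=> sz; apply: Sz].
Qed.

Definition Cinf : R := Cmoll N B + 2 * Ccut N B.

Let trunc_bound n J x : `|trunc n J x| <= Cinf * L.
Proof. exact: (trunc_le B1 dB iU clU L0 f0 mf UfL nstop0). Qed.

Lemma vlim_stopped_le J x : stopped x -> `|vlim J x| <= Cinf * L.
Proof. by move=> [i sx]; rewrite (vlim_stop _ sx). Qed.

Lemma integ_vlim J : integ (fun z => vlim J (coordN z)).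
Proof.
have C0 : 0 <= Cinf * L by apply: le_trans (trunc_bound 0 J 0).
apply: (@integ_dominated _ _ _ mu _ mQ _ (fun z => cst (Cinf * L) z + `|U J z|)).
- exact: measurable_vlim.
- move=> z Qz; have [sz|sz] := pselect (stopped (coordN z)).
    by rewrite ler_wpDr ?vlim_stopped_le.
  by rewrite vlim_nstop// ler_wpDl.
- apply: integD => //; last exact: integ_norm.
  by apply: (@bounded_integrable _ _ _ _ _ _ (Cinf * L)) => //; [exact: lebN_cubeN_lty|move=> z _; rewrite ger0_norm].
Qed.

(** On the stopped set the sequence is bounded and eventually constant at each point, so dominated
    convergence applies; off it [trunc n] is [moll n], which tends to [U] in L^1 by
    [mollify_cvg]. *)
Lemma trunc_cvg_L1 J :
  \int[mu]_(z in Q) `|trunc n J (coordN z) - vlim J (coordN z)| @[n --> \oo] --> 0.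
Proof.
have itr n : integ (fun z => trunc n J (coordN z)).
  by apply: continuous_integrable_cube; exact: continuous_trunc.
pose F n z := trunc n J (coordN z) * \1_S z.
pose G z := vlim J (coordN z) * \1_S z.
have cF : \int[mu]_(z in Q) `|F n z - G z| @[n --> \oo] --> 0.
  apply: (@bounded_cvg_L1 _ _ _ _ _ _ _ _ _ (Cinf * L)) => //.
  - exact: lebN_cubeN_lty.
  - by move=> n; apply: measurable_funM.
  - by apply: measurable_funM => //; exact: measurable_vlim.
  - move=> n z Qz; rewrite /F indicE; case: (_ \in _); rewrite ?mulr1 ?mulr0 ?normr0//.
    exact: le_trans (trunc_bound 0 J 0).
  - move=> z Qz; rewrite /F /G indicE; have [Sz|Sz] := pselect (S z).
      rewrite mem_set//= mulr1; under eq_fun do rewrite mulr1.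
      exact: trunc_cvg.
    rewrite memNset//= mulr0; under eq_fun do rewrite mulr0.
    exact: cvg_cst.
have cM := mollify_cvg B1 dB (iU J).
have cFM : \int[mu]_(z in Q) `|F n z - G z| + \int[mu]_(z in Q) `|convol (U J) (@eta R N n) (coordN z) - U J z|
    @[n --> \oo] --> 0.
  by have h := cvgD cF cM; rewrite addr0 in h; exact: h.
apply: (squeeze_cvgr _ (cvg_cst 0) cFM); apply: nearW => n.
have iC : integ (fun z => convol (U J) (@eta R N n) (coordN z)).
  by apply: integ_convol => // i; exact: pker_eta.
have iD : integ (fun z => `|trunc n J (coordN z) - vlim J (coordN z)|).
  by apply: integ_norm; apply: integB => //; exact: integ_vlim.
have iFG : integ (fun z => `|F n z - G z|).
  apply: (integ_dominated _ _ _ iD) => //.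
    apply: measurableT_comp => //; apply: measurable_funB; apply: measurable_funM => //.
    exact: measurable_vlim.
  move=> z Qz; rewrite normr_id /F /G -mulrBl normrM indicE.
  by case: (_ \in _); rewrite ?normr1 ?normr0 ?mulr1 ?mulr0.
have iM : integ (fun z => `|convol (U J) (@eta R N n) (coordN z) - U J z|).
  by apply: integ_norm; apply: integB.
rewrite Rintegral_ge0//= -RintegralD//; apply: le_Rintegral => //; first exact: integD.
move=> z Qz; rewrite /F /G -mulrBl indicE; have [Sz|Sz] := pselect (S z).
  by rewrite mem_set//= mulr1 ler_wpDr.
rewrite memNset//= mulr0 normr0 add0r vlim_nstop; last by move=> sz; apply: Sz.
by rewrite (trunc_nstop iU clU)// => sz; apply: Sz; split => //; exists n.+1.
Qed.

(** The function [p] is twice the positive part of |v| - Cinf L. As all [trunc n] obey the bound,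
    this positive part is at most |trunc n - v|, whose integral tends to 0; hence [p] has integral
    0. *)
Lemma vlim_le_ae J : {ae mu, forall z, Q z -> `|vlim J (coordN z)| <= Cinf * L}.
Proof.
pose t z : R := `|vlim J (coordN z)| - Cinf * L; pose p z : R := `|t z| + t z.
have it : integ t.
  apply: integB => //; first by apply: integ_norm; exact: integ_vlim.
  by apply: (@bounded_integrable _ _ _ _ _ _ `|Cinf * L|) => //; exact: lebN_cubeN_lty.
have ip : integ p by apply: integD => //; exact: integ_norm.
have p0 z : 0 <= p z by rewrite /p; have := ler_norm (- t z); rewrite normrN; lra.
have Ip : \int[mu]_(z in Q) p z = 0.
  apply/eqP; rewrite eq_le Rintegral_ge0// andbT.
  pose a n := \int[mu]_(z in Q) `|trunc n J (coordN z) - vlim J (coordN z)|.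
  have h : a n + a n @[n --> \oo] --> 0.
    by have h := cvgD (trunc_cvg_L1 J) (trunc_cvg_L1 J); rewrite addr0 in h; exact: h.
  have c : \int[mu]_(z in Q) p z @[_ --> \oo] --> \int[mu]_(z in Q) p z by exact: cvg_cst.
  apply: (ler_cvg_to c h); apply: nearW => n.
  have iD : integ (fun z => `|trunc n J (coordN z) - vlim J (coordN z)|).
    apply: integ_norm; apply: integB => //; last exact: integ_vlim.
    by apply: continuous_integrable_cube; exact: continuous_trunc.
  rewrite -RintegralD//; apply: le_Rintegral => //; first exact: integD.
  move=> z Qz; rewrite /p; have : t z <= `|trunc n J (coordN z) - vlim J (coordN z)|.
    rewrite /t distrC (le_trans _ (lerB_dist _ _))// lerB//.
  have [t0|t0] := leP (t z) 0; first by rewrite (ler0_norm t0) addNr addr_ge0.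
  by rewrite (gtr0_norm t0) => h'; rewrite lerD.
have [H _] := @ae_eq_integral_abs _ _ _ mu _ mQ _ (measurable_int mu ip).
have : ae_eq mu Q (EFin \o p) (cst 0).
  apply: H; transitivity (\int[mu]_(z in Q) (p z)%:E)%E.
    by apply: eq_integral => z _ /=; rewrite ger0_norm.
  by rewrite Rintegral_EFin// Ip.
apply: filterS => z h Qz; have := h Qz => -[]; rewrite /p => E.
have [t0|t0] := leP (t z) 0; first by rewrite -subr_le0.
by move: E; rewrite (gtr0_norm t0) => E; exfalso; lra.
Qed.

Lemma cvg_sumr (I : Type) (s : seq I) (P : pred I) (u_ : I -> nat -> R) (l_ : I -> R) :
  (forall i, P i -> u_ i n @[n --> \oo] --> l_ i) ->
  \sum_(i <- s | P i) u_ i n @[n --> \oo] --> \sum_(i <- s | P i) l_ i.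
Proof.
move=> ul; elim: s => [|i s IH].
  by rewrite big_nil; under eq_fun do rewrite big_nil; exact: cvg_cst.
rewrite big_cons; case Pi : (P i); under eq_fun do rewrite big_cons Pi; last exact: IH.
exact: (cvgD (ul i Pi) IH).
Qed.

Lemma integral_trunc_cvg (g : 'rV[R]_N -> R) J : continuous g ->
  \int[mu]_(z in Q) (g (coordN z) * trunc n J (coordN z)) @[n --> \oo] -->
  \int[mu]_(z in Q) (g (coordN z) * vlim J (coordN z)).
Proof.
move=> cg; have [b gb] := continuous_bounded_cube cg.
have itr n : integ (fun z => trunc n J (coordN z)).
  by apply: continuous_integrable_cube; exact: continuous_trunc.
apply/subr_cvg0; apply: norm_cvg0.
have h : `|b| * \int[mu]_(z in Q) `|trunc n J (coordN z) - vlim J (coordN z)| @[n --> \oo] --> 0.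
  by have h := cvgM (cvg_cst `|b|) (trunc_cvg_L1 J); rewrite mulr0 in h; exact: h.
apply: (squeeze_cvgr _ (cvg_cst 0) h); apply: nearW => n; rewrite normr_ge0/=.
have i1 : integ (fun z => trunc n J (coordN z) - vlim J (coordN z)).
  by apply: integB => //; exact: integ_vlim.
rewrite -RintegralB//; [|exact: integ_mul_continuous|by apply: integ_mul_continuous => //; exact: integ_vlim].
have i2 : integ (fun z => g (coordN z) * (trunc n J (coordN z) - vlim J (coordN z))).
  exact: integ_mul_continuous.
under eq_Rintegral do rewrite -mulrBr.
rewrite (le_trans (le_normr_Rintegral _ i2))//.
rewrite -RintegralZl//; last exact: integ_norm.
apply: le_Rintegral => //; [exact: integ_norm|by apply: integZ => //; exact: integ_norm|].
move=> z Qz; rewrite normrM ler_wpM2r// (le_trans (gb _ (cubeN_le1 Qz)))// ler_norm//.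
Qed.

(** The condition pairs the form with functions bounded on the cube, so it passes to L^1 limits. *)
Lemma wclosed_vlim : wclosed (fun J z => vlim J (coordN z)).
Proof.
move=> g sg pg J; set X := (LHS).
suff h : (cst 0 : nat -> R) n @[n --> \oo] --> X.
  have h0 : (cst 0 : nat -> R) n @[n --> \oo] --> (0 : R) by exact: cvg_cst.
  have hd := @norm_hausdorff R R.
  by rewrite -(cvg_lim hd h) (cvg_lim hd h0).
have -> : cst 0 = (fun n => \sum_(k in J) wsign R [set k] J *
   \int[mu]_(z in Q) (pderiv k g (coordN z) * trunc n (J :\ k) (coordN z))).
  by apply/funext => n; have := @wclosed_trunc _ _ _ iU clU f L n g sg pg J.
apply: cvg_sumr => k _; apply: (cvgM (cvg_cst _)); apply: integral_trunc_cvg.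
exact: smooth_pderiv_continuous.
Qed.
End limit_form.

(** * The norm of a form and its components *)

Section form_norm.
Variables (R : realType) (N r : nat).
Implicit Types w v : lamform R N r.
Local Notation mu := (lebN R N).
Local Notation Q := (cubeN R N).

Lemma lamnorm_ge0 w : 0 <= lamnorm w.
Proof. exact: sqrtr_ge0. Qed.

Lemma le_lamnorm w I : `|w I| <= lamnorm w.
Proof.
rewrite -sqrtr_sqr ler_sqrt ?sumr_ge0// => [|I' _]; last exact: sqr_ge0.
by rewrite (bigD1 I)//= lerDl sumr_ge0// => I' _; exact: sqr_ge0.
Qed.

Lemma lamnorm_le_sum w : lamnorm w <= \sum_I `|w I|.
Proof.
have s0 : 0 <= \sum_I `|w I| by apply: sumr_ge0.
rewrite -[leRHS]ger0_norm// -sqrtr_sqr ler_sqrt ?sqr_ge0//.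
rewrite expr2 mulr_suml; apply: ler_sum => I _.
rewrite -real_normK ?num_real// expr2 ler_wpM2l//.
by rewrite (bigD1 I)//= lerDl sumr_ge0.
Qed.

Lemma lamnorm_le_card w (c : R) : (forall I, `|w I| <= c) -> lamnorm w <= #|{: kset N r}|%:R * c.
Proof.
move=> wc; rewrite (le_trans (lamnorm_le_sum w))// (le_trans (y := \sum_(I : kset N r) c))//.
  by apply: ler_sum.
by rewrite sumr_const -(mulr_natl c).
Qed.

Lemma measurable_lamnorm (w : 'rV[R]_N -> lamform R N r) :
  (forall I, measurable_fun Q (fun z => w (coordN z) I)) ->
  measurable_fun Q (fun z => lamnorm (w (coordN z))).
Proof.
move=> mw; have ms : measurable_fun [set: R] (@Num.sqrt R).
  by apply: continuous_measurable_fun; exact: sqrt_continuous.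
suff mS : measurable_fun Q (fun z => \sum_(I : kset N r) w (coordN z) I ^+ 2).
  exact: (measurableT_comp ms mS).
by apply: measurable_sum => I; apply: measurable_funX.
Qed.

Lemma normr_fext_le w J : `|fext w J| <= lamnorm w.
Proof.
rewrite /fext; case: (insub J) => [I|]; first exact: le_lamnorm.
by rewrite normr0 lamnorm_ge0.
Qed.

Lemma measurable_fext (w : 'rV[R]_N -> lamform R N r) J :
  (forall I, measurable_fun Q (fun z => w (coordN z) I)) ->
  measurable_fun Q (fun z => fext (w (coordN z)) J).
Proof. by move=> mw; rewrite /fext; case: (insub J). Qed.

(** The two forms differ exactly where the norm of their difference is positive. *)
Lemma measurable_neq_form (w v : 'rV[R]_N -> lamform R N r) :
  (forall I, measurable_fun Q (fun z => w (coordN z) I)) ->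
  (forall I, measurable_fun Q (fun z => v (coordN z) I)) ->
  measurable (Q `&` [set z | w (coordN z) <> v (coordN z)]).
Proof.
move=> mw mv; pose d z := lamnorm (lamsub (w (coordN z)) (v (coordN z))).
have md : measurable_fun Q d.
  apply: (@measurable_lamnorm (fun x => lamsub (w x) (v x))) => I.
  exact: measurable_funB.
have := md (@measurable_cubeN R N) _ (measurable_itv `]0, +oo[).
rewrite (_ : d @^-1` _ = [set z | w (coordN z) <> v (coordN z)])//.
apply/seteqP; split => z /=; rewrite in_itv/= andbT => dz.
  move=> E; move: dz; rewrite /d E (_ : lamnorm _ = 0) ?ltxx//.
  by rewrite /lamnorm big1 ?sqrtr0// => I _; rewrite /lamsub subrr expr0n.
rewrite lt_neqAle lamnorm_ge0 andbT; apply: contra_notN dz => /eqP d0.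
apply/funext => I; apply/eqP; rewrite -subr_eq0 -normr_le0 d0.
exact: (le_lamnorm (lamsub (w (coordN z)) (v (coordN z))) I).
Qed.

End form_norm.

(** * Truncation at level L, according to the size of the excess *)

Section closed_truncation.
Variables (R : realType) (N r : nat).
Local Notation mu := (lebN R N).
Local Notation Q := (cubeN R N).
Local Notation integ f := (mu.-integrable Q (EFin \o f)).
Let mQ : measurable Q := @measurable_cubeN R N.
Implicit Types (J : {set 'I_N}) (z : RN R N).

Variable u : 'rV[R]_N -> lamform R N r.
Hypotheses (Lu : L1form u) (du : dclosed u).
Variable L : R.
Hypothesis L0 : 0 < L.

Let nu z : R := lamnorm (u (coordN z)).
Let f z : R := if L < nu z then nu z else 0.
Let W J (x : 'rV[R]_N) := fext (u x) J.

Let mu_ I : measurable_fun Q (fun z => u (coordN z) I).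
Proof. by case: Lu => -[]. Qed.

Let mnu : measurable_fun Q nu.
Proof. exact: measurable_lamnorm. Qed.

Let inu : integ nu.
Proof.
apply/integrableP; split; first exact/measurable_EFinP.
case: Lu => _; under [X in (X < _)%E -> _]eq_integral do rewrite -[X in X%:E]ger0_norm ?lamnorm_ge0//.
by [].
Qed.

Let f0 z : 0 <= f z.
Proof. by rewrite /f; case: ifP => // _; exact: lamnorm_ge0. Qed.

Let mA : measurable (Q `&` [set z | L < nu z]).
Proof.
have := mnu mQ (measurable_itv `]L, +oo[).
rewrite (_ : nu @^-1` _ = [set z | L < nu z])//.
by apply/seteqP; split => z /=; rewrite in_itv/= andbT.
Qed.

Let mf : measurable_fun Q f.
Proof.
apply: (eq_measurable_fun (fun z => nu z * \1_(Q `&` [set z | L < nu z]) z)).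
  move=> z /set_mem Qz; rewrite /f indicE; case: ifPn => h.
    by rewrite mem_set ?mulr1.
  by rewrite memNset ?mulr0// => -[_]; exact/negP.
by apply: measurable_funM => //; exact: measurable_indic.
Qed.

Let f_le_nu z : f z <= nu z.
Proof. by rewrite /f; case: ifP => // _; exact: lamnorm_ge0. Qed.

Let if_ : integ f.
Proof. by apply: (integ_dominated _ _ _ inu) => // z _; rewrite ger0_norm. Qed.

Let nu_le z : nu z <= f z + L.
Proof. by rewrite /f; case: ltP => h; [rewrite lerDl ltW|rewrite add0r]. Qed.

Let fE : (\int[mu]_(z in Q `&` [set z | (L < nu z)%R]) (nu z)%:E = \int[mu]_(z in Q) (f z)%:E)%E.
Proof.
rewrite integral_mkcondr; apply: eq_integral => z _; rewrite /patch /f.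
case: ifPn => [|]; first by rewrite inE/= => ->.
by rewrite notin_setE/= => /negP/negbTE ->.
Qed.

Let iU J : integ (fun z => W J (coordN z)).
Proof.
by apply: (integ_dominated _ _ _ inu) => // [|z _]; [exact: measurable_fext|exact: normr_fext_le].
Qed.

Let clU : wclosed (fun J z => W J (coordN z)).
Proof. exact: dclosed_wclosed. Qed.

Let pW J : Zperiodic (W J).
Proof. by move=> k x; rewrite /W; case: Lu => -[-> _]. Qed.

Let UfL J z : Q z -> `|W J (coordN z)| <= f z + L.
Proof. by move=> _; exact: le_trans (normr_fext_le _ _) (nu_le z). Qed.

Let fi : (\int[mu]_(z in Q) (f z)%:E < +oo)%E.
Proof. by rewrite ltey_eq (integrable_fin_num mQ if_). Qed.

Definition excess : \bar R :=
  (\int[mu]_(z in Q `&` [set z | (L < lamnorm (u (coordN z)))%R]) (lamnorm (u (coordN z)))%:E)%E.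

Let excessE : excess = (\int[mu]_(z in Q) (f z)%:E)%E.
Proof. exact: fE. Qed.

(** For v = 0 the exceptional set has measure at most 1 < excess / L, and the integral of |u| is at
    most excess + L < 2 excess; hence the requirement on [C2]. *)
Lemma closed_truncation_large (C1 C2 : R) : 0 <= C1 -> 2 <= C2 -> (L%:E < excess)%E ->
  exists v : 'rV[R]_N -> lamform R N r,
    [/\ meas_form v, dclosed v,
     {ae mu, forall z, Q z -> lamnorm (v (coordN z)) <= C1 * L},
     (mu (Q `&` [set z | v (coordN z) <> u (coordN z)]) <= (C2 / L)%:E * excess)%E &
     (\int[mu]_(z in Q) (lamnorm (lamsub (v (coordN z)) (u (coordN z))))%:E <= C2%:E * excess)%E].
Proof.
move=> C10 C22 big; have CL : 0 <= C1 * L by rewrite mulr_ge0// ltW.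
have ex : (excess \is a fin_num)%E by rewrite excessE; exact: (integrable_fin_num mQ if_).
have ge : L <= fine excess by rewrite -lee_fin fineK// ltW.
exists (fun=> fun=> 0); split.
- by split.
- move=> s phi _ _; rewrite (eq_integral (cst 0%E)) ?integral0// => z _.
  by rewrite /wedge_top big1// => I _; rewrite mulr0.
- apply: aeW => z _; rewrite (_ : lamnorm _ = 0)//.
  by rewrite /lamnorm big1 ?sqrtr0// => I _; rewrite expr0n.
- apply: (@le_trans _ _ 1%E).
    rewrite -(lebN_cubeN R N); apply: le_measure; rewrite ?inE//.
    exact: (@measurable_neq_form _ _ _ (fun=> fun=> 0)).
  rewrite -(fineK ex) -EFinM lee_fin mulrAC ler_pdivlMr// mul1r (le_trans ge)//.
  by rewrite ler_peMl ?(le_trans _ C22) ?(le_trans _ ge) ?ler1n// ltW.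
- have E z : lamnorm (lamsub (fun=> 0) (u (coordN z))) = nu z.
    by congr Num.sqrt; apply: eq_bigr => I _; rewrite /lamsub sub0r sqrrN.
  under eq_integral do rewrite E.
  apply: (@le_trans _ _ (\int[mu]_(z in Q) ((f z)%:E + L%:E))%E).
    apply: ge0_le_integral => //.
    - by move=> z _; rewrite lee_fin lamnorm_ge0.
    - exact/measurable_EFinP.
    - by apply: emeasurable_funD => //; exact/measurable_EFinP.
    - by move=> z _; rewrite -EFinD lee_fin.
  rewrite ge0_integralD//; [|by move=> z _; rewrite lee_fin|exact/measurable_EFinP|by move=> z _; rewrite lee_fin ltW].
  have -> : (\int[mu]_(_ in Q) L%:E = L%:E)%E.
    rewrite integral_cst// -[RHS]mule1; congr (_ * _)%E; exact: lebN_cubeN.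
  rewrite -excessE -(fineK ex) -EFinD -EFinM lee_fin.
  have e0 : 0 <= fine excess by rewrite (le_trans _ ge)// ltW.
  have : 2 * fine excess <= C2 * fine excess by rewrite ler_wpM2r.
  by move: ge => /=; lra.
Qed.

(** The number K of components converts componentwise bounds into bounds of the norm. Where v
    differs from u, |v - u| <= K (Cinf L + f + L); integrating this with the bound 60^N excess / L
    for the bad set gives the last constant. *)
Lemma closed_truncation_small (B : R) : (0 < N)%N -> 1 <= B ->
  (forall t, `|derive1 (@sstep R) t| <= B) -> (excess <= L%:E)%E ->
  let K := #|{: kset N r}|%:R in
  exists v : 'rV[R]_N -> lamform R N r,
    [/\ meas_form v, dclosed v,
     {ae mu, forall z, Q z -> lamnorm (v (coordN z)) <= K * Cinf N B * L},
     (mu (Q `&` [set z | v (coordN z) <> u (coordN z)]) <= (60 ^+ N / L)%:E * excess)%E &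
     (\int[mu]_(z in Q) (lamnorm (lamsub (v (coordN z)) (u (coordN z))))%:E
       <= (K * (Cinf N B + 1) * 60 ^+ N + K)%:E * excess)%E].
Proof.
move=> N0 B1 dB; rewrite excessE => fL K.
pose vv J x := vlim W f L J x; pose v x : lamform R N r := fun I => vv (val I) x.
have mv J : measurable_fun Q (fun z => vv J (coordN z)) by exact: measurable_vlim.
have iv J : integ (fun z => vv J (coordN z)) by exact: (integ_vlim N0 B1 dB).
have pv J : Zperiodic (vv J) by exact: Zperiodic_vlim.
have clv : wclosed (fun J z => vv J (coordN z)) by exact: (wclosed_vlim N0 B1 dB).
have fv x J : #|J| = r -> fext (v x) J = vv J x.
  by move=> /eqP Jr; rewrite (fext_Sub _ Jr).
have stopE z : Q z -> ~ badset f L z -> v (coordN z) = u (coordN z).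
  move=> Qz nb; apply/funext => I; rewrite /v /vv vlim_nstop; first by rewrite /W fext_in.
  by move=> [j sz]; apply: nb; exact: stop_badset sz.
have mvu : measurable_fun Q (fun z => lamnorm (lamsub (v (coordN z)) (u (coordN z)))).
  apply: (@measurable_lamnorm _ _ _ (fun x => lamsub (v x) (u x))) => I.
  by apply: measurable_funB => //; exact: mv.
have mb := measurable_badset f L; have lb := lebN_badset_le L0 f0 mf fi.
exists v; split.
- split => [k x|I]; last exact: mv.
  by apply/funext => I; exact: pv.
(* [v] keeps only the components of [vv] on sets of size r. The identity for J involves sets of size
   #|J| - 1, so it is inherited when #|J| = r + 1 and has only zero terms otherwise. *)
- apply: wclosed_dclosed => [J|g sg pg J].
    have [Jr|Jr] := eqVneq #|J| r.
      by apply: integ_eq (iv J) => // z _; rewrite fv.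
    apply: (@integ_eq _ _ _ _ _ mQ (fun z => 0 * vv J (coordN z))); last exact: integZ.
    by move=> z _; rewrite fext_out// mul0r.
  have [Jr|Jr] := eqVneq #|J| r.+1.
    rewrite -[RHS](clv g sg pg J); apply: eq_bigr => k kJ; congr (_ * _).
    apply: eq_Rintegral => z _; rewrite fv//.
    by move: Jr; rewrite (cardsD1 k) kJ => -[].
  rewrite big1// => k kJ; rewrite Rintegral0_eq ?mulr0// => z _.
  rewrite fext_out ?mulr0//; apply: contra_neq Jr => Jr.
  by rewrite (cardsD1 k) kJ Jr.
- have h : {ae mu, forall z, forall I : kset N r, Q z -> `|vv (val I) (coordN z)| <= Cinf N B * L}.
    apply: filter_forall => I; exact: (vlim_le_ae N0 B1 dB).
  by apply: filterS h => z h Qz; rewrite -mulrA; apply: lamnorm_le_card => I; exact: h.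
- apply: le_trans lb; apply: le_measure; rewrite ?inE//.
    by apply: measurable_neq_form => // I; exact: mv.
  move=> z [Qz zn]; apply: contrapT => nb; apply: zn; exact: stopE.
have K0 : 0 <= K by rewrite ler0n.
have C0 : 0 <= Cinf N B by rewrite addr_ge0 ?Cmoll_ge0// mulr_ge0 ?Ccut_ge0.
(* The constant part K (Cinf L + L) of the bound for |v - u|, charged to the bad set only; the part
   K f is integrated over the whole cube. *)
set a := K * (Cinf N B + 1) * L.
have C1 : 0 <= Cinf N B + 1 by exact: addr_ge0.
have a0 : 0 <= a by exact: mulr_ge0 (mulr_ge0 K0 C1) (ltW L0).
have m1 : measurable_fun Q (fun z => a%:E * (\1_(badset f L) z)%:E)%E.
  by apply: emeasurable_funM => //; apply/measurable_EFinP; exact: measurable_indic.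
have m2 : measurable_fun Q (fun z => K%:E * (f z)%:E)%E.
  by apply: emeasurable_funM => //; exact/measurable_EFinP.
apply: (@le_trans _ _ (\int[mu]_(z in Q) (a%:E * (\1_(badset f L) z)%:E + K%:E * (f z)%:E))%E).
  apply: ge0_le_integral => //.
  - by move=> z _; rewrite lee_fin lamnorm_ge0.
  - exact/measurable_EFinP.
  - exact: emeasurable_funD.
  move=> z Qz; rewrite -!EFinM -EFinD lee_fin indicE.
  have [[j sz]|ns] := pselect (stopped f L (coordN z)).
    rewrite mem_set ?mulr1/=; last exact: stop_badset sz.
    rewrite (_ : a + K * f z = K * (Cinf N B * L + (f z + L))); last by rewrite /a; ring.
    apply: lamnorm_le_card => I; rewrite (le_trans (ler_normB _ _))// lerD//.
      by apply: (vlim_stopped_le N0 B1 dB) => //; exists j.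
    exact: le_trans (le_lamnorm _ I) (nu_le z).
  rewrite (_ : lamnorm _ = 0); first by exact: addr_ge0 (mulr_ge0 a0 (ler0n _ _)) (mulr_ge0 K0 (f0 z)).
  rewrite /lamnorm big1 ?sqrtr0// => I _.
  by rewrite /lamsub /v /vv vlim_nstop// /W fext_in subrr expr0n.
rewrite ge0_integralD//; last 2 first.
- by move=> z _; rewrite -EFinM lee_fin; exact: mulr_ge0 a0 (ler0n _ _).
- by move=> z _; rewrite -EFinM lee_fin; exact: mulr_ge0 K0 (f0 z).
rewrite ge0_integralZl_EFin//; last first.
  by apply/measurable_EFinP; exact: measurable_indic.
rewrite integral_indic// ge0_integralZl_EFin//; last 2 first.
- by move=> z _; rewrite lee_fin.
- exact/measurable_EFinP.
have ex : ((\int[mu]_(z in Q) (f z)%:E)%E \is a fin_num)%E by exact: (integrable_fin_num mQ if_).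
have mbQ : (mu (badset f L `&` Q) <= (60 ^+ N / L)%:E * \int[mu]_(z in Q) (f z)%:E)%E.
  by apply: le_trans lb; apply: le_measure; rewrite ?inE//; exact: measurableI.
apply: (@le_trans _ _ (a%:E * ((60 ^+ N / L)%:E * \int[mu]_(z in Q) (f z)%:E)
   + K%:E * \int[mu]_(z in Q) (f z)%:E)%E).
  by rewrite leeD2r// lee_wpmul2l.
rewrite -(fineK ex) -!EFinM -EFinD lee_fin le_eqVlt; apply/orP; left; apply/eqP.
by rewrite /a; field; rewrite gt_eqF.
Qed.

End closed_truncation.

Theorem theorem4p1 (R : realType) (N r : nat) :
  (1 <= N)%N -> (r <= N)%N ->
  exists C1 C2 : R, 0 < C1 /\ 0 < C2 /\
  forall u : 'rV[R]_N -> lamform R N r,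
    L1form u -> dclosed u ->
  forall L : R, 0 < L ->
  exists v : 'rV[R]_N -> lamform R N r,
    [/\ meas_form v, dclosed v,
     (* (i) v in L^infty with ||v||_infty <= C1 L *)
     {ae lebN R N, forall x, cubeN R N x -> (lamnorm (v (coordN x)) <= C1 * L)%R},
     (* (ii) *)
     (lebN R N (cubeN R N `&` [set x | v (coordN x) <> u (coordN x)])
        <= (C2 / L)%:E *
           \int[lebN R N]_(x in cubeN R N `&` [set x | (L < lamnorm (u (coordN x)))%R])
              (lamnorm (u (coordN x)))%:E)%E &
     (* (iii) *)
     (\int[lebN R N]_(x in cubeN R N) (lamnorm (lamsub (v (coordN x)) (u (coordN x))))%:E
        <= C2%:E *
           \int[lebN R N]_(x in cubeN R N `&` [set x | (L < lamnorm (u (coordN x)))%R])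
              (lamnorm (u (coordN x)))%:E)%E].
Proof.
move=> N0 _.
(* The bound belongs to the fixed step function, so the constants depend only on N and r. *)
have [B' dB'] := @derive_sstep_bounded R; pose B := 1 + `|B'|.
have B1 : 1 <= B by rewrite lerDl.
have dB t : `|derive1 (@sstep R) t| <= B.
  by rewrite (le_trans (dB' t))// (le_trans (ler_norm _))// lerDr.
pose K : R := #|{: kset N r}|%:R.
have K0 : 0 <= K by rewrite ler0n.
have C0 : 0 <= Cinf N B by rewrite addr_ge0 ?Cmoll_ge0// mulr_ge0 ?Ccut_ge0.
have p0 : 0 <= 60 ^+ N :> R by rewrite exprn_ge0.
pose c := K * (Cinf N B + 1) * 60 ^+ N + K.
have c0 : 0 <= c by exact: addr_ge0 (mulr_ge0 (mulr_ge0 K0 (addr_ge0 C0 ler01)) p0) K0.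
have KC : 0 <= K * Cinf N B by exact: mulr_ge0.
(* The added 1 makes the first constant positive. The second majorizes the constants of both
   estimates in the small case, and its 2 is what the case v = 0 asks for. *)
exists (K * Cinf N B + 1), (c + 60 ^+ N + 2); split; first by rewrite ltr_wpDl.
split; first by rewrite ltr_wpDl// addr_ge0.
move=> u Lu du L L0; rewrite -/(excess u L).
have e0 : (0 <= excess u L)%E by apply: integral_ge0 => z _; rewrite lee_fin lamnorm_ge0.
have [big|small] := ltP L%:E (excess u L).
  by apply: closed_truncation_large => //; [exact: addr_ge0|rewrite lerDr addr_ge0].
have [v [mv dv v1 v2 v3]] := closed_truncation_small Lu du L0 N0 B1 dB small.
exists v; split => //.
- apply: filterS v1 => z h Qz; apply: (le_trans (h Qz)).
  by rewrite ler_wpM2r ?(ltW L0)// lerDl.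
- apply: (le_trans v2); rewrite lee_wpmul2r// lee_fin ler_wpM2r ?invr_ge0 ?(ltW L0)//.
  by rewrite -addrA addrCA lerDl addr_ge0.
- apply: (le_trans v3); rewrite lee_wpmul2r// lee_fin -/K -/c -addrA lerDl.
  exact: addr_ge0.
Qed.
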